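(* Let $\mathbb{K}$ be an algebraically closed field. For $3\le k\le 5$, let $X_k\subset\mathbb{P}^{k+3}$ be a smooth $k$-dimensional linear section of the Plücker embedding $\mathbb{G}(1,\mathbb{P}^4)\subset\mathbb{P}^9$ of the Grassmannian of lines in $\mathbb{P}^4$ over $\mathbb{K}$. Then $$\text{rank-index}(X_k)=\begin{cases}6 & \text{if } k=4,5,\\ 5 & \text{if } k=3.\end{cases}$$
   Context: A $k$-dimensional linear section of $\mathbb{G}(1,\mathbb{P}^4)$ (which has dimension $6$) is the (scheme-theoretic) intersection of $\mathbb{G}(1,\mathbb{P}^4)$ with a linear subspace $\mathbb{P}^{k+3}\subset\mathbb{P}^9$, the intersection having dimension $k$. The homogeneous ideal of $X_k$ in $\mathbb{P}^{k+3}$ is generated by quadratic forms. The rank of a quadratic form is the rank of its associated symmetric matrix. $\text{rank-index}(X)$ is the smallest integer $m$ such that the homogeneous ideal $I(X)$ can be generated by quadratic forms of rank at most $m$.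
   Formalization: The field is additionally assumed to have characteristic different from 2, since the rank of a quadratic form as the rank of its associated symmetric matrix is not defined in characteristic 2 (e.g. xy has no symmetric matrix). *)

(* Defs.v *)
From HB Require Import structures.
From mathcomp Require Import all_boot all_order all_algebra.
From mathcomp.multinomials Require Import mpoly.

Set Implicit Arguments.
Unset Strict Implicit.
Unset Printing Implicit Defensive.

Import GRing.Theory.
Local Open Scope ring_scope.

(* Points of P^(n-1) are represented by nonzero row vectors, all nonzero       *)
(* multiples of a vector being representatives of the same point. A subset of  *)
(* P^(n-1) is the predicate satisfied by all the representatives of its points.*)

Section Projective.

Variables (K : closedFieldType) (n : nat).
Implicit Types (F I : {mpoly K[n]} -> Prop) (X Z : 'rV[K]_n -> Prop).

Definition zeros F : 'rV[K]_n -> Prop :=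
  fun x => x != 0 /\ forall f, F f -> f.@[x ord0] = 0.

(* K is infinite, so a polynomial vanishes at all the representatives of the   *)
(* points of X if and only if all its homogeneous components do: this is the   *)
(* homogeneous ideal of X.                                                     *)
Definition vanishing_ideal X : {mpoly K[n]} -> Prop :=
  fun f => forall x, X x -> f.@[x ord0] = 0.

Definition subset_pred X Z : Prop := forall x, X x -> Z x.

Definition proj_closed Z : Prop :=
  exists F, (forall f, F f -> exists d, f \is d.-homog) /\
            (forall x, Z x <-> zeros F x).

Definition proj_irreducible Z : Prop :=
  [/\ proj_closed Z, (exists x, Z x)
    & forall Z1 Z2, proj_closed Z1 -> proj_closed Z2 ->
        (forall x, Z x -> Z1 x \/ Z2 x) ->
        subset_pred Z Z1 \/ subset_pred Z Z2].

Definition irr_chain X (C : nat -> 'rV[K]_n -> Prop) (d : nat) : Prop :=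
  (forall i, (i <= d)%N -> proj_irreducible (C i) /\ subset_pred (C i) X) /\
  (forall i, (i < d)%N ->
     subset_pred (C i) (C i.+1) /\ ~ subset_pred (C i.+1) (C i)).

(* Krull dimension of a closed subset. *)
Definition proj_dim X (d : nat) : Prop :=
  (exists C, irr_chain X C d) /\
  (forall e C, irr_chain X C e -> (e <= d)%N).

(* Krull dimension of the local ring of X at x: only the chains of irreducible *)
(* closed subsets through x are considered.                                    *)
Definition local_dim X (x : 'rV[K]_n) (d : nat) : Prop :=
  (exists C, irr_chain X C d /\ C 0%N x) /\
  (forall e C, irr_chain X C e -> C 0%N x -> (e <= d)%N).

(* The Zariski tangent space at x of the affine cone over the scheme defined   *)
(* by I; its dimension is one more than that of the tangent space of the       *)
(* projective scheme.                                                          *)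
Definition cone_tangent I (x v : 'rV[K]_n) : Prop :=
  forall f, I f -> \sum_(i < n) (f^`M(i)).@[x ord0] * v ord0 i = 0.

Definition tangent_dim I (x : 'rV[K]_n) (d : nat) : Prop :=
  exists2 B : 'M[K]_(d.+1, n), row_free B
    & forall v, cone_tangent I x v <-> (v <= B)%MS.

(* Smoothness of the subscheme of P^(n-1) defined by the homogeneous ideal I:  *)
(* as K is algebraically closed, it can be tested on K-points.                 *)
Definition smooth_scheme I : Prop :=
  forall x, zeros I x -> exists2 d, local_dim (zeros I) x d & tangent_dim I x d.

Definition ideal_generated (S : {mpoly K[n]} -> Prop) : {mpoly K[n]} -> Prop :=
  fun f => exists2 s : seq ({mpoly K[n]} * {mpoly K[n]}),
    (forall c, c \in s -> S c.2) & f = \sum_(c <- s) c.1 * c.2.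

(* The symmetric matrix M such that q(x) = x M x^T; 2 must be invertible in K. *)
Definition quad_mx (q : {mpoly K[n]}) : 'M[K]_n :=
  \matrix_(i, j) (if i == j then q@_(U_(i) + U_(i))%MM else q@_(U_(i) + U_(j))%MM / 2).

Definition quad_rank (q : {mpoly K[n]}) : nat := \rank (quad_mx q).

Definition generated_by_rank_le I (m : nat) : Prop :=
  exists S : {mpoly K[n]} -> Prop,
    (forall q, S q -> q \is 2.-homog /\ (quad_rank q <= m)%N) /\
    (forall f, I f <-> ideal_generated S f).

Definition rank_index X (m : nat) : Prop :=
  generated_by_rank_le (vanishing_ideal X) m /\
  (forall m', generated_by_rank_le (vanishing_ideal X) m' -> (m <= m')%N).

End Projective.

Section Grassmannian.

Variable K : closedFieldType.

(* The pairs of columns, in the order 01 02 03 04 12 13 14 23 24 34. *)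
Definition pcol1 (a : 'I_10) : 'I_5 :=
  inord (nth 0 [:: 0; 0; 0; 0; 1; 1; 1; 2; 2; 3] a)%N.
Definition pcol2 (a : 'I_10) : 'I_5 :=
  inord (nth 0 [:: 1; 2; 3; 4; 2; 3; 4; 3; 4; 4] a)%N.

(* The Pluecker coordinates of the line of P^4 spanned by the rows of M. *)
Definition plucker (M : 'M[K]_(2, 5)) : 'rV[K]_10 :=
  \row_a (M 0 (pcol1 a) * M 1 (pcol2 a) - M 0 (pcol2 a) * M 1 (pcol1 a)).

(* All the representatives of a point of G(1,P^4) are obtained, by rescaling a *)
(* row of M.                                                                   *)
Definition grassmannian : 'rV[K]_10 -> Prop :=
  fun p => exists2 M : 'M[K]_(2, 5), row_free M & p = plucker M.

(* The linear subspace P^(n-1) of P^9 spanned by the rows of a row-free A is   *)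
(* given the coordinates x |-> x *m A; linear_section_ideal A is the ideal of  *)
(* K[x_0,..,x_(n-1)] obtained by restricting to it the ideal of G(1,P^4), that *)
(* is, the ideal defining the scheme-theoretic intersection.                   *)
Definition linear_forms n (A : 'M[K]_(n, 10)) : 10.-tuple {mpoly K[n]} :=
  [tuple \sum_(i < n) A i a *: 'X_i | a < 10].

Definition linear_section_ideal n (A : 'M[K]_(n, 10)) : {mpoly K[n]} -> Prop :=
  fun f => exists2 g, vanishing_ideal grassmannian g & f = g \mPo linear_forms A.

(* The set of closed points. When the scheme is smooth it is reduced, and its  *)
(* homogeneous ideal is the vanishing ideal of this set.                       *)
Definition linear_section n (A : 'M[K]_(n, 10)) : 'rV[K]_n -> Prop :=
  zeros (linear_section_ideal A).

End Grassmannian.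

(* Main.v *)
(* For p in the space of bivectors of V = K^5 and v in V, let Q_v(p) be the    *)
(* volume of p /\ p /\ v; these are the Pluecker quadrics. Let N be the space  *)
(* of equations of the linear space L spanned by the section, viewed as        *)
(* 2-forms on V.                                                               *)
(* - If some nonzero x in N had rank 2, then the tangent space of the          *)
(*   Grassmannian at some point of the section would be contained in the       *)
(*   hyperplane x = 0, and the section would be singular there. Hence every    *)
(*   nonzero x in N has rank 4, with a kernel spanned by kap x = x /\ x.       *)
(* - The restriction of Q_v to L has rank 6 if no nonzero x in N kills v, and  *)
(*   rank 5 otherwise. The vectors killed by some x span a space of dimension  *)
(*   1 if k = 5 and at most 3 if k = 4, so that the quadrics of rank at most 5 *)
(*   do not generate; for k = 3 they span V and there is no smaller rank.      *)
(* - The ideal of the section is generated by the quadrics. For this, N is     *)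
(*   put in a normal form in which the chart p_01 != 0 of the section is an    *)
(*   affine space for k = 4, 5, and a quadric hypersurface without multiple    *)
(*   component for k = 3. For k = 4, the hyperplane section p_01 = 0 is a      *)
(*   rational variety, whose ideal is found by cutting by two more hyperplanes *)
(*   down to a twisted cubic; each step lifts back because the ideals are      *)
(*   prime. The case k = 5 is lifted from k = 4 in the same way, and k = 3     *)
(*   follows since p_01 is regular modulo the ideal.                           *)
Require Import Defs.
From HB Require Import structures.
From mathcomp Require Import all_boot all_order all_algebra.
From mathcomp.multinomials Require Import mpoly.
From mathcomp Require Import ring.
Import GRing.Theory.
Local Open Scope ring_scope.

Set Implicit Arguments.
Unset Strict Implicit.
Unset Printing Implicit Defensive.

(** Once the ideal of the section is known to be generated by the restricted Pluecker quadrics, its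
    degree 2 part is the space of restrictions of the [Q_v], and the rank index depends only on
    which vectors v give a low rank: [section_generated] and [section_not_generated] turn the span
    of these v into bounds. The matrix [hodge_mx v] of [Q_v] on P^9 has rank 6 and its image
    consists of the 2-forms killed by v, so restriction loses rank exactly when a nonzero equation
    in N kills v ([section_rank_ge6], [section_rank_ge5], [section_rank_le5]). Such a v is a
    multiple of a value of the quadratic map [kap] on N. These values span at most a line or a
    3-space when N has dimension 1 or 2, and all of V when N has dimension 3 ([net_kap_span]).

    Smoothness enters only through [smooth_rank4_forms]. It allows N to be put in a normal form by
    GL_5 ([rank4_normal_form], [pencil_normal_form], [net_normal_form]), for which [ideal5],
    [ideal4] and [ideal3] compute the ideal; [section_ideal_vanishing] brings the result back to the
    coordinates of the section. The first two ideals are kernels of explicit parametrisations,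
    reached from the twisted cubic by repeated use of [kernel_lift]; the third comes from a double
    cover of an affine space. *)

Section Evaluation.

Variables (K : closedFieldType) (n : nat).
Implicit Types (f g : {mpoly K[n]}).

(** * Polynomials determined by their values *)

Lemma digits_inj m N (a b : 'I_m -> nat) :
  (forall i, a i < N)%N -> (forall i, b i < N)%N ->
  (\sum_(i < m) a i * N ^ i = \sum_(i < m) b i * N ^ i)%N -> a =1 b.
Proof.
elim: m a b => [|m IH] a b aN bN; first by move=> _ [].
rewrite !big_ord_recl /= !expn0 !muln1.
have E (c : 'I_m.+1 -> nat) :
    (\sum_(i < m) c (lift ord0 i) * N ^ bump 0 i =
     N * \sum_(i < m) c (lift ord0 i) * N ^ i)%N.
  by rewrite big_distrr; apply: eq_bigr => i _; rewrite /bump expnS mulnCA.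
rewrite !E => e.
have N0 : (0 < N)%N by apply: leq_ltn_trans (aN ord0).
have e0 : a ord0 = b ord0.
  move: (congr1 (modn^~ N) e); rewrite !(addnC (_ ord0)) !(mulnC N).
  by rewrite !modnMDl !modn_small.
move: e; rewrite e0 => /addnI /eqP; rewrite eqn_pmul2l // => /eqP e.
have {}IH := IH _ _ (fun i => aN (lift ord0 i)) (fun i => bN (lift ord0 i)) e.
move=> i; case: (unliftP ord0 i) => [j ->|->] //; exact: IH.
Qed.

(* Kronecker substitution reduces the claim to one variable. *)
Lemma mpoly_eval0 f : (forall x, f.@[x] = 0) -> f = 0.
Proof.
move=> f0; apply/eqP/negPn/negP => fn0.
pose N := msize f.
pose k (m : 'X_{1..n}) := (\sum_(i < n) m i * N ^ i)%N.
pose p : {poly K} := \sum_(m <- msupp f) f@_m *: 'X^(k m).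
have pE t : p.[t] = f.@[fun i => t ^+ (N ^ i)].
  rewrite mevalE /p horner_sum; apply: eq_bigr => m _.
  rewrite hornerZ hornerXn /k expr_sum; congr (_ * _).
  by apply: eq_bigr => i _; rewrite mulnC exprM.
have p0 : p = 0.
  apply/eqP/negPn/negP => /closed_nonrootP[t].
  by rewrite /root pE f0 eqxx.
have [m mf] : {m | m \in msupp f}.
  move: fn0; rewrite -msupp_eq0; case: (msupp f) => // m s _.
  by exists m; rewrite inE eqxx.
have digN m' : m' \in msupp f -> forall i, (m' i < N)%N.
  move=> m'f i; apply: leq_ltn_trans (msize_mdeg_lt m'f).
  by rewrite mdegE (bigD1 i) //= leq_addr.
have := congr1 (fun q : {poly K} => q`_(k m)) p0.
rewrite /p coef0 coef_sum (bigD1_seq m) ?msupp_uniq //= coefZ coefXn eqxx mulr1.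
rewrite big_seq_cond big1 ?addr0 => [/eqP|m' /andP[m'f m'm]].
  by rewrite mcoeff_eq0 mf.
rewrite coefZ coefXn; case: eqP => [e|]; last by rewrite mulr0.
case/eqP: m'm; apply/mnmP => i; apply/esym.
exact: digits_inj (digN _ mf) (digN _ m'f) e i.
Qed.

(** A nonempty open set is dense: f g vanishes everywhere, and polynomials form a domain. *)
Lemma mpoly_eval_dense f g :
  g != 0 -> (forall x, g.@[x] != 0 -> f.@[x] = 0) -> f = 0.
Proof.
move=> g0 fg; have : f * g = 0.
  apply: mpoly_eval0 => x; rewrite mevalM.
  by have [->|/fg->] := eqVneq g.@[x] 0; rewrite ?mulr0 ?mul0r.
by move/eqP; rewrite mulf_eq0 (negPf g0) orbF => /eqP.
Qed.

End Evaluation.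

(** * Homogeneous components *)

Section Homogeneous.

Variables (K : closedFieldType) (n : nat).
Implicit Types (f g : {mpoly K[n]}).

Lemma pihomog_mulr d e f g : g \is e.-homog ->
  pihomog mdeg d (f * g) =
  if (e <= d)%N then pihomog mdeg (d - e) f * g else 0.
Proof.
move=> gh; elim/mpolyind: f => [|c m f _ _ IH].
  by rewrite mul0r !pihomog0 mul0r if_same.
rewrite mulrDl !linearD /= IH -scalerAl !linearZ /=.
have H : 'X_[m] * g \is (mdeg m + e).-homog.
  by apply: dhomogM => //; rewrite dhomogX.
have -> : pihomog mdeg d ('X_[m] * g) =
    if (e <= d)%N then pihomog mdeg (d - e) 'X_[m] * g else 0.
  rewrite pihomogX; case: leqP => ed.
    have [<-|dm] := eqVneq (mdeg m + e)%N d.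
      by rewrite addnK eqxx pihomog_dE.
    rewrite (pihomog_ne0 _ H) // ifN ?mul0r //.
    by apply: contraNneq dm => ->; rewrite subnK.
  by rewrite (pihomog_ne0 _ H) // gtn_eqF // (leq_trans ed) // leq_addl.
by case: leqP => _; rewrite ?scaler0 ?addr0 // mulrDl scalerAl.
Qed.

Lemma homog_eval f d x t : f \is d.-homog ->
  f.@[fun i => t * x i] = t ^+ d * f.@[x].
Proof.
move=> /dhomogP fh; rewrite !mevalE mulr_sumr; apply: eq_big_seq => m mf.
rewrite mulrCA; congr (_ * _).
under eq_bigr => i _ do rewrite exprMn.
by rewrite big_split /= -expr_sum; congr (_ ^+ _ * _); rewrite -mdegE; apply: fh.
Qed.

Lemma homog_mPo k d e (F : n.-tuple {mpoly K[k]}) f : f \is d.-homog ->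
  (forall i, tnth F i \is e.-homog) -> f \mPo F \is (e * d).-homog.
Proof.
move=> /dhomogP fh Fh; rewrite comp_mpolyEX big_seq.
apply: rpred_sum => m mf; apply: rpredZ; rewrite comp_mpolyX.
have <- : (\sum_i m i)%N = d by rewrite -mdegE; apply: fh.
have H (s : seq 'I_n) : \prod_(i <- s) tnth F i ^+ m i
    \is (e * \sum_(i <- s) m i).-homog.
  elim: s => [|i s IH]; first by rewrite !big_nil muln0 dhomog1.
  by rewrite !big_cons mulnDr; apply: dhomogM IH; apply: dhomogMn.
exact: H.
Qed.

(** On the line through x, f is a polynomial in t whose coefficients are the values at x of its
    homogeneous components; it has infinitely many roots. *)
Lemma cone_pihomog f x d :
  (forall t, f.@[fun i => t * x i] = 0) -> (pihomog mdeg d f).@[x] = 0.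
Proof.
move=> f0; pose p : {poly K} := \poly_(e < msize f) (pihomog mdeg e f).@[x].
have pE t : p.[t] = 0.
  rewrite -(f0 t) [in RHS](@pihomog_partitionE _ _ mdeg (msize f) f).
    rewrite raddf_sum horner_poly /=; apply: eq_bigr => e _.
    by rewrite (homog_eval _ _ (pihomogP mdeg e f)) mulrC.
  by rewrite leqnn.
have p0 : p = 0.
  apply/eqP/negPn/negP => /closed_nonrootP[t].
  by rewrite /root pE eqxx.
have [dl|dl] := ltnP d (msize f).
  by have := congr1 (fun q : {poly K} => q`_d) p0; rewrite coef_poly dl coef0.
rewrite pihomogE big1_seq ?meval0 // => m /andP[/eqP md mf].
by have := msize_mdeg_lt mf; rewrite md ltnNge dl.
Qed.

(* Ideals generated by finitely many polynomials *)
End Homogeneous.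

Section Ideals.

Variables (K : closedFieldType) (n : nat).
Implicit Types (f g q : {mpoly K[n]}) (G : seq {mpoly K[n]}).

(** The recursion makes a membership certificate a plain list of coefficients, one per generator in
    the order of G, given by [exists] and checked by [ring]. *)
Fixpoint idl G f : Prop :=
  if G is q :: G' then exists g, idl G' (f - g * q) else f = 0.

Arguments idl : simpl never.

Lemma idl0 G : idl G 0.
Proof. by elim: G => // q G IH; exists 0; rewrite mul0r subr0. Qed.

Lemma idlD G f g : idl G f -> idl G g -> idl G (f + g).
Proof.
elim: G f g => [|q G IH] f g => [->->|]; first by rewrite addr0.
case=> [a fa] [b gb]; exists (a + b).
by rewrite mulrDl opprD addrACA; apply: IH.
Qed.

Lemma idlMl G f g : idl G g -> idl G (f * g).
Proof.
elim: G g => [|q G IH] g => [->|]; first by rewrite mulr0.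
by case=> a ga; exists (f * a); rewrite -mulrA -mulrBr; apply: IH.
Qed.

Lemma idlN G f : idl G f -> idl G (- f).
Proof. by rewrite -mulN1r; apply: idlMl. Qed.

Lemma idlB G f g : idl G f -> idl G g -> idl G (f - g).
Proof. by move=> fG gG; apply: idlD fG (idlN gG). Qed.

Lemma idl_cons G q f : idl G f -> idl (q :: G) f.
Proof. by exists 0; rewrite mul0r subr0. Qed.

Lemma idl_consP G q f : idl (q :: G) f -> exists g, idl G (f - g * q).
Proof. exact. Qed.

Lemma idl_gen G q : q \in G -> idl G q.
Proof.
elim: G => // p G IH; rewrite inE => /orP[/eqP->|/IH qG].
  by exists 1; rewrite mul1r subrr; apply: idl0.
exact: idl_cons.
Qed.

Lemma idl_ind (P : {mpoly K[n]} -> Prop) G :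
  P 0 -> (forall f g, P f -> P g -> P (f + g)) ->
  (forall f q, q \in G -> P (f * q)) -> forall f, idl G f -> P f.
Proof.
move=> P0 PD; elim: G => [|q G IH] PG f; first by move->.
case=> a; rewrite -{2}(subrK (a * q) f) => fa; apply: PD.
  by apply: IH fa => g r rG; apply: PG; rewrite inE rG orbT.
by apply: PG; rewrite inE eqxx.
Qed.

Lemma idl_sub G G' f :
  (forall q, q \in G -> idl G' q) -> idl G f -> idl G' f.
Proof.
move=> GG'; apply: idl_ind => [||g q /GG'/idlMl]; [exact: idl0 | exact: idlD | exact].
Qed.

Lemma idl_pihomog G f d : (forall q, q \in G -> exists e, q \is e.-homog) ->
  idl G f -> idl G (pihomog mdeg d f).
Proof.
move=> Gh; move: f; apply: (idl_ind (P := fun f => idl G (pihomog mdeg d f))) => [||g q qG].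
- by rewrite pihomog0; apply: idl0.
- by move=> ??; rewrite pihomogD; apply: idlD.
have [e qh] := Gh q qG; rewrite (pihomog_mulr _ _ qh).
by case: ifP => _; [apply/idlMl/idl_gen | apply: idl0].
Qed.

End Ideals.

Arguments idl : simpl never.

(** Substitution respects congruence modulo the ideal, because sums and products do. *)
Lemma idl_subst (K : closedFieldType) n k G (F F' : n.-tuple {mpoly K[k]})
    (f : {mpoly K[n]}) :
  (forall i, idl G (tnth F i - tnth F' i)) -> idl G ((f \mPo F) - (f \mPo F')).
Proof.
move=> FF.
have S_mul a a' b b' : idl G (a - a') -> idl G (b - b') ->
    idl G (a * b - a' * b').
  have -> : a * b - a' * b' = b * (a - a') + a' * (b - b') by ring.
  by move=> A B; apply: idlD; apply: idlMl.
elim/mpolyind: f => [|c m f _ _ IH].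
  by rewrite !comp_mpoly0 subrr; apply: idl0.
rewrite !comp_mpolyD opprD addrACA; apply: idlD IH.
rewrite !comp_mpolyZ -scalerBr -mul_mpolyC; apply: idlMl.
rewrite !comp_mpolyX; elim/big_ind2: _ => [|a a' b b'|i _].
- by rewrite subrr; apply: idl0.
- by move=> A B; apply: S_mul.
elim: (m i) => [|e IHe]; first by rewrite !expr0 subrr; apply: idl0.
by rewrite !exprS; apply: S_mul.
Qed.

Lemma idl_mPo (K : closedFieldType) n k G (F : n.-tuple {mpoly K[k]}) f :
  idl G f -> idl [seq g \mPo F | g <- G] (f \mPo F).
Proof.
move: f; apply: (idl_ind (P := fun f => idl [seq g \mPo F | g <- G] (f \mPo F))) => [|g h|g q qG].
- by rewrite comp_mpoly0; apply: idl0.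
- by rewrite raddfD; apply: idlD.
by rewrite rmorphM; apply/idlMl/idl_gen/map_f.
Qed.

(** * Kernels of polynomial parametrisations *)

Section Substitution.

Variable K : closedFieldType.

Lemma mpoly_ring_ind n (P : {mpoly K[n]} -> Prop) :
  (forall c, P c%:MP) -> (forall i, P 'X_i) ->
  (forall f g, P f -> P g -> P (f + g)) ->
  (forall f g, P f -> P g -> P (f * g)) -> forall f, P f.
Proof.
move=> PC PX PD PM; elim/mpolyind => [|c m f _ _]; first by rewrite -mpolyC0.
move=> Pf; apply: PD Pf; rewrite -mul_mpolyC; apply: (PM) => //.
rewrite mpolyXE_id; apply: (big_ind P) => [||i _]; [by rewrite -mpolyC1 | exact: PM |].
elim: (m i) => [|e IH]; first by rewrite expr0 -mpolyC1.
by rewrite exprS; apply: PM.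
Qed.

(** An equation of the image of F holds on the image of F' as soon as the points of F' over the
    dense open set D != 0 lie in the image of F. *)
Lemma mPo_dense n k r (F : n.-tuple {mpoly K[k]}) (F' : n.-tuple {mpoly K[r]})
    (D : {mpoly K[r]}) f :
  D != 0 ->
  (forall x, D.@[x] != 0 ->
     exists z, forall i, (tnth F' i).@[x] = (tnth F i).@[z]) ->
  f \mPo F = 0 -> f \mPo F' = 0.
Proof.
move=> D0 FF' f0; apply: (mpoly_eval_dense D0) => x /FF'[z zx].
have := congr1 (meval z) f0; rewrite meval0 !comp_mpoly_meval => <-.
exact: meval_eq.
Qed.

(** F is congruent to the identity, so f is congruent to its substitution by F. *)
Lemma mPo_proj n G (F : n.-tuple {mpoly K[n]}) f :
  (forall i, idl G ('X_i - tnth F i)) -> f \mPo F = 0 -> idl G f.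
Proof.
move=> FG f0; have := @idl_subst _ _ _ G [tuple 'X_i | i < n] F f.
rewrite comp_mpoly_id f0 subr0; apply => i.
by rewrite tnth_mktuple.
Qed.

Lemma mPo_idl0 n k G (F : n.-tuple {mpoly K[k]}) f :
  (forall q, q \in G -> q \mPo F = 0) -> idl G f -> f \mPo F = 0.
Proof.
move=> G0; move: f; apply: (idl_ind (P := fun f => f \mPo F = 0)).
- exact: comp_mpoly0.
- by move=> f g f0 g0; rewrite comp_mpolyD f0 g0 addr0.
by move=> f q /G0 q0; rewrite rmorphM /= q0 mulr0.
Qed.

(* If l is not a zero divisor modulo the kernel of a parametrisation, then it *)
(* suffices to know the homogeneous elements of the kernel modulo l: divide   *)
(* by l and induct on the degree.                                             *)
Lemma kernel_lift n k (F : n.-tuple {mpoly K[k]}) G l :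
  (forall q, q \in G -> exists e, q \is e.-homog) -> l \is 1.-homog ->
  (forall q, q \in G -> q \mPo F = 0) -> l \mPo F != 0 ->
  (forall x t, exists y, forall i, (tnth F i).@[y] = t * (tnth F i).@[x]) ->
  (forall d f, f \is d.-homog -> f \mPo F = 0 -> idl (l :: G) f) ->
  forall f, f \mPo F = 0 -> idl G f.
Proof.
move=> Gh lh G0 l0 cone H.
have main d f : f \is d.-homog -> f \mPo F = 0 -> idl G f.
  elim: d f => [|d IH] f fh f0; have [g gG] := H _ _ fh f0;
    have := idl_pihomog _ Gh gG;
    rewrite -[f in X in X -> _](pihomog_dE fh).
    move/(_ 0%N); rewrite pihomogB pihomog_id (pihomog_mulr _ _ lh) subr0.
    by rewrite pihomog_dE.
  move/(_ d.+1); rewrite pihomogB pihomog_id (pihomog_mulr _ _ lh) subSS subn0.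
  rewrite (pihomog_dE fh) => fG.
  rewrite -(subrK (pihomog mdeg d g * l) f); apply: (idlD fG).
  rewrite mulrC; apply: idlMl; apply: IH (pihomogP _ _ _) _.
  have := mPo_idl0 G0 fG; rewrite raddfB /= rmorphM /= f0 sub0r => /eqP.
  by rewrite oppr_eq0 mulf_eq0 (negPf l0) orbF => /eqP.
move=> f f0.
rewrite (@pihomog_partitionE _ _ mdeg (msize f) f) //.
elim/big_ind: _ => [||e _]; [exact: idl0 | exact: idlD |].
apply: main (pihomogP _ _ _) _; apply: mpoly_eval0 => x.
rewrite comp_mpoly_meval; apply: cone_pihomog => t.
have [y yx] := cone x t.
have := congr1 (meval y) f0; rewrite meval0 comp_mpoly_meval => <-.
exact: meval_eq.
Qed.

(** The monomials 1, s^2 t and s t^2 are independent over K[s^3, t^3], as their exponents of s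
    differ modulo 3. *)
Lemma cube_independent (f0 f1 f2 : {mpoly K[2]})
    (C := [tuple 'X_ord0 ^+ 3; 'X_ord_max ^+ 3] : 2.-tuple {mpoly K[2]}) :
  (f0 \mPo C) + (f1 \mPo C) * ('X_ord0 ^+ 2 * 'X_ord_max)
    + (f2 \mPo C) * ('X_ord0 * 'X_ord_max ^+ 2) = 0 ->
  [/\ f0 = 0, f1 = 0 & f2 = 0].
Proof.
have CE (f : {mpoly K[2]}) : f \mPo C = \sum_(m <- msupp f) f@_m *: 'X_[(m *+ 3)%MM].
  rewrite comp_mpolyEX; apply: eq_bigr => m _; rewrite comp_mpolyX.
  congr (_ *: _); rewrite mpolyXE_id; apply: eq_bigr => i _.
  rewrite mulmnE mulnC exprM; congr (_ ^+ _).
  by case: i => [[|[|//]] ilt]; rewrite (tnth_nth 0) /=; congr ('X_ _ ^+ _);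
    apply: val_inj.
pose u1 : 'X_{1..2} := (U_(ord0) *+ 2 + U_(ord_max))%MM.
pose u2 : 'X_{1..2} := (U_(ord0) + U_(ord_max) *+ 2)%MM.
have co (f : {mpoly K[2]}) m (u v : 'X_{1..2}) a b : u ord0 = a -> v ord0 = b ->
    (a < 3)%N -> (b < 3)%N -> a <> b -> ((f \mPo C) * 'X_[u])@_(m *+ 3 + v)%MM = 0.
  move=> <- <- u3 v3 uv; rewrite CE mulr_suml raddf_sum /= big1 // => m' _.
  rewrite -scalerAl mcoeffZ -mpolyXD mcoeffX; case: eqP => [e|]; last by rewrite mulr0.
  case: uv; move: (congr1 (fun m : 'X_{1..2} => m ord0 %% 3)%N e).
  have DE (l r : 'X_{1..2}) : (l *+ 3 + r)%MM ord0 = (l ord0 * 3 + r ord0)%N.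
    by rewrite mnmDE mulmnE.
  by rewrite !DE !modnMDl !modn_small.
have cube_inj (m m' : 'X_{1..2}) : (m *+ 3 = m' *+ 3)%MM -> m = m'.
  move=> e; apply/mnmP => i; apply/eqP; rewrite -(eqn_pmul2r (isT : 0 < 3)%N).
  by rewrite -!mulmnE e.
have co1 (f : {mpoly K[2]}) m (u : 'X_{1..2}) :
    ((f \mPo C) * 'X_[u])@_(m *+ 3 + u)%MM = f@_m.
  rewrite addmC mcoeffMX CE raddf_sum /=.
  have [mf|mf] := boolP (m \in msupp f).
    rewrite (bigD1_seq m) ?msupp_uniq //= mcoeffZ mcoeffX eqxx mulr1.
    rewrite big1 ?addr0 // => m' m'm; rewrite mcoeffZ mcoeffX.
    case: eqP => [e|]; last by rewrite mulr0.
    case/eqP: m'm.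
    by apply: cube_inj e.
  rewrite (memN_msupp_eq0 mf) big1_seq // => m' /andP[_ m'f].
  rewrite mcoeffZ mcoeffX; case: eqP => [e|]; last by rewrite mulr0.
  case/negP: mf; suff -> : m = m' by [].
  by apply: cube_inj.
have -> : 'X_ord0 ^+ 2 * 'X_ord_max = 'X_[u1] :> {mpoly K[2]}.
  by rewrite /u1 mpolyXD -mpolyXn.
have -> : 'X_ord0 * 'X_ord_max ^+ 2 = 'X_[u2] :> {mpoly K[2]}.
  by rewrite /u2 mpolyXD -mpolyXn.
rewrite -[f0 \mPo C]mulr1 -[in (f0 \mPo C) * _]mpolyX0 => e.
have u10 : u1 ord0 = 2%N by rewrite /u1 mnmDE mulmnE !mnm1E.
have u20 : u2 ord0 = 1%N by rewrite /u2 mnmDE mulmnE !mnm1E.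
have u00 : (0%MM : 'X_{1..2}) ord0 = 0%N by rewrite mnm0E.
have cf m v : ((f0 \mPo C) * 'X_[0%MM])@_(m *+ 3 + v)%MM
    + ((f1 \mPo C) * 'X_[u1])@_(m *+ 3 + v)%MM
    + ((f2 \mPo C) * 'X_[u2])@_(m *+ 3 + v)%MM = 0 by rewrite -!mcoeffD e mcoeff0.
split; apply/mpolyP => m; rewrite mcoeff0.
- by move: (cf m 0%MM); rewrite co1 (co f1 _ _ _ _ _ u10 u00) // (co f2 _ _ _ _ _ u20 u00) // !addr0.
- by move: (cf m u1); rewrite co1 (co f0 _ _ _ _ _ u00 u10) // (co f2 _ _ _ _ _ u20 u10) // add0r addr0.
by move: (cf m u2); rewrite co1 (co f0 _ _ _ _ _ u00 u20) // (co f1 _ _ _ _ _ u10 u20) // !add0r.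
Qed.

End Substitution.

(* The Pluecker relation omitting the index j, up to sign. *)
Definition plk (R : comNzRingType) (x : nat -> R) : seq R :=
  [:: x 4%N * x 9%N - x 5%N * x 8%N + x 6%N * x 7%N;
      x 1%N * x 9%N - x 2%N * x 8%N + x 3%N * x 7%N;
      x 0%N * x 9%N - x 2%N * x 6%N + x 3%N * x 5%N;
      x 0%N * x 8%N - x 1%N * x 6%N + x 3%N * x 4%N;
      x 0%N * x 7%N - x 1%N * x 5%N + x 2%N * x 4%N].

Lemma ord10P (P : 'I_10 -> Prop) : (forall k, (k < 10)%N -> P (inord k)) -> forall i, P i.
Proof. by move=> H i; rewrite -(inord_val i); apply: H. Qed.

Lemma normal_form_add (R : comNzRingType) (f g a b c a' b' c' y z : R) :
  f + g - ((a + a') + (b + b') * y + (c + c') * z) =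
  f - (a + b * y + c * z) + (g - (a' + b' * y + c' * z)).
Proof. ring. Qed.

Lemma mul_congr (R : comNzRingType) (f g a b c : R) :
  f * g - c = g * (f - a) + a * (g - b) + (a * b - c).
Proof. ring. Qed.

Lemma nf_X7_identity (R : comNzRingType) (x0 x1 x2 x4 x5 x7 u v : R) :
  x0 * x7 - x1 * x5 + x2 * x4 - (x1 ^+ 2 - u - v * x1) + x1 * (x1 + x5) =
  x7 * x0 ^+ 1 - ((- x4 * x2 - u) + - v * x1).
Proof. ring. Qed.

Lemma nf_mul_identity (R : comNzRingType) (a b c d u v y : R) :
  b * d * (y ^+ 2 - u - v * y) = (a + b * y) * (c + d * y)
    - (a * c + u * (b * d) + (a * d + b * c + v * (b * d)) * y).
Proof. ring. Qed.

(** * Ideals of the sections in normal form *)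

Section SectionIdeals.

Variable K : closedFieldType.

Notation X k := ('X_(inord k) : {mpoly K[10]}).
Notation Z r k := ('X_(inord k) : {mpoly K[r.+1]}).

Definition tup r (s : seq {mpoly K[r]}) : 10.-tuple {mpoly K[r]} :=
  [tuple nth 0 s i | i < 10].

Lemma tnth_tup r (s : seq {mpoly K[r]}) i : tnth (tup s) i = nth 0 s i.
Proof. by rewrite tnth_mktuple. Qed.

Lemma X_tup r (s : seq {mpoly K[r]}) k : (k < 10)%N -> X k \mPo tup s = nth 0 s k.
Proof. by move=> k10; rewrite comp_mpolyXU -tnth_nth tnth_tup inordK. Qed.

Lemma comp_mpolyM n k (F : n.-tuple {mpoly K[k]}) : {morph comp_mpoly F : x y / x * y}.
Proof. exact: rmorphM. Qed.

Definition comp_simp n k := (@comp_mpolyD n K k, @comp_mpolyB n K k,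
  @comp_mpolyN n K k, @comp_mpolyM n k, X_tup).

Lemma mevalXn n (v : 'I_n -> K) p e : (p ^+ e).@[v] = p.@[v] ^+ e.
Proof. exact: rmorphXn. Qed.

Definition eval_simp n := (@mevalD n K, @mevalB n K, @mevalN n K, @mevalM n K,
  mevalXn, @mevalXU n K, @meval0 n K, @meval1 n K).

Lemma X_neq0 n i : ('X_i : {mpoly K[n]}) != 0.
Proof. by rewrite -msupp_eq0 msuppX. Qed.

Lemma X_homog n i : ('X_i : {mpoly K[n]}) \is 1.-homog.
Proof. by rewrite dhomogX; apply/eqP/mdeg1. Qed.

Lemma XX_homog n i j : ('X_i * 'X_j : {mpoly K[n]}) \is 2.-homog.
Proof. exact: dhomogM (X_homog i) (X_homog j). Qed.

Lemma plk_homog q : q \in plk (fun k => X k) -> q \is 2.-homog.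
Proof.
by rewrite !inE => /orP[|/orP[|/orP[|/orP[]]]] /eqP->;
  rewrite rpredD ?rpredB ?XX_homog.
Qed.

(* Equations of two hyperplanes, in a basis of K^5 in which they are omega0   *)
(* and omega1 below.                                                          *)
Definition L0 : {mpoly K[10]} := X 1 + X 5.
Definition L1 : {mpoly K[10]} := X 2 + X 6.

Lemma L0_homog : L0 \is 1.-homog. Proof. by rewrite rpredD ?X_homog. Qed.
Lemma L1_homog : L1 \is 1.-homog. Proof. by rewrite rpredD ?X_homog. Qed.

(** [I5] and [I4] define the sections for k = 5 and k = 4, and [I40] the hyperplane section p_01 = 0
    of the latter. The order of the generators fixes that of the coefficients in the certificates
    below. *)
Definition I5 : seq {mpoly K[10]} := L0 :: plk (fun k => X k).
Definition I4 := L1 :: I5.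
Definition I40 := X 0 :: I4.

Definition mixed_homog (G : seq {mpoly K[10]}) := forall q, q \in G -> exists e, q \is e.-homog.

Lemma mixed_cons q G e : q \is e.-homog -> mixed_homog G -> mixed_homog (q :: G).
Proof.
move=> qh Gh r; rewrite inE => /orP[/eqP->|]; last exact: Gh.
by exists e.
Qed.

Lemma I5_homog : mixed_homog I5.
Proof. by apply: mixed_cons L0_homog _ => q /plk_homog; exists 2. Qed.

Lemma I4_homog : mixed_homog I4.
Proof. exact: mixed_cons L1_homog I5_homog. Qed.

Lemma I40_homog : mixed_homog I40.
Proof. exact: mixed_cons (X_homog _) I4_homog. Qed.

(** The colon ideal (G : a) contains the ideal of H once it contains its generators. *)
Lemma idl_mul_sub (a g : {mpoly K[10]}) H G :
  (forall q, q \in H -> idl G (q * a)) -> idl H g -> idl G (g * a).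
Proof.
move=> HG; move: g; apply: (idl_ind (P := fun g => idl G (g * a))).
- by rewrite mul0r; apply: idl0.
- by move=> f g; rewrite mulrDl; apply: idlD.
by move=> f q /HG qa; rewrite -mulrA; apply: idlMl.
Qed.

Ltac in_cases := rewrite !inE; repeat case/orP; move/eqP->.

(* The affine cone over the rational normal cubic, in the coordinates 1 to 6. *)
Definition cubic : 10.-tuple {mpoly K[2]} :=
  let s := Z 1 0 in let t := Z 1 1 in
  tup [:: 0; s ^+ 2 * t; s * t ^+ 2; t ^+ 3; - s ^+ 3; - (s ^+ 2 * t); - (s * t ^+ 2)].

Definition Icubic := [:: X 9, X 8, X 7 & I40].

(** Modulo [Icubic], every polynomial reduces to a + b X_1 + c X_2 with a, b, c in K[X_3, X_4]. On
    the cubic, - X_4 = s^3, X_3 = t^3, X_1 = s^2 t and X_2 = s t^2, so [cube_independent] forces a =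
    b = c = 0. *)
Lemma cubic_kernel f : f \mPo cubic = 0 -> idl Icubic f.
Proof.
pose B : 2.-tuple {mpoly K[10]} := [tuple - X 4; X 3].
pose nf (r : {mpoly K[2]} * {mpoly K[2]} * {mpoly K[2]}) :=
  (r.1.1 \mPo B) + (r.1.2 \mPo B) * X 1 + (r.2 \mPo B) * X 2.
have BE : ('X_ord0 \mPo B = - X 4) * ('X_ord_max \mPo B = X 3).
  by rewrite !comp_mpolyXU.
have [r fr] : exists r, idl Icubic (f - nf r).
  move: f; apply: mpoly_ring_ind.
  - move=> c; exists (c%:MP, 0, 0); rewrite /nf /= comp_mpolyC !comp_mpoly0.
    by rewrite !mul0r !addr0 subrr; apply: idl0.
  - apply: ord10P => k k10.
    have red r g : r = nf g -> idl Icubic (X k - r) -> exists g, idl Icubic (X k - nf g).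
      by move=> -> H; exists g.
    have nfE r : nf r = (r.1.1 \mPo B) + (r.1.2 \mPo B) * X 1 + (r.2 \mPo B) * X 2 by [].
    have gen j : (j < 11)%N -> idl Icubic (nth 0 Icubic j) by move=> ?; apply/idl_gen/mem_nth.
    case: k k10 red => [|[|[|[|[|[|[|[|[|[|//]]]]]]]]]] _ red.
    + apply: (red 0 (0, 0, 0)); last by rewrite subr0; exact: (gen 3 isT).
      by rewrite nfE /= comp_mpoly0 !mul0r !addr0.
    + apply: (red (X 1) (0, 1, 0)); last by rewrite subrr; apply: idl0.
      by rewrite nfE /= !comp_mpoly0 comp_mpoly1; ring.
    + apply: (red (X 2) (0, 0, 1)); last by rewrite subrr; apply: idl0.
      by rewrite nfE /= !comp_mpoly0 comp_mpoly1; ring.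
    + apply: (red (X 3) ('X_ord_max, 0, 0)); last by rewrite subrr; apply: idl0.
      by rewrite nfE /= !comp_mpoly0 BE; ring.
    + apply: (red (X 4) (- 'X_ord0, 0, 0)); last by rewrite subrr; apply: idl0.
      by rewrite nfE /= !comp_mpoly0 comp_mpolyN BE; ring.
    + apply: (red (- X 1) (0, - 1, 0)).
        by rewrite nfE /= !comp_mpoly0 comp_mpolyN comp_mpoly1; ring.
      by rewrite opprK addrC; exact: (gen 5 isT).
    + apply: (red (- X 2) (0, 0, - 1)).
        by rewrite nfE /= !comp_mpoly0 comp_mpolyN comp_mpoly1; ring.
      by rewrite opprK addrC; exact: (gen 4 isT).
    + apply: (red 0 (0, 0, 0)); last by rewrite subr0; exact: (gen 2 isT).
      by rewrite nfE /= comp_mpoly0 !mul0r !addr0.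
    + apply: (red 0 (0, 0, 0)); last by rewrite subr0; exact: (gen 1 isT).
      by rewrite nfE /= comp_mpoly0 !mul0r !addr0.
    + apply: (red 0 (0, 0, 0)); last by rewrite subr0; exact: (gen 0 isT).
      by rewrite nfE /= comp_mpoly0 !mul0r !addr0.
  - move=> f g [r fr] [r' gr]; exists (r.1.1 + r'.1.1, r.1.2 + r'.1.2, r.2 + r'.2).
    have -> : f + g - nf (r.1.1 + r'.1.1, r.1.2 + r'.1.2, r.2 + r'.2)
            = f - nf r + (g - nf r').
      by rewrite /nf /= !comp_mpolyD; apply: normal_form_add.
    exact: idlD.
  move=> f g [r fr] [r' gr].
  pose a : {mpoly K[2]} := 'X_ord0; pose d : {mpoly K[2]} := 'X_ord_max.
  (* The product is reduced by X_1^2 = a X_2, X_1 X_2 = a d and X_2^2 = d X_1, where a stands for -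
     X_4 and d for X_3. *)
  exists (r.1.1 * r'.1.1 + a * d * (r.1.2 * r'.2 + r.2 * r'.1.2),
          r.1.1 * r'.1.2 + r.1.2 * r'.1.1 + d * (r.2 * r'.2),
          r.1.1 * r'.2 + r.2 * r'.1.1 + a * (r.1.2 * r'.1.2)).
  set N := nf _.
  have -> : f * g - N = g * (f - nf r) + nf r * (g - nf r') + (nf r * nf r' - N).
    exact: mul_congr.
  apply: idlD; first by apply: idlD; apply: idlMl.
  rewrite /N /nf /= !comp_simp /a /d !BE.
  move: (r.1.1 \mPo B) (r.1.2 \mPo B) (r.2 \mPo B) => u0 u1 u2.
  move: (r'.1.1 \mPo B) (r'.1.2 \mPo B) (r'.2 \mPo B) => v0 v1 v2.
  have m11 : idl Icubic (X 1 * X 1 + X 4 * X 2).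
    exists 0, 0, (- X 0), 0, 0, (X 1), 0, 0, 0, 0, 1; rewrite /L0 /L1; ring.
  have m12 : idl Icubic (X 1 * X 2 + X 4 * X 3).
    exists 0, (- X 0), 0, 0, (X 1), 0, 0, 0, 0, 1, 0; rewrite /L0 /L1; ring.
  have m22 : idl Icubic (X 2 * X 2 - X 1 * X 3).
    exists (- X 0), 0, 0, 0, (X 2), (- X 3), 0, 0, 1, 0, 0; rewrite /L0 /L1; ring.
  have := idlD (idlD (idlMl (u1 * v1) m11) (idlMl (u1 * v2 + u2 * v1) m12))
     (idlMl (u2 * v2) m22).
  by congr idl; ring.
move=> f0; have rf0 : nf r \mPo cubic = 0.
  have G0 q : q \in Icubic -> q \mPo cubic = 0.
    by in_cases; rewrite ?/L0 ?/L1 !comp_simp //=; ring.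
  have := mPo_idl0 G0 fr; rewrite comp_mpolyB f0 sub0r => /eqP.
  by rewrite oppr_eq0 => /eqP.
have s0 : inord 0 = ord0 :> 'I_2 by apply: val_inj; rewrite /= inordK.
have s1 : inord 1 = ord_max :> 'I_2 by apply: val_inj; rewrite /= inordK.
have BC (g : {mpoly K[2]}) : (g \mPo B) \mPo cubic =
    g \mPo [tuple 'X_ord0 ^+ 3; 'X_ord_max ^+ 3].
  apply/eqP; rewrite -subr_eq0; apply/eqP/mpoly_eval0 => x.
  rewrite mevalB !comp_mpoly_meval; apply/eqP; rewrite subr_eq0; apply/eqP.
  apply: meval_eq => -[[|[|//]] ?]; rewrite !(tnth_nth 0) /= ?eval_simp tnth_tup inordK //= ?s0 ?s1
   !eval_simp; ring.
have e : nf r = 0.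
  move: rf0; rewrite /nf !comp_simp // !BC /= !s0 !s1 => /cube_independent[-> -> ->].
  by rewrite !comp_mpoly0 !mul0r !addr0.
by move: fr; rewrite e subr0.
Qed.

Definition proj (S : {set 'I_10}) : 10.-tuple {mpoly K[10]} :=
  [tuple if i \in S then 'X_i else 0 | i < 10].

Lemma proj_ker (S : {set 'I_10}) f :
  f \mPo proj S = 0 ->
  idl [seq 'X_i | i <- enum (~: S)] f.
Proof.
apply: mPo_proj => i; rewrite tnth_mktuple; case: ifP => iS.
  by rewrite subrr; apply: idl0.
by rewrite subr0; apply/idl_gen/map_f; rewrite mem_enum inE iS.
Qed.

Lemma meval_proj (S : {set 'I_10}) i (x : 'I_10 -> K) :
  (tnth (proj S) i).@[x] =
  if i \in S then x i else 0.
Proof. by rewrite tnth_mktuple; case: ifP; rewrite ?mevalXU ?meval0. Qed.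

(** A quadric through the scroll defined below that does not contain the space of the coordinates 3,
    8 and 9, on which it is - X_8 X_3. *)
Definition qscroll : {mpoly K[10]} := X 9 * X 2 - X 8 * X 3.

Lemma root_exists (a : K) e : (0 < e)%N -> exists b, b ^+ e = a.
Proof.
move=> e0; have [b bE] := @solve_monicpoly K e (fun i => if i == 0%N then a else 0) e0.
exists b; rewrite bE; case: e e0 {bE} => // e _.
by rewrite big_ord_recl /= mulr1 big1 ?addr0 // => i _; rewrite mul0r.
Qed.

(** The cone over the rational normal scroll S(1,3): u runs along the line joining the point (s : t)
    of the twisted cubic to the corresponding point of the line of the coordinates 8 and 9. *)
Definition scroll : 10.-tuple {mpoly K[3]} :=
  let s := Z 2 0 in let t := Z 2 1 in let u := Z 2 2 in
  tup [:: 0; s ^+ 2 * t; s * t ^+ 2; t ^+ 3; - s ^+ 3; - (s ^+ 2 * t); - (s * t ^+ 2);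
          0; - (s * u); - (t * u)].

Definition Iscroll := [:: qscroll, X 7 & I40].

Lemma qscroll_homog : qscroll \is 2.-homog.
Proof. by rewrite rpredB ?XX_homog. Qed.

(* The hyperplane X_9 = 0 cuts the scroll in the twisted cubic cone and the   *)
(* plane of the coordinates 4 and 8.                                          *)
Lemma scroll_kernel f : f \mPo scroll = 0 -> idl Iscroll f.
Proof.
move: f; apply: (@kernel_lift _ _ _ _ _ (X 9)).
- exact: mixed_cons qscroll_homog (mixed_cons (X_homog _) I40_homog).
- exact: X_homog.
- by move=> q; in_cases; rewrite ?/L0 ?/L1 ?/qscroll !comp_simp //=; ring.
- by rewrite X_tup //= oppr_eq0 mulf_neq0 ?X_neq0.
(* The parametrisation has degree 3 when s, t have weight 1 and u has weight 2. *)
- move=> x a; have [b <-] := root_exists a (isT : 0 < 3)%N.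
  exists (fun i : 'I_3 => nth 0 [:: b * x (inord 0); b * x (inord 1); b ^+ 2 * x (inord 2)] i).
  apply: ord10P => k k10; rewrite !tnth_tup inordK //.
  case: k k10 => [|[|[|[|[|[|[|[|[|[|//]]]]]]]]]] _ /=;
    rewrite !eval_simp ?inordK //=; ring.
move=> d f _ f0.
(* The scroll contains the cubic, at u = 0. *)
have : idl Icubic f.
  apply: cubic_kernel; apply: (mPo_dense (oner_neq0 _)) f0 => x _.
  exists (fun i : 'I_3 => nth 0 [:: x (inord 0); x (inord 1); 0] i).
  apply: ord10P => k k10; rewrite !tnth_tup inordK //.
  case: k k10 => [|[|[|[|[|[|[|[|[|[|//]]]]]]]]]] _ /=;
    rewrite !eval_simp ?inordK //=; ring.
have H : forall q, q \in Icubic -> idl [:: X 8, X 9, X 7 & I40] q.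
  move=> q; rewrite inE => /orP[/eqP->|]; first exact/idl_cons/idl_gen/mem_head.
  rewrite inE => /orP[/eqP->|qG]; first exact/idl_gen/mem_head.
  exact/idl_cons/idl_cons/idl_gen.
case/(idl_sub H)/idl_consP => g gG.
pose S : {set 'I_10} := [set inord 4; inord 8].
pose P := proj S.
have XP k : (k < 10)%N -> X k \mPo P = if (k == 4) || (k == 8) then X k else 0.
  by move=> k10; rewrite comp_mpolyXU -tnth_nth tnth_mktuple !inE -!val_eqE /= !inordK.
(* A point of the plane with nonzero coordinate 4 is on the scroll, at t = 0. Hence g X_8 vanishes
   on the plane, and so does g. *)
have fP : f \mPo P = 0.
  apply: (mPo_dense (X_neq0 (inord 4))) f0 => x; rewrite mevalXU => x4.
  have [s sE] := root_exists (- x (inord 4)) (isT : 0 < 3)%N.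
  have s0 : s != 0 by apply: contraNneq x4 => s0; rewrite -oppr_eq0 -sE s0 expr0n.
  exists (fun i : 'I_3 => nth 0 [:: s; 0; - x (inord 8) / s] i).
  apply: ord10P => k k10; rewrite tnth_tup meval_proj inordK // !inE -!val_eqE /= !inordK //.
  case: k k10 => [|[|[|[|[|[|[|[|[|[|//]]]]]]]]]] _ /=;
    rewrite !eval_simp ?inordK //= ?sE; by first [ring | field].
have gP : g \mPo P = 0.
  have GP q : q \in [:: X 9, X 7 & I40] -> q \mPo P = 0.
    by in_cases; rewrite ?/L0 ?/L1 ?(comp_mpolyD, comp_mpolyB, comp_mpolyM, comp_mpolyN) !XP //=; ring.
  have := mPo_idl0 GP gG; rewrite comp_mpolyB fP comp_mpolyM XP //= sub0r => /eqP.
  by rewrite oppr_eq0 mulf_eq0 (negPf (X_neq0 _)) orbF => /eqP.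
rewrite -(subrK (g * X 8) f); apply: idlD.
  apply: (idl_sub _ gG) => q; rewrite inE => /orP[/eqP->|qG]; first exact/idl_gen/mem_head.
  exact/idl_cons/idl_cons/idl_gen.
(* As g lies in the ideal of the plane, it remains to multiply each coordinate other than 4 and 8 by
   X_8 and land in the ideal of X_9 and [Iscroll]. *)
apply: (idl_mul_sub _ (proj_ker gP)) => q /mapP[i].
rewrite mem_enum !inE -!val_eqE /= !inordK // => iS ->; move: i iS.
apply: ord10P => k k10; rewrite inordK //.
case: k k10 => [|[|[|[|[|[|[|[|[|[|//]]]]]]]]]] _ // _.
- exists 0, 0, 0, (X 8), 0, 0, 0, 0, 0, 0, 0; rewrite /L0 /L1 /qscroll; ring.
- exists (- X 4), 0, (- X 6), 0, 0, (X 8), 1, 0, 0, 0, 0; rewrite /L0 /L1 /qscroll; ring.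
- exists (X 1), 0, (X 3), 0, 0, 0, 0, (- 1), 0, 0, 0; rewrite /L0 /L1 /qscroll; ring.
- exists (X 2), (- 1), 0, 0, 0, 0, 0, 0, 0, 0, 0; rewrite /L0 /L1 /qscroll; ring.
- exists (X 4), 0, (X 6), 0, 0, 0, (- 1), 0, 0, 0, 0; rewrite /L0 /L1 /qscroll; ring.
- exists (- X 1), 0, (- X 3), 0, (X 8), 0, 0, 1, 0, 0, 0; rewrite /L0 /L1 /qscroll; ring.
- exists 0, 0, (X 8), 0, 0, 0, 0, 0, 0, 0, 0; rewrite /L0 /L1 /qscroll; ring.
- exists (X 8), 0, 0, 0, 0, 0, 0, 0, 0, 0, 0; rewrite /L0 /L1 /qscroll; ring.
Qed.

(** A family of planes over the twisted cubic: the coordinates 7, 8, 9 are the coefficients of (s X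
    + t Y)(v X - u Y). Setting v = 0 gives the scroll. *)
Definition conic_bundle : 10.-tuple {mpoly K[4]} :=
  let s := Z 3 0 in let t := Z 3 1 in let u := Z 3 2 in let v := Z 3 3 in
  tup [:: 0; s ^+ 2 * t; s * t ^+ 2; t ^+ 3; - s ^+ 3; - (s ^+ 2 * t); - (s * t ^+ 2);
          s * v; t * v - s * u; - (t * u)].

(* The hyperplane X_7 = 0 cuts this variety in the scroll, on which qscroll   *)
(* vanishes, and the linear space of the coordinates 3, 8 and 9.              *)
Lemma conic_bundle_kernel f : f \mPo conic_bundle = 0 -> idl I40 f.
Proof.
move: f; apply: (@kernel_lift _ _ _ _ _ (X 7)).
- exact: I40_homog.
- exact: X_homog.
- by move=> q; in_cases; rewrite ?/L0 ?/L1 ?/qscroll !comp_simp //=; ring.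
- by rewrite X_tup //= mulf_neq0 ?X_neq0.
- move=> x a; have [b <-] := root_exists a (isT : 0 < 3)%N.
  exists (fun i : 'I_4 => nth 0 [:: b * x (inord 0); b * x (inord 1);
    b ^+ 2 * x (inord 2); b ^+ 2 * x (inord 3)] i).
  apply: ord10P => k k10; rewrite !tnth_tup inordK //.
  case: k k10 => [|[|[|[|[|[|[|[|[|[|//]]]]]]]]]] _ /=;
    rewrite !eval_simp ?inordK //=; ring.
move=> d f _ f0.
have : idl Iscroll f.
  apply: scroll_kernel; apply: (mPo_dense (oner_neq0 _)) f0 => x _.
  exists (fun i : 'I_4 => nth 0 [:: x (inord 0); x (inord 1); x (inord 2); 0] i).
  apply: ord10P => k k10; rewrite !tnth_tup inordK //.
  case: k k10 => [|[|[|[|[|[|[|[|[|[|//]]]]]]]]]] _ /=;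
    rewrite !eval_simp ?inordK //=; ring.
case/idl_consP => g gG.
pose S : {set 'I_10} := [set inord 3; inord 8; inord 9].
pose P := proj S.
have XP k : (k < 10)%N -> X k \mPo P = if [|| k == 3, k == 8 | k == 9] then X k else 0.
  by move=> k10; rewrite comp_mpolyXU -tnth_nth tnth_mktuple !inE -!val_eqE /= !inordK // -orbA.
have fP : f \mPo P = 0.
  apply: (mPo_dense (X_neq0 (inord 3))) f0 => x; rewrite mevalXU => x3.
  have [t tE] := root_exists (x (inord 3)) (isT : 0 < 3)%N.
  have t0 : t != 0 by apply: contraNneq x3 => t0; rewrite -tE t0 expr0n.
  exists (fun i : 'I_4 => nth 0 [:: 0; t; - x (inord 9) / t; x (inord 8) / t] i).
  apply: ord10P => k k10; rewrite tnth_tup meval_proj inordK // !inE -!val_eqE /= !inordK //.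
  case: k k10 => [|[|[|[|[|[|[|[|[|[|//]]]]]]]]]] _ /=;
    rewrite !eval_simp ?inordK //= ?tE; by first [ring | field].
have gP : g \mPo P = 0.
  have GP q : q \in [:: X 7 & I40] -> q \mPo P = 0.
    by in_cases; rewrite ?/L0 ?/L1 ?(comp_mpolyD, comp_mpolyB, comp_mpolyM, comp_mpolyN) !XP //=; ring.
  have := mPo_idl0 GP gG; rewrite comp_mpolyB fP comp_mpolyM /qscroll comp_mpolyB !comp_mpolyM.
  rewrite !XP //= mulr0 !sub0r mulrN opprK => /eqP.
  by rewrite !mulf_eq0 !(negPf (X_neq0 _)) !orbF => /eqP.
(* The certificates show that [qscroll] times each coordinate other than 3, 8, 9 lies in the ideal
   of X_7 and [I40]. *)
rewrite -(subrK (g * qscroll) f); apply: idlD => //.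
apply: (idl_mul_sub _ (proj_ker gP)) => q /mapP[i].
rewrite mem_enum !inE -!val_eqE /= !inordK // => iS ->; move: i iS.
apply: ord10P => k k10; rewrite inordK //.
case: k k10 => [|[|[|[|[|[|[|[|[|[|//]]]]]]]]]] _ // _.
- exists 0, qscroll, 0, 0, 0, 0, 0, 0, 0; rewrite /L0 /L1 /qscroll; ring.
- exists (X 3 * X 6), (- X 8 * X 9), (X 1 * X 9), (- X 3 * X 8), (- X 3), 0, 0, (X 9), 0; rewrite /L0 /L1 /qscroll; ring.
- exists (- X 3 ^+ 2), (- X 9 ^+ 2), (X 2 * X 9), (- X 3 * X 9), 0, (X 3), (X 9), 0, 0; rewrite /L0 /L1 /qscroll; ring.
- exists (- X 2 * X 6), (X 8 ^+ 2), (- X 1 * X 8), (X 2 * X 8), (X 2), 0, 0, (- X 8), 0; rewrite /L0 /L1 /qscroll; ring.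
- exists (- (X 3 * X 6)), (X 8 * X 9), (- (X 1 * X 9)), (qscroll + X 3 * X 8), (X 3), 0, 0, (- X 9), 0; rewrite /L0 /L1 /qscroll; ring.
- exists (X 3 ^+ 2), (X 9 ^+ 2), (qscroll - X 2 * X 9), (X 3 * X 9), 0, (- X 3), (- X 9), 0, 0; rewrite /L0 /L1 /qscroll; ring.
- exists qscroll, 0, 0, 0, 0, 0, 0, 0, 0; rewrite /L0 /L1 /qscroll; ring.
Qed.

(* The lines spanned by (h, 0, a, b, c) and (0, h, b, c, d): L0 and L1 make   *)
(* the matrix (a, b, c; b, c, d) a Hankel matrix.                             *)
Definition chart4 : 10.-tuple {mpoly K[5]} :=
  let h := Z 4 0 in
  let a := Z 4 1 in let b := Z 4 2 in let c := Z 4 3 in let d := Z 4 4 in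
  tup [:: h ^+ 2; h * b; h * c; h * d; - (h * a); - (h * b); - (h * c);
          a * c - b ^+ 2; a * d - b * c; b * d - c ^+ 2].

(* A deformation of conic_bundle into the chart, with parameter the           *)
(* coordinate 0.                                                              *)
Definition deform : 10.-tuple {mpoly K[5]} :=
  let e := Z 4 0 in
  let s := Z 4 1 in let t := Z 4 2 in let c := Z 4 3 in let d := Z 4 4 in
  tup [:: e; s ^+ 2 * t; s * t ^+ 2 + e * c; t ^+ 3 + e * d; - s ^+ 3;
          - (s ^+ 2 * t); - (s * t ^+ 2 + e * c);
          s ^+ 3 * c; s ^+ 3 * d - s ^+ 2 * t * c;
          s ^+ 2 * t * d - s * t ^+ 2 * c *+ 2 - e * c ^+ 2].

Lemma chart4_kernel f : f \mPo chart4 = 0 -> idl I4 f.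
Proof.
move: f; apply: (@kernel_lift _ _ _ _ _ (X 0)).
- exact: I4_homog.
- exact: X_homog.
- by move=> q; in_cases; rewrite ?/L0 ?/L1 ?/qscroll !comp_simp //=; ring.
- by rewrite X_tup //= expf_neq0 ?X_neq0.
- move=> x a; have [b <-] := root_exists a (isT : 0 < 2)%N.
  exists (fun i : 'I_5 => b * x i).
  apply: ord10P => k k10; rewrite !tnth_tup inordK //.
  case: k k10 => [|[|[|[|[|[|[|[|[|[|//]]]]]]]]]] _ /=;
    rewrite !eval_simp ?inordK //=; ring.
move=> d f fh f0; apply: conic_bundle_kernel.
(* For e != 0, e times a point of [deform] is a point of [chart4], and f is homogeneous. *)
have : f \mPo deform = 0.
  apply: (mpoly_eval_dense (X_neq0 (inord 0))) => x; rewrite mevalXU => e0.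
  pose s := x (inord 1); pose t := x (inord 2); pose e := x (inord 0).
  pose z := fun i : 'I_5 => nth 0 [:: e; s ^+ 3; s ^+ 2 * t;
     s * t ^+ 2 + e * x (inord 3); t ^+ 3 + e * x (inord 4)] i.
  have := congr1 (meval z) f0; rewrite meval0 !comp_mpoly_meval.
  have -> : f.@[fun i => (tnth chart4 i).@[z]]
          = f.@[fun i => e * (tnth deform i).@[x]].
    apply: meval_eq.
    apply: ord10P => k k10; rewrite !tnth_tup inordK //.
    case: k k10 => [|[|[|[|[|[|[|[|[|[|//]]]]]]]]]] _ /=;
      rewrite !eval_simp /z ?inordK //= /e /s /t ?mulr2n ?eval_simp; ring.
  rewrite (homog_eval _ _ fh) => /eqP.
  by rewrite mulf_eq0 expf_eq0 (negPf e0) andbF => /eqP.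
apply: (mPo_dense (X_neq0 (inord 0))) => x; rewrite mevalXU => s0.
pose s := x (inord 0); pose t := x (inord 1).
pose u := x (inord 2); pose v := x (inord 3).
(* Where s != 0, [conic_bundle] is the fibre e = 0 of [deform]: the last two parameters solve the
   equations of the coordinates 7 and 8. *)
exists (fun i : 'I_5 => nth 0 [:: 0; s; t; v / s ^+ 2;
   ((s * t * (v / s ^+ 2)) *+ 2 - u) / s ^+ 2] i).
apply: ord10P => k k10; rewrite !tnth_tup inordK //.
case: k k10 => [|[|[|[|[|[|[|[|[|[|//]]]]]]]]]] _ /=;
  rewrite ?mulr2n !eval_simp ?inordK //= /s /t /u /v; by first [ring | field].
Qed.

(** The lines spanned by (h, 0, a, b, c') and (0, h, b, c, d). Only [L0] vanishes on them; [L1]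
    becomes h (c - c'), and c = c' gives back [chart4]. *)
Definition chart5 : 10.-tuple {mpoly K[6]} :=
  let h := Z 5 0 in let a := Z 5 1 in let b := Z 5 2 in let c := Z 5 3 in
  let c' := Z 5 4 in let d := Z 5 5 in
  tup [:: h ^+ 2; h * b; h * c; h * d; - (h * a); - (h * b); - (h * c');
          a * c - b ^+ 2; a * d - b * c'; b * d - c * c'].

Lemma chart5_kernel f : f \mPo chart5 = 0 -> idl I5 f.
Proof.
move: f; apply: (@kernel_lift _ _ _ _ _ L1).
- exact: I5_homog.
- exact: L1_homog.
- by move=> q; in_cases; rewrite ?/L0 ?/L1 ?/qscroll !comp_simp //=; ring.
- apply/eqP => /(congr1 (meval (fun i : 'I_6 => nth 0 [:: 1; 0; 0; 1; 0; 0] i))).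
  rewrite !comp_simp //= !eval_simp !inordK //= !(mulr0, mulr1, oppr0, addr0).
  by apply/eqP/oner_neq0.
- move=> x a; have [b <-] := root_exists a (isT : 0 < 2)%N.
  exists (fun i : 'I_6 => b * x i).
  apply: ord10P => k k10; rewrite !tnth_tup inordK //.
  case: k k10 => [|[|[|[|[|[|[|[|[|[|//]]]]]]]]]] _ /=;
    rewrite !eval_simp ?inordK //=; ring.
move=> d f _ f0; apply: chart4_kernel; apply: (mPo_dense (oner_neq0 _)) f0 => x _.
exists (fun i : 'I_6 => nth 0 [:: x (inord 0); x (inord 1); x (inord 2); x (inord 3);
   x (inord 3); x (inord 4)] i).
apply: ord10P => k k10; rewrite !tnth_tup inordK //.
case: k k10 => [|[|[|[|[|[|[|[|[|[|//]]]]]]]]]] _ /=;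
  rewrite !eval_simp ?inordK //=; ring.
Qed.

(** That every such f lies in the ideal of G means that this ideal is radical and that its zero set
    is the closure of its part with p_01 != 0. *)
Definition vanishes_on_chart (G : seq {mpoly K[10]}) (f : {mpoly K[10]}) : Prop :=
  forall p : 'I_10 -> K, p (inord 0) != 0 ->
    (forall q, q \in G -> q.@[p] = 0) -> f.@[p] = 0.

Lemma chart4_zero q : q \in I4 -> q \mPo chart4 = 0.
Proof. by in_cases; rewrite ?/L0 ?/L1 !comp_simp //=; ring. Qed.

Lemma chart5_zero q : q \in I5 -> q \mPo chart5 = 0.
Proof. by in_cases; rewrite ?/L0 ?/L1 !comp_simp //=; ring. Qed.

Lemma conic_bundle_zero q : q \in I40 -> q \mPo conic_bundle = 0.
Proof. by in_cases; rewrite ?/L0 ?/L1 !comp_simp //=; ring. Qed.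

Lemma vanishes_on_mPo G r (F : 10.-tuple {mpoly K[r]}) f :
  tnth F (inord 0) != 0 -> (forall q, q \in G -> q \mPo F = 0) ->
  vanishes_on_chart G f -> f \mPo F = 0.
Proof.
move=> F0 GF fG; apply: (mpoly_eval_dense F0) => x x0.
rewrite comp_mpoly_meval; apply: fG => // q /GF q0.
by have := congr1 (meval x) q0; rewrite meval0 comp_mpoly_meval.
Qed.

Lemma ideal4 f : vanishes_on_chart I4 f -> idl I4 f.
Proof.
move=> f0; apply/chart4_kernel/(vanishes_on_mPo _ chart4_zero f0).
by rewrite tnth_tup inordK // expf_neq0 ?X_neq0.
Qed.

Lemma ideal5 f : vanishes_on_chart I5 f -> idl I5 f.
Proof.
move=> f0; apply/chart5_kernel/(vanishes_on_mPo _ chart5_zero f0).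
by rewrite tnth_tup inordK // expf_neq0 ?X_neq0.
Qed.

Lemma sum_ord10 (V : nmodType) (F : 'I_10 -> V) :
  \sum_i F i = F (inord 0) + F (inord 1) + F (inord 2) + F (inord 3) + F (inord 4)
    + F (inord 5) + F (inord 6) + F (inord 7) + F (inord 8) + F (inord 9).
Proof.
rewrite !big_ord_recl big_ord0 addr0 !addrA.
by do !congr (_ + _); congr F; apply: val_inj; rewrite /= inordK.
Qed.

(** * The ideal for k = 3: a double cover in the chart *)

Section Threefold.

Hypothesis char_neq2 : (2 : K) != 0.
Variable x : 'I_10 -> K.
Hypothesis x7 : x (inord 7) = 1.

Definition linform (y : 'I_10 -> K) : {mpoly K[10]} := \sum_i (y i)%:MP * 'X_i.

Notation C k := (x (inord k))%:MP.

Let ell := linform x.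
Let I3 := ell :: I4.

Let ellE : ell = C 0 * X 0 + C 1 * X 1 + C 2 * X 2 + C 3 * X 3 + C 4 * X 4
  + C 5 * X 5 + C 6 * X 6 + X 7 + C 8 * X 8 + C 9 * X 9.
Proof. by rewrite /ell /linform sum_ord10 x7 mpolyC1 mul1r. Qed.

Lemma ell_conic_bundle : ell \mPo conic_bundle != 0.
Proof.
apply/eqP => e.
pose z w := fun i : 'I_4 => nth 0 [:: 1; 0; 0; w] i : K.
have ez w : (ell \mPo conic_bundle).@[z w] = 0 by rewrite e meval0.
have : (ell \mPo conic_bundle).@[z 1] - (ell \mPo conic_bundle).@[z 0] = 1.
  rewrite !comp_mpoly_meval ellE !(mevalD, mevalM, mevalC, mevalXU) !tnth_tup !inordK //= /z.
  rewrite !eval_simp !inordK //=; ring.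
by rewrite !ez subr0 => /esym/eqP; rewrite oner_eq0.
Qed.

(** [I4] and [I40] are prime, being kernels of parametrisations. If f X_0 = g ell modulo [I4], then
    g vanishes on [conic_bundle], where ell does not, so g = g' X_0 modulo [I4]; cancelling X_0
    modulo [I4] leaves f = g' ell. *)
Lemma X0_regular f : idl I3 (f * X 0) -> idl I3 f.
Proof.
case/idl_consP => g gI.
have gcb : g \mPo conic_bundle = 0.
  have H q : q \in I4 -> q \mPo conic_bundle = 0.
    by move=> qI; apply: conic_bundle_zero; rewrite inE qI orbT.
  have := mPo_idl0 H gI; rewrite comp_mpolyB !comp_mpolyM X_tup //= mulr0 sub0r.
  by move/eqP; rewrite oppr_eq0 mulf_eq0 (negPf ell_conic_bundle) orbF => /eqP.
have [g' g'I] := idl_consP (conic_bundle_kernel gcb).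
have H : idl I4 (f - g' * ell).
  apply: chart4_kernel; apply/eqP.
  have : ((f - g' * ell) * X 0) \mPo chart4 = 0.
    apply: (mPo_idl0 chart4_zero).
    have -> : (f - g' * ell) * X 0 = (f * X 0 - g * ell) + ell * (g - g' * X 0) by ring.
    by apply: idlD => //; apply: idlMl.
  move/eqP; rewrite comp_mpolyM mulf_eq0 => /orP[//|].
  by rewrite X_tup //= expf_eq0 (negPf (X_neq0 _)) andbF.
rewrite -(subrK (g' * ell) f); apply: idlD; first exact: idl_cons.
by apply/idlMl/idl_gen; rewrite inE eqxx.
Qed.

Lemma X0_regular_exp f m : idl I3 (f * X 0 ^+ m) -> idl I3 f.
Proof.
elim: m => [|m IH]; first by rewrite expr0 mulr1.
by rewrite exprSr mulrA => /X0_regular.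
Qed.

(* The coordinates h, y0, y2, y3 of chart4; on the section y1 is a root of    *)
(* y1^2 = y1_coef1 y1 + y1_coef0.                                             *)
Let y1_coef1 : {mpoly K[4]} :=
  (x (inord 9))%:MP * Z 3 3 - (x (inord 8))%:MP * Z 3 2
    + (x (inord 1) - x (inord 5))%:MP * Z 3 0.
Let y1_coef0 : {mpoly K[4]} :=
  Z 3 1 * Z 3 2 + (x (inord 8))%:MP * (Z 3 1 * Z 3 3) - (x (inord 9))%:MP * Z 3 2 ^+ 2
    + Z 3 0 * ((x (inord 0))%:MP * Z 3 0 + (x (inord 2) - x (inord 6))%:MP * Z 3 2
      + (x (inord 3))%:MP * Z 3 3 - (x (inord 4))%:MP * Z 3 1).

Let base : 4.-tuple {mpoly K[10]} := [tuple X 0; - X 4; X 2; X 3].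

Let baseE : (Z 3 0 \mPo base = X 0) * (Z 3 1 \mPo base = - X 4) *
  (Z 3 2 \mPo base = X 2) * (Z 3 3 \mPo base = X 3).
Proof. by rewrite !comp_mpolyXU !inordK. Qed.

Let nf (r : {mpoly K[4]} * {mpoly K[4]}) := (r.1 \mPo base) + (r.2 \mPo base) * X 1.

Let y1_equation :
  idl I3 (X 1 ^+ 2 - (y1_coef0 \mPo base) - (y1_coef1 \mPo base) * X 1).
Proof.
rewrite /y1_coef0 /y1_coef1 !(comp_simp, comp_mpolyC, rmorphXn) /= !baseE !mpolyCB.
exists (- X 0), (C 8 * X 1 + C 9 * X 2 + C 6 * X 0), (X 1 - C 9 * X 3 + C 5 * X 0),
  0, 0, (C 9), (C 8), 1; rewrite ellE /L0 /L1; ring.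
Qed.

Let nfM r r' : idl I3 (nf r * nf r' -
  nf (r.1 * r'.1 + y1_coef0 * (r.2 * r'.2),
      r.1 * r'.2 + r.2 * r'.1 + y1_coef1 * (r.2 * r'.2))).
Proof.
have := idlMl ((r.2 \mPo base) * (r'.2 \mPo base)) y1_equation.
congr idl; rewrite /nf /= !comp_simp.
exact: nf_mul_identity.
Qed.

(** After inverting X_0, the quotient is spanned by 1 and X_1 over the polynomials in X_0, X_4, X_2,
    X_3; the coordinates 7, 8, 9 each cost one factor X_0. *)
Let normal_form f : exists m r, idl I3 (f * X 0 ^+ m - nf r).
Proof.
move: f; apply: mpoly_ring_ind.
- move=> c; exists 0%N, (c%:MP, 0); rewrite /nf /= comp_mpolyC comp_mpoly0 mul0r expr0 mulr1.
  by rewrite addr0 subrr; apply: idl0.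
- apply: ord10P => k k10.
  have red0 r : X k = nf r -> exists m r, idl I3 (X k * X 0 ^+ m - nf r).
    by move=> e; exists 0%N, r; rewrite expr0 mulr1 -e subrr; apply: idl0.
  have red m r : idl I3 (X k * X 0 ^+ m - nf r) ->
    exists m r, idl I3 (X k * X 0 ^+ m - nf r) by move=> H; exists m, r.
  have nfE r : nf r = (r.1 \mPo base) + (r.2 \mPo base) * X 1 by [].
  case: k k10 red0 red => [|[|[|[|[|[|[|[|[|[|//]]]]]]]]]] _ red0 red.
  + by apply: (red0 (Z 3 0, 0)); rewrite nfE /= comp_mpoly0 baseE; ring.
  + by apply: (red0 (0, 1)); rewrite nfE /= comp_mpoly0 comp_mpoly1; ring.
  + by apply: (red0 (Z 3 2, 0)); rewrite nfE /= comp_mpoly0 baseE; ring.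
  + by apply: (red0 (Z 3 3, 0)); rewrite nfE /= comp_mpoly0 baseE; ring.
  + by apply: (red0 (- Z 3 1, 0)); rewrite nfE /= comp_mpoly0 !comp_simp baseE; ring.
  + apply: (red 0%N (0, -1)); rewrite nfE /= !comp_simp comp_mpoly0 comp_mpoly1.
    by exists 0, 0, 1, 0, 0, 0, 0, 0; rewrite /L0; ring.
  + apply: (red 0%N (- Z 3 2, 0)); rewrite nfE /= !comp_simp comp_mpoly0 baseE.
    by exists 0, 1, 0, 0, 0, 0, 0, 0; rewrite /L1; ring.
  + apply: (red 1%N (Z 3 1 * Z 3 2 - y1_coef0, - y1_coef1)).
    have gen j : (j < 8)%N -> idl I3 (nth 0 I3 j) by move=> ?; apply/idl_gen/mem_nth.
    have := idlD (idlB (gen 7 isT) y1_equation) (idlMl (X 1) (gen 2 isT)).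
    by rewrite nfE /= !comp_simp !baseE; congr idl; apply: nf_X7_identity.
  + apply: (red 1%N (Z 3 1 * Z 3 3, - Z 3 2)); rewrite nfE /= !comp_simp !baseE.
    by exists 0, (X 1), 0, 0, 0, 0, 1, 0; rewrite /L1; ring.
  + apply: (red 1%N (- Z 3 2 ^+ 2, Z 3 3)); rewrite nfE /= !comp_simp ?rmorphXn /= !baseE.
    by exists 0, (X 2), (- X 3), 0, 0, 1, 0, 0; rewrite /L0 /L1; ring.
- move=> f g [m [r fr]] [m' [r' gr]].
  exists (m + m')%N, (r.1 * Z 3 0 ^+ m' + r'.1 * Z 3 0 ^+ m, r.2 * Z 3 0 ^+ m' + r'.2 * Z 3 0 ^+ m).
  have := idlD (idlMl (X 0 ^+ m') fr) (idlMl (X 0 ^+ m) gr).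
  by congr idl; rewrite /nf /= !comp_simp ?rmorphXn /= !baseE exprD; ring.
move=> f g [m [r fr]] [m' [r' gr]].
have := idlD (idlD (idlMl (g * X 0 ^+ m') fr) (idlMl (nf r) gr)) (nfM r r').
set r'' := (_, _) => H.
exists (m + m')%N, r''; move: H; rewrite exprD.
by generalize (nf r) (nf r') (nf r'') => u v w; congr idl; ring.
Qed.

Lemma ideal3 f : vanishes_on_chart I3 f -> idl I3 f.
Proof.
move=> f0; have [m [r fr]] := normal_form f.
apply: (@X0_regular_exp _ m).
suff [r1 r2] : r.1 = 0 /\ r.2 = 0.
  by move: fr; rewrite /nf r1 r2 !comp_mpoly0 mul0r addr0 subr0.
(* The discriminant of the equation of y1. It is nonzero because y0 y2 occurs in it with coefficient
   4. Where it does not vanish, r.1 + r.2 y1 is zero at two distinct roots y1, so r.1 and r.2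
   vanish. *)
pose disc := y1_coef1 ^+ 2 + y1_coef0 *+ 4.
have disc0 : Z 3 0 * disc != 0.
  rewrite mulf_neq0 ?X_neq0 //; apply/eqP => d0.
  pose z w := fun i : 'I_4 => nth 0 [:: 0; w; 1; 0] i : K.
  have ez w : disc.@[z w] = 0 by rewrite d0 meval0.
  have : disc.@[z 1] - disc.@[z 0] = 2 ^+ 2.
    rewrite /disc /y1_coef0 /y1_coef1 !mulr2n /= !(eval_simp, mevalC) /z !inordK //=; ring.
  by rewrite !ez subr0 => /esym/eqP; rewrite expf_eq0 (negPf char_neq2).
have key (z : 'I_4 -> K) : (Z 3 0 * disc).@[z] != 0 -> r.1.@[z] = 0 /\ r.2.@[z] = 0.
  rewrite mevalM mevalXU mulf_eq0 => /norP[h0 d0].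
  set h := z (inord 0) in h0; pose y0 := z (inord 1); pose y2 := z (inord 2).
  pose y3 := z (inord 3).
  have [e eE] := root_exists disc.@[z] (isT : 0 < 2)%N.
  have e0 : e != 0 by apply: contraNneq d0 => e0; rewrite -eE e0 expr0n.
  have root y1 : y1 ^+ 2 = y1_coef1.@[z] * y1 + y1_coef0.@[z] ->
      r.1.@[z] + r.2.@[z] * y1 = 0.
    move=> y1E.
    pose p := fun i : 'I_10 => nth 0 [:: h; y1; y2; y3; - y0; - y1; - y2;
       (y0 * y2 - y1 ^+ 2) / h; (y0 * y3 - y1 * y2) / h; (y1 * y3 - y2 ^+ 2) / h] i.
    have pI q : q \in I3 -> q.@[p] = 0.
      rewrite inE => /orP[/eqP->|].
        rewrite ellE !(eval_simp, mevalC) /p !inordK //= y1E /y1_coef0 /y1_coef1.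
        by rewrite !(eval_simp, mevalC) -/h -/y0 -/y2 -/y3; field.
      by rewrite !inE; repeat case/orP; move/eqP->;
        rewrite ?/L0 ?/L1 ?eval_simp /p ?inordK //=; field.
    have pf : f.@[p] = 0 by apply: f0; rewrite // /p inordK.
    have nfE : (nf r).@[p] = r.1.@[z] + r.2.@[z] * y1.
      have B (g : {mpoly K[4]}) : (g \mPo base).@[p] = g.@[z].
        rewrite comp_mpoly_meval; apply: meval_eq => i; rewrite -(inord_val i) (tnth_nth 0).
        by case: i => [[|[|[|[|//]]]] ilt]; rewrite /= inordK //= !eval_simp /p inordK //= ?opprK.
      by rewrite /nf /= mevalD mevalM mevalXU !B /p inordK.
    have : (f * X 0 ^+ m - nf r).@[p] = 0.
      move: fr; move: (_ - _); apply: (idl_ind (P := fun g => g.@[p] = 0)).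
      - exact: meval0.
      - by move=> g g' g0 g'0; rewrite mevalD g0 g'0 addr0.
      by move=> g q /pI q0; rewrite mevalM q0 mulr0.
    by rewrite mevalB mevalM pf mul0r sub0r nfE => /eqP; rewrite oppr_eq0 => /eqP.
  have e2 : e ^+ 2 = y1_coef1.@[z] ^+ 2 + 2 * 2 * y1_coef0.@[z].
    by rewrite eE /disc mevalD mevalXn raddfMn /=; ring.
  have R1 := root ((y1_coef1.@[z] + e) / 2).
  have R2 := root ((y1_coef1.@[z] - e) / 2).
  move: R1 R2 e2; move: (y1_coef1.@[z]) (y1_coef0.@[z]) => c1 c0 R1 R2 e2.
  have n4 : (4 : K) != 0 by rewrite -[4%N]/(2 * 2)%N natrM mulf_neq0.
  have c0E : c0 = (e ^+ 2 - c1 ^+ 2) / (2 * 2) by rewrite e2; field.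
  have {}R1 : r.1.@[z] + r.2.@[z] * ((c1 + e) / 2) = 0.
    by apply: R1; rewrite c0E; field; rewrite n4.
  have {}R2 : r.1.@[z] + r.2.@[z] * ((c1 - e) / 2) = 0.
    by apply: R2; rewrite c0E; field; rewrite n4.
  have r20 : r.2.@[z] = 0.
    have : r.2.@[z] * e = 0.
      have -> : r.2.@[z] * e = (r.1.@[z] + r.2.@[z] * ((c1 + e) / 2))
         - (r.1.@[z] + r.2.@[z] * ((c1 - e) / 2)) by field.
      by rewrite R1 R2 subr0.
    by move/eqP; rewrite mulf_eq0 (negPf e0) orbF => /eqP.
  by split=> //; move: R1; rewrite r20 mul0r addr0.
by split; apply: (mpoly_eval_dense disc0) => z /key[].
Qed.

End Threefold.

End SectionIdeals.

Lemma ord5P (P : 'I_5 -> Prop) : (forall k, (k < 5)%N -> P (inord k)) -> forall i, P i.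
Proof. by move=> H i; rewrite -(inord_val i); apply: H. Qed.

Lemma sum_ord5 (V : nmodType) (F : 'I_5 -> V) :
  \sum_i F i = F (inord 0) + F (inord 1) + F (inord 2) + F (inord 3) + F (inord 4).
Proof.
rewrite !big_ord_recl big_ord0 addr0 !addrA.
by do !congr (_ + _); congr F; apply: val_inj; rewrite /= inordK.
Qed.

Local Notation "x `_[ k ]" := (x 0 (inord k)) (at level 3, format "x `_[ k ]").

(** * Bivectors and 2-forms on K^5 *)

Section Forms.

Variable K : closedFieldType.
Implicit Types (u v w : 'rV[K]_5) (x y p : 'rV[K]_10).

Definition row10 (s : seq K) : 'rV[K]_10 := \row_i nth 0 s i.
Definition row5 (s : seq K) : 'rV[K]_5 := \row_i nth 0 s i.

Lemma row10E s k : (k < 10)%N -> (row10 s)`_[k] = nth 0 s k.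
Proof. by move=> ?; rewrite mxE inordK. Qed.
Lemma row5E s k : (k < 5)%N -> (row5 s)`_[k] = nth 0 s k.
Proof. by move=> ?; rewrite mxE inordK. Qed.

Lemma row10P x y : (forall k, (k < 10)%N -> x`_[k] = y`_[k]) -> x = y.
Proof. by move=> H; apply/rowP; apply: ord10P. Qed.
Lemma row5P u v : (forall k, (k < 5)%N -> u`_[k] = v`_[k]) -> u = v.
Proof. by move=> H; apply/rowP; apply: ord5P. Qed.

Definition wedge u v : 'rV[K]_10 := plucker (col_mx u v).

Lemma pcolE : forall k, (k < 10)%N ->
  pcol1 (inord k) = inord (nth 0 [:: 0; 0; 0; 0; 1; 1; 1; 2; 2; 3] k)%N /\
  pcol2 (inord k) = inord (nth 0 [:: 1; 2; 3; 4; 2; 3; 4; 3; 4; 4] k)%N.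
Proof. by move=> k k10; rewrite /pcol1 /pcol2 inordK. Qed.

Definition wedge_list u v := [::
  u`_[0] * v`_[1] - u`_[1] * v`_[0]; u`_[0] * v`_[2] - u`_[2] * v`_[0];
  u`_[0] * v`_[3] - u`_[3] * v`_[0]; u`_[0] * v`_[4] - u`_[4] * v`_[0];
  u`_[1] * v`_[2] - u`_[2] * v`_[1]; u`_[1] * v`_[3] - u`_[3] * v`_[1];
  u`_[1] * v`_[4] - u`_[4] * v`_[1]; u`_[2] * v`_[3] - u`_[3] * v`_[2];
  u`_[2] * v`_[4] - u`_[4] * v`_[2]; u`_[3] * v`_[4] - u`_[4] * v`_[3]].

Lemma pluckerE (M : 'M[K]_(2, 5)) :
  plucker M = row10 (wedge_list (row ord0 M) (row ord_max M)).
Proof.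
apply: row10P => k k10; rewrite row10E // mxE.
have [-> ->] := pcolE k10.
have -> : (1 : 'I_2) = ord_max by apply: val_inj.
by case: k k10 => [|[|[|[|[|[|[|[|[|[|//]]]]]]]]]] _; rewrite /= !mxE.
Qed.

Lemma wedgeE u v : wedge u v = row10 (wedge_list u v).
Proof.
rewrite /wedge pluckerE; congr (row10 (wedge_list _ _)); apply/rowP => i; rewrite !mxE.
  by case: splitP => // j; rewrite ord1.
by case: splitP => // j; rewrite ord1.
Qed.

Lemma plucker_wedge (M : 'M[K]_(2, 5)) : plucker M = wedge (row ord0 M) (row ord_max M).
Proof. by rewrite wedgeE pluckerE. Qed.

(* The vector such that x /\ x = 2 (v |-> kap x . v), up to the volume form;  *)
(* it vanishes when x has rank at most 2, and otherwise spans the kernel of x *)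
(* viewed as a 2-form.                                                        *)
Definition kap x : 'rV[K]_5 := row5 [::
  x`_[4] * x`_[9] - x`_[5] * x`_[8] + x`_[6] * x`_[7];
  - (x`_[1] * x`_[9] - x`_[2] * x`_[8] + x`_[3] * x`_[7]);
  x`_[0] * x`_[9] - x`_[2] * x`_[6] + x`_[3] * x`_[5];
  - (x`_[0] * x`_[8] - x`_[1] * x`_[6] + x`_[3] * x`_[4]);
  x`_[0] * x`_[7] - x`_[1] * x`_[5] + x`_[2] * x`_[4]].

(** The polarisation of [kap], as stated by [kapD]. *)
Definition kap2 x y : 'rV[K]_5 := row5 [::
  x`_[4] * y`_[9] + x`_[9] * y`_[4] - x`_[5] * y`_[8] - x`_[8] * y`_[5]
    + x`_[6] * y`_[7] + x`_[7] * y`_[6];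
  - (x`_[1] * y`_[9] + x`_[9] * y`_[1] - x`_[2] * y`_[8] - x`_[8] * y`_[2]
    + x`_[3] * y`_[7] + x`_[7] * y`_[3]);
  x`_[0] * y`_[9] + x`_[9] * y`_[0] - x`_[2] * y`_[6] - x`_[6] * y`_[2]
    + x`_[3] * y`_[5] + x`_[5] * y`_[3];
  - (x`_[0] * y`_[8] + x`_[8] * y`_[0] - x`_[1] * y`_[6] - x`_[6] * y`_[1]
    + x`_[3] * y`_[4] + x`_[4] * y`_[3]);
  x`_[0] * y`_[7] + x`_[7] * y`_[0] - x`_[1] * y`_[5] - x`_[5] * y`_[1]
    + x`_[2] * y`_[4] + x`_[4] * y`_[2]].

(* The contraction of the 2-form x by the vector u. *)
Definition ctr x u : 'rV[K]_5 := row5 [::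
  - (x`_[0] * u`_[1] + x`_[1] * u`_[2] + x`_[2] * u`_[3] + x`_[3] * u`_[4]);
  x`_[0] * u`_[0] - x`_[4] * u`_[2] - x`_[5] * u`_[3] - x`_[6] * u`_[4];
  x`_[1] * u`_[0] + x`_[4] * u`_[1] - x`_[7] * u`_[3] - x`_[8] * u`_[4];
  x`_[2] * u`_[0] + x`_[5] * u`_[1] + x`_[7] * u`_[2] - x`_[9] * u`_[4];
  x`_[3] * u`_[0] + x`_[6] * u`_[1] + x`_[8] * u`_[2] + x`_[9] * u`_[3]].

Definition dot5 u v : K := u`_[0] * v`_[0] + u`_[1] * v`_[1] + u`_[2] * v`_[2]
  + u`_[3] * v`_[3] + u`_[4] * v`_[4].

Definition frm x u v : K := dot5 (ctr x u) v.

(* The map p |-> p /\ v, followed by the identification of trivectors with    *)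
(* 2-forms: the gradient of p |-> kap p . v.                                  *)
Definition hodge_list v p := [::
  v`_[2] * p`_[9] - v`_[3] * p`_[8] + v`_[4] * p`_[7];
  v`_[3] * p`_[6] - v`_[1] * p`_[9] - v`_[4] * p`_[5];
  v`_[1] * p`_[8] - v`_[2] * p`_[6] + v`_[4] * p`_[4];
  v`_[2] * p`_[5] - v`_[1] * p`_[7] - v`_[3] * p`_[4];
  v`_[0] * p`_[9] - v`_[3] * p`_[3] + v`_[4] * p`_[2];
  v`_[2] * p`_[3] - v`_[0] * p`_[8] - v`_[4] * p`_[1];
  v`_[0] * p`_[7] - v`_[2] * p`_[2] + v`_[3] * p`_[1];
  v`_[0] * p`_[6] - v`_[1] * p`_[3] + v`_[4] * p`_[0];
  v`_[1] * p`_[2] - v`_[0] * p`_[5] - v`_[3] * p`_[0];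
  v`_[0] * p`_[4] - v`_[1] * p`_[1] + v`_[2] * p`_[0]].

Definition hodge v p := row10 (hodge_list v p).

Ltac case10 k k10 := case: k k10 => [|[|[|[|[|[|[|[|[|[|//]]]]]]]]]] _.
Ltac case5 k k5 := case: k k5 => [|[|[|[|[|//]]]]] _.
Ltac mx_simp := rewrite ?wedgeE; do 2! rewrite ?(row10E, row5E) //=;
  do 2! rewrite ?mxE ?inordK //= ?(row10E, row5E) //=.

Lemma kapD x y : kap (x + y) = kap x + kap y + kap2 x y.
Proof. by apply: row5P => k k5; case5 k k5; mx_simp; ring. Qed.

Lemma kapZ a x : kap (a *: x) = a ^+ 2 *: kap x.
Proof. by apply: row5P => k k5; case5 k k5; mx_simp; ring. Qed.

Lemma kap2Z a b x y : kap2 (a *: x) (b *: y) = (a * b) *: kap2 x y.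
Proof. by apply: row5P => k k5; case5 k k5; mx_simp; ring. Qed.

Lemma kap2D x y z : kap2 (x + y) z = kap2 x z + kap2 y z.
Proof. by apply: row5P => k k5; case5 k k5; mx_simp; ring. Qed.

Lemma kap2C x y : kap2 x y = kap2 y x.
Proof. by apply: row5P => k k5; case5 k k5; mx_simp; ring. Qed.

Lemma kap2xx x : kap2 x x = kap x *+ 2.
Proof. by apply: row5P => k k5; case5 k k5; rewrite mulr2n; mx_simp; ring. Qed.

Lemma ctr_kap x : ctr x (kap x) = 0.
Proof. by apply: row5P => k k5; case5 k k5; mx_simp; ring. Qed.

(** The part linear in y of the identity [ctr_kap] for x + y. *)
Lemma ctr_kap2 x y : ctr x (kap2 x y) = - ctr y (kap x).
Proof. by apply: row5P => k k5; case5 k k5; mx_simp; ring. Qed.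

Lemma ctrDl x y u : ctr (x + y) u = ctr x u + ctr y u.
Proof. by apply: row5P => k k5; case5 k k5; mx_simp; ring. Qed.
Lemma ctrDr x u v : ctr x (u + v) = ctr x u + ctr x v.
Proof. by apply: row5P => k k5; case5 k k5; mx_simp; ring. Qed.
Lemma ctrZl a x u : ctr (a *: x) u = a *: ctr x u.
Proof. by apply: row5P => k k5; case5 k k5; mx_simp; ring. Qed.
Lemma ctrZr a x u : ctr x (a *: u) = a *: ctr x u.
Proof. by apply: row5P => k k5; case5 k k5; mx_simp; ring. Qed.

Lemma frmDr x u v w : frm x u (v + w) = frm x u v + frm x u w.
Proof. by rewrite /frm /dot5; mx_simp; ring. Qed.
Lemma frmDl x u v w : frm x (u + v) w = frm x u w + frm x v w.
Proof. by rewrite /frm /dot5; mx_simp; ring. Qed.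
Lemma frmZr a x u v : frm x u (a *: v) = a * frm x u v.
Proof. by rewrite /frm /dot5; mx_simp; ring. Qed.
Lemma frmZl a x u v : frm x (a *: u) v = a * frm x u v.
Proof. by rewrite /frm /dot5; mx_simp; ring. Qed.
Lemma frmC x u v : frm x u v = - frm x v u.
Proof. by rewrite /frm /dot5; mx_simp; ring. Qed.
Lemma frmxx x u : frm x u u = 0.
Proof. by rewrite /frm /dot5; mx_simp; ring. Qed.

Lemma frm_wedge x u v : (x *m (wedge u v)^T) 0 0 = frm x u v.
Proof. by rewrite mxE sum_ord10 /frm /dot5; mx_simp; ring. Qed.

(** Contraction is an antiderivation: up to duality, the left side is the contraction of p /\ v by
    u. *)
Lemma hodge_hodge u v p :
  hodge u (hodge v p) = dot5 u v *: p - wedge v (ctr p u).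
Proof. by apply: row10P => k k10; case10 k k10; rewrite /dot5; mx_simp; ring. Qed.

Lemma kap_hodge v p : kap (hodge v p) = dot5 v (kap p) *: v.
Proof. by apply: row5P => k k5; case5 k k5; rewrite /dot5; mx_simp; ring. Qed.

Lemma ctr_hodge v p : ctr (hodge v p) v = 0.
Proof. by apply: row5P => k k5; case5 k k5; mx_simp; ring. Qed.

Lemma hodge_wedge u v : hodge u (wedge u v) = 0.
Proof. by apply: row10P => k k10; case10 k k10; mx_simp; ring. Qed.

Lemma kap_wedge u v : kap (wedge u v) = 0.
Proof. by apply: row5P => k k5; case5 k k5; mx_simp; ring. Qed.

Lemma hodgeD v p q : hodge v (p + q) = hodge v p + hodge v q.
Proof. by apply: row10P => k k10; case10 k k10; mx_simp; ring. Qed.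
Lemma hodgeZ v a p : hodge v (a *: p) = a *: hodge v p.
Proof. by apply: row10P => k k10; case10 k k10; mx_simp; ring. Qed.

End Forms.

Ltac case10 k k10 := case: k k10 => [|[|[|[|[|[|[|[|[|[|//]]]]]]]]]] _.
Ltac case5 k k5 := case: k k5 => [|[|[|[|[|//]]]]] _.
Ltac mx_simp := rewrite ?wedgeE; do 2! rewrite ?(row10E, row5E) //=;
  do 2! rewrite ?mxE ?inordK //= ?(row10E, row5E) //=.

Lemma mxrank_mul_inj (F : fieldType) m n q (B : 'M[F]_(m, n)) (C : 'M[F]_(n, q)) :
  (forall y : 'rV_m, y *m B *m C = 0 -> y *m B = 0) -> \rank (B *m C) = \rank B.
Proof.
move=> H; rewrite -(mxrank_mul_ker B C); suff -> : (B :&: kermx C)%MS = 0.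
  by rewrite mxrank0 addn0.
apply/eqP/rowV0P => z; rewrite sub_capmx => /andP[/submxP[y ->] /sub_kermxP].
exact: H.
Qed.

(** * Ranks of the quadrics and of their restrictions *)

Section Ranks.

Variable K : closedFieldType.
Implicit Types (u v w : 'rV[K]_5) (x y p : 'rV[K]_10).

Lemma hodge_linear v : linear (hodge v).
Proof. by move=> a x y; rewrite hodgeD hodgeZ. Qed.

HB.instance Definition _ v :=
  GRing.isLinear.Build K 'rV[K]_10 'rV[K]_10 _ (hodge v) (hodge_linear v).

Lemma wedge_linear v : linear (wedge v).
Proof. by move=> a x y; apply: row10P => k k10; case10 k k10; mx_simp; ring. Qed.

HB.instance Definition _ v :=
  GRing.isLinear.Build K 'rV[K]_5 'rV[K]_10 _ (wedge v) (wedge_linear v).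

Lemma ctr_linear x : linear (ctr x).
Proof. by move=> a u v; rewrite ctrDr ctrZr. Qed.

HB.instance Definition _ x :=
  GRing.isLinear.Build K 'rV[K]_5 'rV[K]_5 _ (ctr x) (ctr_linear x).

Definition hodge_mx v : 'M[K]_10 := lin1_mx (hodge v).
Definition wedge_mx v : 'M[K]_(5, 10) := lin1_mx (wedge v).

Lemma mul_hodge_mx v p : p *m hodge_mx v = hodge v p.
Proof. exact: mul_rV_lin1. Qed.

Lemma mul_wedge_mx v c : c *m wedge_mx v = wedge v c.
Proof. exact: mul_rV_lin1. Qed.

Lemma hodge_sym v x y : (hodge v x *m y^T) 0 0 = (hodge v y *m x^T) 0 0.
Proof. by rewrite !mxE !sum_ord10; mx_simp; ring. Qed.

Lemma hodge_quad v x : (hodge v x *m x^T) 0 0 = 2 * dot5 v (kap x).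
Proof. by rewrite !mxE !sum_ord10 /dot5; mx_simp; ring. Qed.

Lemma tr_hodge_mx v : (hodge_mx v)^T = hodge_mx v.
Proof.
apply/matrixP => i j; rewrite mxE.
have E a b : hodge_mx v a b = (hodge v (delta_mx 0 a) *m (delta_mx 0 b : 'rV_10)^T) 0 0.
  rewrite -mul_hodge_mx -rowE [RHS]mxE (bigD1 b) //= big1 => [|c cb]; rewrite !mxE.
    by rewrite !eqxx /= mulr1 addr0.
  by rewrite (negPf cb) andbF mulr0.
by rewrite !E hodge_sym.
Qed.

Lemma row5_neq0 v : v != 0 -> exists2 i, v 0 i != 0 & exists u, dot5 u v = 1.
Proof.
move=> /rV0Pn[i vi]; exists i => //; move: i vi; apply: ord5P => k k5 vk.
exists ((v 0 (inord k))^-1 *: delta_mx 0 (inord k)); move: vk.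
by case5 k k5 => vk; rewrite /dot5 !mxE /= -!val_eqE /= !inordK //=; field.
Qed.

Lemma hodge_eq0 v p : v != 0 -> hodge v p = 0 -> exists c, p = wedge v c.
Proof.
move=> /row5_neq0[_ _ [u uv]] vp; exists (ctr p u).
by have := hodge_hodge u v p; rewrite vp linear0 uv scale1r => /esym/eqP; rewrite subr_eq0 => /eqP.
Qed.

Lemma ctr_eq0 v x : v != 0 -> ctr x v = 0 -> exists p, x = hodge v p.
Proof.
move=> /row5_neq0[_ _ [u uv]] vx; exists (hodge u x).
have uv' : dot5 v u = 1 by rewrite -uv /dot5; ring.
by rewrite hodge_hodge vx linear0 uv' scale1r subr0.
Qed.

Lemma wedge_eq0 v c : v != 0 -> wedge v c = 0 -> exists a, c = a *: v.
Proof.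
move=> /row5_neq0[_ _ [u uv]] vc; exists (dot5 u c).
have : dot5 u v *: c - dot5 u c *: v = ctr (wedge v c) u.
  by apply: row5P => k k5; case5 k k5; rewrite /dot5; mx_simp; ring.
have c0 : ctr 0 u = 0 by apply: row5P => k k5; case5 k k5; mx_simp; ring.
by rewrite vc c0 uv scale1r => /eqP; rewrite subr_eq0 => /eqP.
Qed.

Lemma rank_wedge_mx v : v != 0 -> \rank (wedge_mx v) = 4%N.
Proof.
move=> v0; have : \rank (kermx (wedge_mx v)) = 1%N.
  apply/eqP; rewrite eqn_leq; apply/andP; split.
    rewrite (@leq_trans (\rank v)) ?rank_leq_row // mxrankS //.
    apply/rV_subP => c /sub_kermxP; rewrite mul_wedge_mx => /(wedge_eq0 v0)[a ->].
    exact: scalemx_sub.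
  rewrite lt0n mxrank_eq0; apply: contraNneq v0 => k0.
  have : (v <= kermx (wedge_mx v))%MS.
    apply/sub_kermxP; rewrite mul_wedge_mx.
    by apply: row10P => k k10; case10 k k10; mx_simp; ring.
  by rewrite k0 submx0.
rewrite mxrank_ker; have := rank_leq_row (wedge_mx v).
by case: (\rank _) => [|[|[|[|[|[|//]]]]]].
Qed.

(** Exactness of the Koszul complex: p /\ v = 0 exactly when p is in v /\ V, of dimension 4. *)
Lemma rank_hodge_mx v : v != 0 -> \rank (hodge_mx v) = 6%N.
Proof.
move=> v0; apply/eqP; rewrite eqn_leq; apply/andP; split.
  have := mulmx0_rank_max (_ : wedge_mx v *m hodge_mx v = 0).
  rewrite rank_wedge_mx // => H; rewrite -(leq_add2l 4); apply: H.
  by apply/row_matrixP => i; rewrite row_mul rowE mul_wedge_mx mul_hodge_mx hodge_wedge row0.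
have : (\rank (kermx (hodge_mx v)) <= 4)%N.
  apply: (@leq_trans (\rank (wedge_mx v))); last by rewrite rank_wedge_mx.
  apply: mxrankS.
  apply/rV_subP => p /sub_kermxP.
  rewrite mul_hodge_mx => /(hodge_eq0 v0)[c ->].
  by rewrite -mul_wedge_mx submxMl.
rewrite mxrank_ker; have := rank_leq_row (hodge_mx v).
by move: (\rank _) => r; do 11!(case: r => [|r] //).
Qed.

Section Sections.

Variables (n : nat) (A : 'M[K]_(n, 10)).

(** Twice the symmetric matrix of the restriction of [Q_v] to the row space of A. *)
Definition section_mx v : 'M[K]_n := A *m hodge_mx v *m A^T.

Definition annihilates x := A *m x^T = 0.

Lemma annihilates_tr x : annihilates x <-> x *m A^T = 0.
Proof.
by split=> h; apply: trmx_inj; rewrite trmx_mul ?trmxK trmx0 // -h trmx_mul trmxK.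
Qed.

Lemma annihilatesD x y : annihilates x -> annihilates y -> annihilates (x + y).
Proof. by rewrite /annihilates linearD mulmxDr => -> ->; rewrite addr0. Qed.

Lemma annihilatesZ a x : annihilates x -> annihilates (a *: x).
Proof. by rewrite /annihilates linearZ /= -scalemxAr => ->; rewrite scaler0. Qed.

Lemma rank_hodge_section v : \rank (hodge_mx v *m A^T) = \rank (A *m hodge_mx v).
Proof. by rewrite -mxrank_tr trmx_mul trmxK tr_hodge_mx. Qed.

(** Elements of the image of [hodge_mx v] are killed by v, and [A^T] kills exactly the annihilator
    of A; as these meet in 0, no rank is lost on either side. *)
Lemma section_rank_ge6 v : v != 0 ->
  (forall x, annihilates x -> ctr x v = 0 -> x = 0) -> (6 <= \rank (section_mx v))%N.
Proof.
move=> v0 H; rewrite /section_mx mxrank_mul_inj => [|y].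
  rewrite -rank_hodge_section mxrank_mul_inj ?rank_hodge_mx // => y.
  rewrite mul_hodge_mx => /annihilates_tr/H; apply.
  exact: ctr_hodge.
rewrite mulmxA mul_hodge_mx => /annihilates_tr/H; apply.
exact: ctr_hodge.
Qed.

Lemma section_rank_ge5 v x : v != 0 -> annihilates x -> ctr x v = 0 -> kap x != 0 ->
  2 != 0 :> K ->
  (forall y, annihilates y -> ctr y v = 0 -> exists a, y = a *: x) ->
  (5 <= \rank (section_mx v))%N.
Proof.
move=> v0 Ax xv kx n2 H; have [p xE] := ctr_eq0 v0 xv.
rewrite /section_mx mxrank_mul_inj => [|y].
  (* On one side at most the line of x is lost. On the other nothing is: if a x = [hodge v (y *m A)]
     with x = [hodge v p], pairing with p gives 2 a [dot5 v (kap p)] = 0, while [kap x] != 0. *)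
  have := mxrank_mul_ker (hodge_mx v) A^T; rewrite rank_hodge_section rank_hodge_mx //.
  suff r1 : (\rank (hodge_mx v :&: kermx A^T)%MS <= 1)%N.
    by move=> e; rewrite -(leq_add2r (\rank (hodge_mx v :&: kermx A^T)%MS)) e (leq_add2l 5 _ 1).
  rewrite (@leq_trans (\rank x)) ?rank_leq_row // mxrankS //.
  apply/rV_subP => z; rewrite sub_capmx => /andP[/submxP[y ->] /sub_kermxP].
  rewrite mul_hodge_mx => /annihilates_tr/H[|a ->]; first exact: ctr_hodge.
  exact: scalemx_sub.
rewrite mulmxA mul_hodge_mx => /annihilates_tr/H[|a yE]; first exact: ctr_hodge.
have : a * (hodge v p *m p^T) 0 0 = 0.
  have -> : a * (hodge v p *m p^T) 0 0 = (hodge v (y *m A) *m p^T) 0 0.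
    by rewrite yE xE -scalemxAl [RHS]mxE.
  rewrite hodge_sym -xE trmx_mul mulmxA.
  by have /annihilates_tr-> := Ax; rewrite mul0mx mxE.
rewrite hodge_quad mulrA => /eqP; rewrite mulf_eq0 => /orP[|/eqP k0].
  by rewrite mulf_eq0 (negPf n2) orbF => /eqP a0; rewrite yE a0 scale0r.
by move: kx; rewrite xE kap_hodge k0 scale0r eqxx.
Qed.

Lemma section_rank_le6 v : (\rank (section_mx v) <= 6)%N.
Proof.
have [->|v0] := eqVneq v 0; last first.
  apply: (@leq_trans (\rank (hodge_mx v))); last by rewrite rank_hodge_mx.
  by rewrite /section_mx -mulmxA (leq_trans (mxrankM_maxr _ _)) // mxrankM_maxl.
suff -> : section_mx 0 = 0 by rewrite mxrank0.
rewrite /section_mx; suff -> : hodge_mx 0 = 0 by rewrite mulmx0 mul0mx.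
apply/row_matrixP => i; rewrite rowE mul_hodge_mx row0.
by apply: row10P => k k10; case10 k k10; mx_simp; ring.
Qed.

Lemma section_rank_le5 v x : annihilates x -> x != 0 -> ctr x v = 0 -> v != 0 ->
  (\rank (section_mx v) <= 5)%N.
Proof.
move=> Ax x0 xv v0; have [p xE] := ctr_eq0 v0 xv.
rewrite /section_mx -mulmxA (leq_trans (mxrankM_maxr _ _)) //.
have := mxrank_mul_ker (hodge_mx v) A^T; rewrite rank_hodge_mx //.
suff r1 : (1 <= \rank (hodge_mx v :&: kermx A^T)%MS)%N.
  by move=> e; rewrite -ltnS -(leq_add2r (\rank (hodge_mx v :&: kermx A^T)%MS)) addSn e (leq_add2l 6 1).
rewrite (leq_trans _ (_ : \rank x <= _)%N) ?lt0n ?mxrank_eq0 //.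
rewrite mxrankS // sub_capmx; apply/andP; split.
  by rewrite xE -mul_hodge_mx submxMl.
by apply/sub_kermxP/annihilates_tr.
Qed.

(* As kap x = 0 means that x has rank at most 2, no nonzero equation of the   *)
(* linear space has rank 2: this is what smoothness provides.                 *)
Definition rank4_forms := forall x, annihilates x -> kap x = 0 -> x = 0.

Lemma quad_root (a b c : K) : exists st : K * K,
  (st != (0, 0)) /\ a * st.1 ^+ 2 + b * (st.1 * st.2) + c * st.2 ^+ 2 = 0.
Proof.
have [a0|a0] := eqVneq a 0.
  exists (1, 0); rewrite a0 /=; split; last by ring.
  by rewrite xpair_eqE oner_eq0.
have [s sE] := @solve_monicpoly K 2 (fun i => if i == 0%N then - c / a else - b / a) isT.
exists (s, 1); split; first by rewrite xpair_eqE oner_eq0 andbF.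
by rewrite /= sE big_ord_recl big_ord1 /= /bump /=; field.
Qed.

(* Otherwise all the forms of a pencil would be pulled back from a space of   *)
(* dimension 4, where the Pfaffian is a binary quadratic form on the pencil.  *)
Lemma common_kernel v x y : rank4_forms -> v != 0 ->
  annihilates x -> annihilates y -> ctr x v = 0 -> ctr y v = 0 ->
  exists s t, (s, t) != (0, 0) /\ s *: x + t *: y = 0.
Proof.
move=> nd v0 Ax Ay xv yv; have [p xE] := ctr_eq0 v0 xv; have [q yE] := ctr_eq0 v0 yv.
have [[s t] [st0 /= e]] := quad_root (dot5 v (kap p)) (dot5 v (kap2 p q)) (dot5 v (kap q)).
exists s, t; split=> //; apply: nd; first by apply: annihilatesD; apply: annihilatesZ.
rewrite xE yE -!hodgeZ -hodgeD kap_hodge.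
suff -> : dot5 v (kap (s *: p + t *: q)) = 0 by rewrite scale0r.
rewrite kapD !kapZ kap2Z -e /dot5; mx_simp; ring.
Qed.

Lemma kap_kernel v x : rank4_forms -> annihilates x -> x != 0 -> v != 0 ->
  ctr x v = 0 -> exists2 a, a != 0 & kap x = a *: v.
Proof.
move=> nd Ax x0 v0 xv; have [p xE] := ctr_eq0 v0 xv.
have k : kap x = dot5 v (kap p) *: v by rewrite {1}xE kap_hodge.
exists (dot5 v (kap p)) => //; apply: contraNneq x0 => a0.
by apply/eqP/nd => //; rewrite k a0 scale0r.
Qed.

End Sections.

End Ranks.

(** * Decomposable bivectors and the action of GL_5 *)

Section BaseChange.

Variable K : closedFieldType.
Implicit Types (u v w : 'rV[K]_5) (x y p : 'rV[K]_10) (g h : 'M[K]_5).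

Lemma wedge_ctr p u v :
  wedge (ctr p u) (ctr p v) = frm p u v *: p - hodge (kap p) (wedge u v).
Proof. by apply: row10P => k k10; case10 k k10; rewrite /frm /dot5; mx_simp; ring. Qed.

Definition unit_row k : 'rV[K]_5 := delta_mx 0 (inord k).

Definition pair1 k := nth 0%N [:: 0; 0; 0; 0; 1; 1; 1; 2; 2; 3]%N k.
Definition pair2 k := nth 0%N [:: 1; 2; 3; 4; 2; 3; 4; 3; 4; 4]%N k.

Lemma frm_unit_row p k : (k < 10)%N -> frm p (unit_row (pair1 k)) (unit_row (pair2 k)) = p`_[k].
Proof.
move=> k10; case10 k k10; rewrite /frm /dot5 /unit_row /=; mx_simp; rewrite -!val_eqE /= !inordK //=; ring.
Qed.

Lemma form_neq0 p : p != 0 -> exists u v, frm p u v = 1.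
Proof.
move=> /rV0Pn[i]; move: i; apply: ord10P => k k10 pk.
exists (unit_row (pair1 k)), ((p`_[k])^-1 *: unit_row (pair2 k)).
by rewrite frmZr frm_unit_row // mulVf.
Qed.

(** By [wedge_ctr], contracting p by two vectors on which it takes the value 1 yields the two
    factors. *)
Lemma decomposable p : kap p = 0 -> p != 0 -> exists u v, p = wedge u v.
Proof.
move=> k0 /form_neq0[u [v uv]]; exists (ctr p u), (ctr p v).
rewrite wedge_ctr uv scale1r k0; apply/eqP; rewrite -subr_eq0 opprB addrCA subrr addr0; apply/eqP.
by apply: row10P => k k10; case10 k k10; mx_simp; ring.
Qed.

Lemma wedge_row_free u v : wedge u v != 0 -> row_free (col_mx u v).
Proof.
move=> uv; rewrite -kermx_eq0; apply/rowV0P => y /sub_kermxP.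
rewrite -[y]hsubmxK mul_row_col [lsubmx y]mx11_scalar [rsubmx y]mx11_scalar !mul_scalar_mx.
move: (lsubmx y 0 0) (rsubmx y 0 0) => s t e.
have cross a b : wedge (a *: u + b *: v) v = a *: wedge u v.
  by apply: row10P => k k10; case10 k k10; mx_simp; ring.
have cross' a b : wedge u (a *: u + b *: v) = b *: wedge u v.
  by apply: row10P => k k10; case10 k k10; mx_simp; ring.
have w0 : wedge (0 : 'rV_5) v = 0 by apply: row10P => k k10; case10 k k10; mx_simp; ring.
have /eqP := cross s t; rewrite e w0 eq_sym scaler_eq0 (negPf uv) orbF => /eqP->.
have /eqP := cross' s t; rewrite e linear0 eq_sym scaler_eq0 (negPf uv) orbF => /eqP->.
by apply/rowP => i; rewrite !mxE; case: splitP => j _; rewrite mxE mul0rn.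
Qed.

(** The second exterior power of g. [pullback], through its transpose, is the change of basis for
    2-forms. *)
Definition wedge2 g : 'M[K]_10 :=
  \matrix_(a, b) wedge (row (pcol1 a) g) (row (pcol2 a) g) 0 b.

Lemma row_wedge2 g k : (k < 10)%N ->
  row (inord k) (wedge2 g) = wedge (row (inord (pair1 k)) g) (row (inord (pair2 k)) g).
Proof. by move=> k10; apply/rowP => b; rewrite !mxE; have [-> ->] := pcolE k10. Qed.

Lemma wedge2E g a b : (a < 10)%N -> (b < 10)%N ->
  wedge2 g (inord a) (inord b) =
  g (inord (pair1 a)) (inord (pair1 b)) * g (inord (pair2 a)) (inord (pair2 b)) -
  g (inord (pair1 a)) (inord (pair2 b)) * g (inord (pair2 a)) (inord (pair1 b)).
Proof.
move=> a10 b10; rewrite mxE wedgeE row10E //.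
have [-> ->] := pcolE a10.
by case10 b b10; rewrite /= !mxE.
Qed.

Lemma tr_wedge2 g : (wedge2 g)^T = wedge2 g^T.
Proof.
apply/matrixP; apply: ord10P => a a10; apply: ord10P => b b10.
by rewrite mxE !wedge2E // !mxE; ring.
Qed.

Lemma wedge_mulmx u v g : wedge (u *m g) (v *m g) = wedge u v *m wedge2 g.
Proof.
apply: row10P => b b10; rewrite [RHS]mxE sum_ord10 !wedge2E //.
rewrite !wedgeE !row10E //.
by case10 b b10; rewrite /= !mxE !sum_ord5; ring.
Qed.

Lemma wedge2M g h : wedge2 (g *m h) = wedge2 g *m wedge2 h.
Proof.
apply/row_matrixP; apply: ord10P => k k10.
by rewrite row_mul !row_wedge2 // !row_mul wedge_mulmx.
Qed.

Lemma wedge2_1 : wedge2 1%:M = 1%:M.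
Proof.
apply/row_matrixP; apply: ord10P => k k10; rewrite row_wedge2 // row1.
apply: row10P => b b10; rewrite wedgeE row10E //.
by case10 k k10; case10 b b10; rewrite /= !mxE -!val_eqE /= !inordK //= ?mulr0 ?mulr1 ?mul0r ?subrr ?subr0.
Qed.

Lemma wedge2_unit g : g \in unitmx -> wedge2 g \in unitmx.
Proof.
move=> gu; have := wedge2M g (invmx g); rewrite mulmxV // wedge2_1 => /esym.
by case/mulmx1_unit.
Qed.

Lemma wedge2V g : g \in unitmx -> wedge2 g *m wedge2 (invmx g) = 1%:M.
Proof. by move=> gu; rewrite -wedge2M mulmxV // wedge2_1. Qed.

Lemma kap_wedge2 x g : kap x = 0 -> kap (x *m wedge2 g) = 0.
Proof.
move=> k0; have [->|/(decomposable k0)[u [v ->]]] := eqVneq x 0.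
  by rewrite mul0mx; apply: row5P => k k5; case5 k k5; mx_simp; ring.
by rewrite -wedge_mulmx kap_wedge.
Qed.

Definition pullback g x : 'rV[K]_10 := x *m (wedge2 g)^T.

Lemma pullbackE g x k : (k < 10)%N ->
  (pullback g x)`_[k] = frm x (row (inord (pair1 k)) g) (row (inord (pair2 k)) g).
Proof.
move=> k10; rewrite -frm_wedge -row_wedge2 // !mxE; apply: eq_bigr => j _.
by rewrite !mxE.
Qed.

Lemma pullbackK g : g \in unitmx -> cancel (pullback g) (pullback (invmx g)).
Proof.
move=> gu x; rewrite /pullback -mulmxA -trmx_mul.
by rewrite -wedge2M mulVmx // wedge2_1 trmx1 mulmx1.
Qed.

Lemma pullback_annihilates n (A : 'M[K]_(n, 10)) g x : g \in unitmx ->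
  annihilates A x -> annihilates (A *m wedge2 (invmx g)) (pullback g x).
Proof.
move=> gu Ax; rewrite /annihilates /pullback trmx_mul trmxK mulmxA -(mulmxA A).
by rewrite -wedge2M mulVmx // wedge2_1 mulmx1.
Qed.

Lemma rank4_forms_mul n (A : 'M[K]_(n, 10)) g : g \in unitmx ->
  rank4_forms A -> rank4_forms (A *m wedge2 g).
Proof.
move=> gu nd x Ax kx.
have e : pullback g x = 0.
  apply: nd; first by rewrite /annihilates /pullback trmx_mul trmxK mulmxA.
  by rewrite /pullback tr_wedge2 kap_wedge2.
by rewrite -(pullbackK gu x) e /pullback mul0mx.
Qed.

Lemma dual_vectors u v : (forall s t, s *: u + t *: v = 0 -> s = 0 /\ t = 0) ->
  exists f0 f1, [/\ dot5 u f0 = 1, dot5 v f0 = 0, dot5 u f1 = 0 & dot5 v f1 = 1].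
Proof.
move=> indep; have fr : row_free (col_mx u v).
  rewrite -kermx_eq0; apply/rowV0P => y /sub_kermxP.
  rewrite -[y]hsubmxK mul_row_col [lsubmx y]mx11_scalar [rsubmx y]mx11_scalar !mul_scalar_mx.
  move/indep => [-> ->].
  by apply/rowP => i; rewrite !mxE; case: splitP => j _; rewrite mxE mul0rn.
have [B BE] : exists B, col_mx u v *m B = 1%:M by exists (pinvmx (col_mx u v)); apply: mulmxVp.
have dotE (w f : 'rV[K]_5) : dot5 w f = (w *m f^T) 0 0.
  by rewrite mxE sum_ord5 /dot5 !mxE.
have E (i j : 'I_2) : (row i (col_mx u v) *m (row j B^T)^T) 0 0 = (i == j)%:R.
  move/matrixP/(_ i j): BE; rewrite [RHS]mxE => <-.
  by rewrite !mxE; apply: eq_bigr => k _; rewrite !mxE.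
have r0 : row ord0 (col_mx u v) = u.
  by apply/rowP => i; rewrite !mxE; case: splitP => // j; rewrite ord1.
have r1 : row ord_max (col_mx u v) = v.
  by apply/rowP => i; rewrite !mxE; case: splitP => // j; rewrite ord1.
exists (row ord0 B^T), (row ord_max B^T).
have := (E ord0 ord0, E ord_max ord0, E ord0 ord_max, E ord_max ord_max).
by rewrite r0 r1 !dotE => -[[[-> ->] ->] ->].
Qed.

Definition of_rows (s : seq 'rV[K]_5) : 'M[K]_5 := \matrix_i nth 0 s i.

Lemma row_of_rows s k : (k < 5)%N -> row (inord k) (of_rows s) = nth 0 s k.
Proof. by move=> k5; rewrite rowK inordK. Qed.

Lemma of_rows_unit s :
  (forall a0 a1 a2 a3 a4, a0 *: nth 0 s 0 + a1 *: nth 0 s 1 + a2 *: nth 0 s 2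
     + a3 *: nth 0 s 3 + a4 *: nth 0 s 4 = 0 ->
     [/\ a0 = 0, a1 = 0, a2 = 0, a3 = 0 & a4 = 0]) -> of_rows s \in unitmx.
Proof.
move=> indep; rewrite -row_free_unit -kermx_eq0; apply/rowV0P => y /sub_kermxP.
rewrite mulmx_sum_row sum_ord5 !row_of_rows // => /indep[*].
by apply/rowP; apply: ord5P => k k5; case5 k k5; rewrite mxE.
Qed.

Definition omega0 : 'rV[K]_10 := row10 [:: 0; 1; 0; 0; 0; 1].
Definition omega1 : 'rV[K]_10 := row10 [:: 0; 0; 1; 0; 0; 0; 1].

Lemma frm_kap x u : frm x u (kap x) = 0.
Proof.
rewrite frmC /frm ctr_kap; rewrite /dot5 !mxE; ring.
Qed.

Lemma frm_unit_rowr x u k : (k < 5)%N -> frm x u (unit_row k) = (ctr x u)`_[k].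
Proof.
move=> k5; rewrite /frm; move: (ctr x u) => v.
by case5 k k5; rewrite /dot5 /unit_row !mxE -!val_eqE /= !inordK //=; ring.
Qed.

Lemma frm_lin x a b c d e u v w r s t :
  frm x (a *: u + b *: v + c *: w + d *: r + e *: s) t =
  a * frm x u t + b * frm x v t + c * frm x w t + d * frm x r t + e * frm x s t.
Proof. by rewrite !frmDl !frmZl. Qed.

(** The new basis consists of two hyperbolic pairs (f0, e2), (f1, e3) and the kernel vector [kap x];
    [orth] projects to the orthogonal of the first pair. *)
Lemma rank4_normal_form x : kap x != 0 -> exists2 g, g \in unitmx & pullback g x = omega0.
Proof.
move=> k0; have x0 : x != 0.
  by apply: contraNneq k0 => ->; apply/eqP; apply: row5P => k k5; case5 k k5; mx_simp; ring.
have [f0 [e2 f02]] := form_neq0 x0.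
pose orth c := c - frm x c e2 *: f0 + frm x c f0 *: e2.
have orthE c d : frm x (orth c) d = frm x c d - frm x c e2 * frm x f0 d + frm x c f0 * frm x e2 d.
  by rewrite /orth !frmDl -scaleNr !frmZl mulNr.
have e2f0 : frm x e2 f0 = -1 by rewrite frmC f02.
have orth_e2 c : frm x (orth c) e2 = 0 by rewrite orthE f02 frmxx; ring.
have orth_f0 c : frm x (orth c) f0 = 0 by rewrite orthE e2f0 frmxx; ring.
have [c [d cd]] : exists c d, frm x (orth c) (orth d) = 1.
  (* The coordinates of the difference are the values of x on projected basis vectors; if all
     vanished, x would be decomposable. *)
  have : x != wedge (- ctr x e2) (ctr x f0).
    by apply: contraNneq k0 => ->; rewrite kap_wedge.
  rewrite -subr_eq0 => /rV0Pn[i]; move: i; apply: ord10P => k k10.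
  have tE : frm x (orth (unit_row (pair1 k))) (orth (unit_row (pair2 k))) =
      (x - wedge (- ctr x e2) (ctr x f0))`_[k].
    rewrite frmC orthE (frmC x f0 (orth _)) (frmC x e2 (orth _)) orth_e2 orth_f0.
    rewrite !oppr0 !mulr0 subr0 addr0 -frmC orthE frm_unit_row //.
    rewrite (frmC x _ e2) (frmC x _ f0).
    by case10 k k10; rewrite /= !frm_unit_rowr //; mx_simp; ring.
  move=> pk; exists (unit_row (pair1 k)), (((x - wedge (- ctr x e2) (ctr x f0))`_[k])^-1 *: unit_row (pair2 k)).
  have -> a e : orth (a *: e) = a *: orth e.
    by rewrite /orth !frmZl !scalerDr !scalerN !scalerA.
  by rewrite frmZr tE mulVf.
move: (orth c) (orth d) (orth_e2 c) (orth_e2 d) (orth_f0 c) (orth_f0 d) cd.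
move=> f1 e3 f12 e32 f10 e30 f13 {c d orth orthE orth_e2 orth_f0}.
pose s := [:: f0; f1; e2; e3; kap x].
have kx u : frm x (kap x) u = 0 by rewrite frmC frm_kap oppr0.
exists (of_rows s).
  apply: of_rows_unit => a0 a1 a2 a3 a4 /= e.
  have F t : a0 * frm x f0 t + a1 * frm x f1 t + a2 * frm x e2 t + a3 * frm x e3 t = 0.
    by have := frm_lin x a0 a1 a2 a3 a4 f0 f1 e2 e3 (kap x) t; rewrite e kx mulr0 addr0 => <-;
      rewrite -(scale0r 0) frmZl mul0r.
  have a00 : a0 = 0 by move: (F e2); rewrite f02 f12 frmxx e32 !mulr0 !addr0 mulr1.
  have a10 : a1 = 0.
    by move: (F e3); rewrite a00 f13 (frmC x e2) e32 frmxx oppr0 !mulr0 mul0r add0r !addr0 mulr1.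
  have a20 : a2 = 0.
    move: (F f0); rewrite a00 a10 e2f0 e30 !mul0r mulr0 !add0r addr0 mulrN1.
    by move/eqP; rewrite oppr_eq0 => /eqP.
  have a30 : a3 = 0.
    move: (F f1); rewrite a00 a10 a20 (frmC x e3) f13 !mul0r !add0r mulrN1.
    by move/eqP; rewrite oppr_eq0 => /eqP.
  split=> //; move/eqP: e; rewrite a00 a10 a20 a30 !scale0r !add0r scaler_eq0 (negPf k0) orbF.
  by move/eqP.
have f01 : frm x f0 f1 = 0 by rewrite frmC f10 oppr0.
have f03 : frm x f0 e3 = 0 by rewrite frmC e30 oppr0.
have e23 : frm x e2 e3 = 0 by rewrite frmC e32 oppr0.
apply: row10P => k k10; rewrite pullbackE // row10E //.
by case10 k k10; rewrite /pair1 /pair2 /= !row_of_rows //= ?frm_kap.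
Qed.

End BaseChange.

(** * Normal forms of pencils and nets of 2-forms *)

Section NormalForms.

Variable K : closedFieldType.
Implicit Types (u v w : 'rV[K]_5) (x y z p : 'rV[K]_10) (g h : 'M[K]_5).

Notation omega0 := (omega0 K).
Notation omega1 := (omega1 K).

Section Sections.

Variables (n : nat) (A : 'M[K]_(n, 10)).
Hypothesis nd : rank4_forms A.

Definition free2 x y := forall s t, s *: x + t *: y = 0 -> s = 0 /\ t = 0.
Definition free3 x y z :=
  forall r s t, r *: x + s *: y + t *: z = 0 -> [/\ r = 0, s = 0 & t = 0].

Lemma free2_common_kernel x y v : annihilates A x -> annihilates A y -> free2 x y ->
  ctr x v = 0 -> ctr y v = 0 -> v = 0.
Proof.
move=> Ax Ay xy xv yv; apply/eqP/negPn/negP => v0.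
have [s [t [st0 /xy[s0 t0]]]] := common_kernel nd v0 Ax Ay xv yv.
by rewrite s0 t0 eqxx in st0.
Qed.

Lemma kap_neq0 x : annihilates A x -> x != 0 -> kap x != 0.
Proof. by move=> Ax; apply: contra_neq => /(nd Ax). Qed.

(** The kernels of s x + t y trace the conic s^2 [kap x] + s t [kap2 x y] + t^2 [kap y]. Its
    coefficients form a chain e4, e3, e2 in which x kills e4, y kills e2 and y e4 = x e3, y e3 = x
    e2; vectors f0, f1 dual to it complete the basis. *)
Lemma pencil_normal_form x y : annihilates A x -> annihilates A y -> free2 x y ->
  exists g, [/\ g \in unitmx, pullback g x = omega0, pullback g y = omega1,
    row (inord 2) g = kap y
    & row (inord 3) g = - kap2 x y /\ row (inord 4) g = kap x].
Proof.
move=> Ax Ay xy.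
have x0 : x != 0.
  apply/eqP => x0; have [/eqP] : (1 : K) = 0 /\ (0 : K) = 0.
    by apply: xy; rewrite x0 scaler0 scale0r addr0.
  by rewrite oner_eq0.
pose e2 := kap y; pose e3 := - kap2 x y; pose e4 := kap x.
have ctrN z u : ctr z (- u) = - ctr z u by rewrite linearN.
have x4 : ctr x e4 = 0 by rewrite ctr_kap.
have y2 : ctr y e2 = 0 by rewrite ctr_kap.
have y4 : ctr y e4 = ctr x e3 by rewrite /e3 ctrN ctr_kap2 opprK.
have y3 : ctr y e3 = ctr x e2 by rewrite /e3 ctrN kap2C ctr_kap2 opprK.
(* A relation would make x kill the kernel vector of another form of the pencil, or y that of x. A
   vector killed by two independent forms is zero, against [kap_neq0]. *)
have indep s t : s *: ctr x e2 + t *: ctr x e3 = 0 -> s = 0 /\ t = 0.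
  move=> st; have [s0|s0] := eqVneq s 0.
    split=> //; move: st; rewrite s0 scale0r add0r => /eqP; rewrite scaler_eq0.
    case/orP => [/eqP//|/eqP x3]; have := kap_neq0 Ax x0; rewrite -/e4.
    by rewrite (free2_common_kernel Ax Ay xy x4) ?eqxx // y4.
  pose m := - t / s; pose y' := y + m *: x.
  have xy' : free2 x y'.
    move=> a b; rewrite /y' scalerDr scalerA addrCA -scalerDl addrC => /xy[/eqP + b0].
    by rewrite b0 mul0r addr0 => /eqP.
  have Ay' : annihilates A y' by apply: annihilatesD => //; apply: annihilatesZ.
  have ky' : kap y' = kap y + m *: kap2 x y + m ^+ 2 *: kap x.
    by rewrite /y' kapD kapZ -[y in kap2 y _]scale1r kap2Z mul1r kap2C -addrA (addrC (_ *: kap x)) addrA.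
  have xk : ctr x (kap y') = 0.
    rewrite ky' !linearD !linearZ /= ctr_kap scaler0 addr0 -[kap2 x y]opprK -/e3 -/e2.
    rewrite linearN /= scalerN -scaleNr /m mulNr opprK.
    apply: (scalerI s0); rewrite scaler0 scalerDr scalerA.
    by have -> : s * (t / s) = t by field.
  have y'0 : y' != 0.
    apply/eqP => y'0; have [_ /eqP] : (0 : K) = 0 /\ (1 : K) = 0.
      by apply: xy'; rewrite y'0 scaler0 scale0r addr0.
    by rewrite oner_eq0.
  have := kap_neq0 Ay' y'0.
  by rewrite (free2_common_kernel Ax Ay' xy' xk) ?eqxx // ctr_kap.
have indep' s t : s *: (- ctr x e2) + t *: (- ctr x e3) = 0 -> s = 0 /\ t = 0.
  by rewrite !scalerN -opprD => /eqP; rewrite oppr_eq0 => /eqP/indep.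
have [f0 [f1 [a2f0 a3f0 a2f1 a3f1]]] := dual_vectors indep'.
have dotN u v : dot5 (- u) v = - dot5 u v by rewrite /dot5 !mxE; ring.
have FE z e f : dot5 (- ctr z e) f = frm z f e by rewrite dotN -/(frm z e f) -frmC.
have x02 : frm x f0 e2 = 1 by rewrite -FE.
have x03 : frm x f0 e3 = 0 by rewrite -FE.
have x12 : frm x f1 e2 = 0 by rewrite -FE.
have x13 : frm x f1 e3 = 1 by rewrite -FE.
have F0 z e f : ctr z e = 0 -> frm z f e = 0.
  by move=> ze; rewrite -FE ze oppr0 /dot5 !mxE; ring.
have fx4 f : frm x f e4 = 0 by exact: F0.
have fy2 f : frm y f e2 = 0 by exact: F0.
have fy3 f : frm y f e3 = frm x f e2 by rewrite -!FE y3.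
have fy4 f : frm y f e4 = frm x f e3 by rewrite -!FE y4.
have x32 : frm x e3 e2 = 0 by rewrite -fy3 frmxx.
have x23 : frm x e2 e3 = 0 by rewrite frmC x32 oppr0.
(* The correction makes both x and y vanish on the pair f0', f1. *)
pose f0' := f0 + frm x f0 f1 *: e3 + frm y f0 f1 *: e4.
have F' z f : frm z f0' f = frm z f0 f + frm x f0 f1 * frm z e3 f + frm y f0 f1 * frm z e4 f.
  by rewrite /f0' !frmDl !frmZl.
have C z e f a : frm z f e = a -> frm z e f = - a by move=> <-; exact: frmC.
have x4f f : frm x e4 f = 0 by rewrite (C _ _ _ _ (fx4 f)) oppr0.
pose s := [:: f0'; f1; e2; e3; e4].
have x02' : frm x f0' e2 = 1 by rewrite F' x02 x32 x4f; ring.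
have x03' : frm x f0' e3 = 0 by rewrite F' x03 frmxx x4f; ring.
have x01' : frm x f0' f1 = 0 by rewrite F' (C _ _ _ _ x13) x4f; ring.
have y01' : frm y f0' f1 = 0.
  rewrite F' (C y e3 f1 0); last by rewrite fy3.
  by rewrite (C y e4 f1 1); [ring | rewrite fy4].
have e40 : e4 != 0 by exact: kap_neq0.
have gu : of_rows s \in unitmx.
  apply: of_rows_unit => a0 a1 a2 a3 a4 /= e.
  have F t : a0 * frm x f0' t + a1 * frm x f1 t + a2 * frm x e2 t + a3 * frm x e3 t = 0.
    by have := frm_lin x a0 a1 a2 a3 a4 f0' f1 e2 e3 e4 t; rewrite e x4f mulr0 addr0 => <-;
      rewrite -(scale0r 0) frmZl mul0r.
  have a00 : a0 = 0 by move: (F e2); rewrite x02' x12 frmxx x32; rewrite !mulr0 !addr0 mulr1.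
  have a10 : a1 = 0.
    by move: (F e3); rewrite a00 x13 x23 frmxx !mulr0 mul0r add0r !addr0 mulr1.
  have a20 : a2 = 0.
    move: (F f0'); rewrite a00 a10 (C _ _ _ _ x02') (C _ _ _ _ x03') oppr0 !mul0r mulr0 !add0r addr0 mulrN1.
    by move/eqP; rewrite oppr_eq0 => /eqP.
  have a30 : a3 = 0.
    move: (F f1); rewrite a00 a10 a20 (C _ _ _ _ x13) !mul0r !add0r mulrN1.
    by move/eqP; rewrite oppr_eq0 => /eqP.
  split=> //; move/eqP: e; rewrite a00 a10 a20 a30 !scale0r !add0r scaler_eq0 (negPf e40) orbF.
  by move/eqP.
exists (of_rows s); split=> //; try by rewrite !row_of_rows.
- apply: row10P => k k10; rewrite pullbackE // row10E //.
  by case10 k k10; rewrite /pair1 /pair2 /= !row_of_rows //= ?fx4.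
apply: row10P => k k10; rewrite pullbackE // row10E //.
by case10 k k10; rewrite /pair1 /pair2 /= !row_of_rows //= ?(fy2, fy3, fy4) ?frmxx.
Qed.

End Sections.

(* In the basis of pencil_normal_form, the third form restricts to zero on    *)
(* the common isotropic subspace of the pencil; a root of a cubic then gives  *)
(* a form of rank 2.                                                          *)
Lemma isotropic_net n (A : 'M[K]_(n, 10)) z : rank4_forms A ->
  annihilates A omega0 -> annihilates A omega1 -> annihilates A z ->
  free3 omega0 omega1 z -> z`_[7] = 0 -> z`_[8] = 0 -> z`_[9] = 0 -> False.
Proof.
move=> nd A0 A1 Az indep z7 z8 z9.
suff [s [t k0]] : exists s t, kap (s *: omega0 + t *: omega1 + z) = 0.
  have := nd _ (annihilatesD (annihilatesD (annihilatesZ s A0) (annihilatesZ t A1)) Az) k0.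
  by rewrite -[z in _ + z]scale1r => /indep[_ _ /eqP]; rewrite oner_eq0.
(* The form vanishes on the span of e2, e3, e4, so [kap] consists, up to sign, of the 2x2 minors of
   its 2x3 block; a relation (m, v) between the two rows kills them. *)
have kE (s t m v : K) : m * (z`_[1] + s) + v * z`_[4] = 0 ->
    m * (z`_[2] + t) + v * (z`_[5] + s) = 0 -> m * z`_[3] + v * (z`_[6] + t) = 0 ->
    (m != 0) || (v != 0) -> kap (s *: omega0 + t *: omega1 + z) = 0.
  move=> e1 e2 e3 mv.
  have minor a b c d : m * a + v * b = 0 -> m * c + v * d = 0 -> a * d - b * c = 0.
    move=> ab cd; case/orP: mv => [m0|v0].
      apply: (mulfI m0); rewrite mulr0 -[RHS](mul0r d) -ab.
      by have -> : m * (a * d - b * c) = (m * a + v * b) * d - b * (m * c + v * d);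
        [ring | rewrite cd mulr0 subr0].
    apply: (mulfI v0); rewrite mulr0 -[RHS](mulr0 a) -cd.
    have -> : v * (a * d - b * c) = a * (m * c + v * d) - c * (m * a + v * b) by ring.
    by rewrite ab mulr0 subr0.
  have m12 := minor _ _ _ _ e1 e2; have m13 := minor _ _ _ _ e1 e3; have m23 := minor _ _ _ _ e2 e3.
  apply: row5P => k k5; case5 k k5; mx_simp; rewrite ?z7 ?z8 ?z9; try by ring.
  - by apply: oppr_inj; rewrite oppr0; apply: (etrans _ m23); ring.
  - by apply: (etrans _ m13); ring.
  - by apply: oppr_inj; rewrite oppr0; apply: (etrans _ m12); ring.
have [z3|z3] := eqVneq z`_[3] 0.
  exists (- z`_[1]), (- z`_[2]); apply: (kE _ _ 1 0); rewrite ?oner_eq0 ?z3 //; ring.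
(* With v = 1, the last two equations determine t and s, and the first becomes this cubic in m. *)
have [m mE] := @solve_monicpoly K 3 (fun i => nth 0 [:: - z`_[4] / z`_[3];
  - (z`_[1] - z`_[5]) / z`_[3]; (z`_[2] - z`_[6]) / z`_[3]] i) isT.
rewrite !big_ord_recl big_ord0 /= /bump /= in mE.
pose t := - z`_[6] - m * z`_[3]; pose s := - z`_[5] - m * (z`_[2] + t).
exists s, t; apply: (kE _ _ m 1); rewrite ?oner_eq0 ?orbT // /s /t; try by ring.
have -> : m * (z`_[1] + (- z`_[5] - m * (z`_[2] + (- z`_[6] - m * z`_[3])))) + 1 * z`_[4] =
  z`_[3] * m ^+ 3 - m ^+ 2 * (z`_[2] - z`_[6]) + m * (z`_[1] - z`_[5]) + z`_[4] by ring.
rewrite mE; by field.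
Qed.

Lemma pullback_linear g : linear (pullback g).
Proof. by move=> a x y; rewrite /pullback mulmxDl scalemxAl. Qed.

HB.instance Definition _ g :=
  GRing.isLinear.Build K 'rV[K]_10 'rV[K]_10 _ (pullback g) (pullback_linear g).

(** Coordinate 7 of the pulled back z is - T at the chosen basis of the pencil. If T vanishes at (x,
    y), (y, x) and (x, x + y), then z is zero on the span of [kap x], [kap2 x y], [kap y], as 2 is
    invertible; [isotropic_net] excludes this. *)
Lemma net_normal_form n (A : 'M[K]_(n, 10)) x y z : rank4_forms A -> (2 : K) != 0 ->
  annihilates A x -> annihilates A y -> annihilates A z -> free3 x y z ->
  exists g a b c d, [/\ g \in unitmx, pullback g (a *: x + b *: y) = omega0,
    pullback g (c *: x + d *: y) = omega1 & (pullback g z)`_[7] != 0].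
Proof.
move=> nd n2 Ax Ay Az indep.
pose T a b := frm z (kap b) (kap2 a b).
have main a b c d : a * d - b * c != 0 -> T (a *: x + b *: y) (c *: x + d *: y) != 0 ->
    exists g a b c d, [/\ g \in unitmx, pullback g (a *: x + b *: y) = omega0,
      pullback g (c *: x + d *: y) = omega1 & (pullback g z)`_[7] != 0].
  move=> D; set x' := _ + b *: y; set y' := _ + d *: y => T0.
  have Ax' : annihilates A x' by apply: annihilatesD; apply: annihilatesZ.
  have Ay' : annihilates A y' by apply: annihilatesD; apply: annihilatesZ.
  have xy' : free2 x' y'.
    move=> s t e; have [|sa sb _] := indep (s * a + t * c) (s * b + t * d) 0.
      rewrite -[RHS]e /x' /y' scale0r addr0 !scalerDr !scalerA !scalerDl.
      by rewrite addrACA.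
    split; apply: (mulIf D); rewrite mul0r.
      have -> : s * (a * d - b * c) = d * (s * a + t * c) - c * (s * b + t * d) by ring.
      by rewrite sa sb !mulr0 subr0.
    have -> : t * (a * d - b * c) = a * (s * b + t * d) - b * (s * a + t * c) by ring.
    by rewrite sa sb !mulr0 subr0.
  have [g [gu gx gy g2 [g3 g4]]] := pencil_normal_form nd Ax' Ay' xy'.
  exists g, a, b, c, d; split=> //.
  by rewrite pullbackE // /pair1 /pair2 /= g2 g3 -scaleN1r frmZr mulN1r oppr_eq0.
have [Txy|] := eqVneq (T x y) 0; last first.
  by move=> T0; apply: (main 1 0 0 1); rewrite ?(scale1r, scale0r, addr0, add0r) //;
    rewrite mulr1 mul0r subr0 oner_neq0.
have [Tyx|] := eqVneq (T y x) 0; last first.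
  by move=> T0; apply: (main 0 1 1 0); rewrite ?(scale1r, scale0r, addr0, add0r) //;
    rewrite mul0r mulr1 sub0r oppr_eq0 oner_neq0.
have [Txxy|] := eqVneq (T x (x + y)) 0; last first.
  by move=> T0; apply: (main 1 0 1 1); rewrite ?(scale1r, scale0r, addr0, add0r) //;
    rewrite mulr1 mul0r subr0 oner_neq0.
exfalso; have xy : free2 x y.
  move=> s t e; have [|-> -> _] := indep s t 0; last by [].
  by rewrite scale0r addr0.
have [g [gu gx gy g2 [g3 g4]]] := pencil_normal_form nd Ax Ay xy.
have nd' : rank4_forms (A *m wedge2 (invmx g)) by apply: rank4_forms_mul; rewrite ?unitmx_inv.
apply: (isotropic_net nd' (z := pullback g z)); rewrite -?gx -?gy ?pullbackE // /pair1 /pair2 /= ?g2 ?g3 ?g4;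
  try exact: pullback_annihilates.
- move=> r s t; rewrite -!linearZ -!linearD /= => e; apply: indep.
  by rewrite -(pullbackK gu (_ + _)) e linear0.
- by rewrite -scaleN1r frmZr -/(T x y) Txy mulr0.
- have E (a b c : 'rV[K]_5) : frm z (a + b + c) (a *+ 2 + c) =
      2 * frm z b a + frm z b c - frm z a c.
    rewrite mulr2n !frmDl !frmDr !frmxx (frmC z c a); ring.
  move: Txxy; rewrite /T kapD (kap2C x (x + y)) kap2D (kap2C y x) kap2xx E.
  rewrite -/(T x y) Txy kap2C -/(T y x) Tyx subr0 addr0 => /eqP.
  by rewrite mulf_eq0 (negPf n2) => /eqP.
by rewrite -scaleN1r frmZl frmC kap2C -/(T y x) Tyx oppr0 mulr0.
Qed.

End NormalForms.

(** * Spanning by kernels, tangent spaces and smoothness *)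

Section Smoothness.

Variable K : closedFieldType.
Implicit Types (u v w : 'rV[K]_5) (x y z p : 'rV[K]_10) (g h : 'M[K]_5).

Notation omega0 := (omega0 K).
Notation omega1 := (omega1 K).

(** The pencil forces v_2 = v_3 = v_4 = 0. If v_1 != 0, the remaining relations on z make two
    independent forms of the net share a kernel vector, against [common_kernel]. *)
Lemma net_kap_span n (A : 'M[K]_(n, 10)) z v : rank4_forms A ->
  annihilates A omega0 -> annihilates A omega1 -> annihilates A z -> z`_[7] = 1 ->
  dot5 v (kap omega0) = 0 -> dot5 v (kap omega1) = 0 -> dot5 v (kap z) = 0 ->
  dot5 v (kap (omega0 + omega1)) = 0 -> dot5 v (kap (omega0 + z)) = 0 ->
  dot5 v (kap (omega1 + z)) = 0 -> v = 0.
Proof.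
move=> nd A0 A1 Az z7 k0 k1 kz k01 k0z k1z.
have H2 x y : dot5 v (kap x) = 0 -> dot5 v (kap y) = 0 -> dot5 v (kap (x + y)) = 0 ->
    dot5 v (kap2 x y) = 0.
  rewrite kapD; have dotD a b : dot5 v (a + b) = dot5 v a + dot5 v b by rewrite /dot5 !mxE; ring.
  by rewrite !dotD => -> ->; rewrite !add0r.
have v4 : v`_[4] = 0.
  apply/eqP; rewrite -oppr_eq0; apply/eqP; apply: (etrans _ k0).
  by rewrite /dot5; mx_simp; ring.
have v2 : v`_[2] = 0.
  apply/eqP; rewrite -oppr_eq0; apply/eqP; apply: (etrans _ k1).
  by rewrite /dot5; mx_simp; ring.
have v3 : v`_[3] = 0.
  by apply: (etrans _ (H2 _ _ k0 k1 k01)); rewrite /dot5; mx_simp; ring.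
have e0 : v`_[0] * z`_[8] + v`_[1] * z`_[9] = 0.
  apply/eqP; rewrite -oppr_eq0; apply/eqP; apply: (etrans _ (H2 _ _ k0 kz k0z)).
  by rewrite /dot5; mx_simp; rewrite v2 v3 v4; ring.
have e1 : v`_[0] = - (v`_[1] * z`_[8]).
  apply/eqP; rewrite -addr_eq0; apply/eqP; apply: (etrans _ (H2 _ _ k1 kz k1z)).
  by rewrite /dot5; mx_simp; rewrite v2 v3 v4 z7; ring.
suff v1 : v`_[1] = 0.
  by apply: row5P => k k5; case5 k k5; rewrite !mxE // e1 v1 mul0r oppr0.
apply/eqP/negPn/negP => v1.
have z9 : z`_[9] = z`_[8] ^+ 2.
  apply: (mulfI v1); apply/eqP; rewrite -subr_eq0; apply/eqP; apply: (etrans _ e0).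
  by rewrite e1; ring.
pose r := z`_[8].
(* This is - [kap (omega0 + r *: omega1)]. *)
pose u : 'rV[K]_5 := row5 [:: 0; 0; r ^+ 2; - r; 1].
pose X1 := z`_[4] * r ^+ 2 - z`_[5] * r + z`_[6].
have u0 : u != 0.
  apply/eqP => /rowP/(_ (inord 4))/eqP; rewrite row5E // mxE oner_eq0 //.
have X0 : z`_[1] * r ^+ 2 - z`_[2] * r + z`_[3] + r * X1 = 0.
  apply: (mulfI v1); apply/eqP; rewrite mulr0 -oppr_eq0; apply/eqP.
  apply: (etrans _ kz).
  by rewrite /dot5; mx_simp; rewrite v2 v3 v4 z7 z9 e1 /X1 /r; ring.
pose a := omega0 + r *: omega1; pose b := z - X1 *: omega1.
have Aa : annihilates A a by apply: annihilatesD => //; apply: annihilatesZ.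
have Ab : annihilates A b.
  by rewrite /b -scaleNr; apply: annihilatesD => //; apply: annihilatesZ.
have au : ctr a u = 0 by apply: row5P => k k5; case5 k k5; mx_simp; ring.
have bu : ctr b u = 0.
  apply: row5P => k k5; case5 k k5; mx_simp; rewrite ?z7 ?z9 -/r; try by ring.
    by apply: oppr_inj; rewrite oppr0; apply: (etrans _ X0); ring.
  by rewrite /X1; ring.
have [s [t [st0 e]]] := common_kernel nd u0 Aa Ab au bu.
have t0 : t = 0.
  by move/rowP/(_ (inord 7)): e; mx_simp; rewrite z7 => <-; ring.
have s0 : s = 0.
  by move/rowP/(_ (inord 1)): e; mx_simp; rewrite t0 => <-; ring.
by rewrite s0 t0 eqxx in st0.
Qed.

Lemma poly_eval_dense (p q : {poly K}) : q != 0 ->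
  (forall t, q.[t] != 0 -> p.[t] = 0) -> p = 0.
Proof.
move=> q0 H; have : p * q = 0.
  apply/eqP/negPn/negP => /closed_nonrootP[t]; rewrite /root hornerM.
  by have [->|/H->] := eqVneq q.[t] 0; rewrite ?mulr0 ?mul0r eqxx.
by move/eqP; rewrite mulf_eq0 (negPf q0) orbF => /eqP.
Qed.

Section Curve.

Variables (n : nat) (x w r : 'I_n -> K).

Definition along_curve (f : {mpoly K[n]}) : {poly K} :=
  mmap polyC (fun i => (x i)%:P + w i *: 'X + r i *: 'X^2) f.

Lemma along_curve_eval f t :
  (along_curve f).[t] = f.@[fun i => x i + w i * t + r i * t ^+ 2].
Proof.
move: f; apply: mpoly_ring_ind => [c|i|f g|f g]; rewrite /along_curve.
- by rewrite mmapC mevalC hornerC.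
- by rewrite mmapX mmap1U mevalXU !hornerE.
- by rewrite mmapD mevalD hornerD => -> ->.
by rewrite rmorphM /= mevalM hornerM => -> ->.
Qed.

Lemma mderivU (i j : 'I_n) : ('X_j : {mpoly K[n]})^`M(i) = (j == i)%:R.
Proof.
rewrite mderivX mnm1E; case: eqP => [->|_]; last by rewrite scale0r.
have -> : (U_(i) - U_(i) = 0)%MM by apply/mnmP => l; rewrite mnmBE subnn mnm0E.
by rewrite mpolyX0 scale1r.
Qed.

Lemma along_curve_coef f : (along_curve f)`_0 = f.@[x] /\
  (along_curve f)`_1 = \sum_i (f^`M(i)).@[x] * w i.
Proof.
move: f; apply: mpoly_ring_ind => [c|i|f g [f0 f1] [g0 g1]|f g [f0 f1] [g0 g1]];
  rewrite /along_curve.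
- rewrite mmapC mevalC !coefC; split=> //=.
  by rewrite big1 // => i _; rewrite mderivC meval0 mul0r.
- rewrite mmapX mmap1U mevalXU !coefD !coefZ !coefC !coefX !coefXn /= !mulr0 !addr0 add0r mulr1.
  split=> //; rewrite (bigD1 i) //= big1 ?addr0 => [|j ji].
    by rewrite mderivU eqxx meval1 mul1r.
  by rewrite mderivU eq_sym (negPf ji) meval0 mul0r.
- rewrite mmapD mevalD !coefD -/(along_curve f) -/(along_curve g) f0 f1 g0 g1; split=> //.
  by rewrite -big_split /=; apply: eq_bigr => i _; rewrite mderivD mevalD mulrDl.
rewrite rmorphM /= -/(along_curve f) -/(along_curve g) mevalM !coefM.
rewrite !big_ord_recl !big_ord0 /= /bump /= f0 f1 g0 g1 !addr0; split=> //.
rewrite mulr_sumr mulr_suml addrC -big_split /=; apply: eq_bigr => i _.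
by rewrite mderivM mevalD !mevalM; ring.
Qed.

End Curve.

Lemma linear_forms_eval n (A : 'M[K]_(n, 10)) a (y : 'rV[K]_n) :
  (tnth (linear_forms A) a).@[y ord0] = (y *m A) 0 a.
Proof.
rewrite tnth_mktuple raddf_sum /= mxE; apply: eq_bigr => i _.
by rewrite mevalZ mevalXU mulrC.
Qed.

Lemma meval_linear_forms n (A : 'M[K]_(n, 10)) (f : {mpoly K[10]}) (y : 'rV[K]_n) :
  (f \mPo linear_forms A).@[y ord0] = f.@[(y *m A) ord0].
Proof. by rewrite comp_mpoly_meval; apply: meval_eq => a; rewrite linear_forms_eval. Qed.

Lemma grassmannian_wedge u v : wedge u v != 0 -> grassmannian (wedge u v).
Proof. by move=> uv; exists (col_mx u v) => //; apply: wedge_row_free. Qed.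

Lemma ctr_wedge a b u : ctr (wedge a b) u = dot5 u a *: b - dot5 u b *: a.
Proof. by apply: row5P => k k5; case5 k k5; rewrite /dot5; mx_simp; ring. Qed.

(** The curve (a - t d) /\ (b + t c) has velocity a /\ c + b /\ d at t = 0, and g vanishes along it;
    its t^2 term r does not affect the derivative. *)
Lemma grassmannian_tangent n (A : 'M[K]_(n, 10)) (y w : 'rV[K]_n) a b c d :
  wedge a b != 0 -> y *m A = wedge a b -> w *m A = wedge a c + wedge b d ->
  cone_tangent (linear_section_ideal A) y w.
Proof.
move=> ab yA wA f [g gG ->].
pose r := wedge (- d) c.
pose F := along_curve (wedge a b ord0) ((w *m A) ord0) (r ord0) g.
have F0 : F = 0.
  have /rV0Pn[i abi] := ab.
  (* A coordinate of the curve that is nonzero at t = 0: where q is nonzero, the bivector is a point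
     of the Grassmannian. *)
  pose q : {poly K} := (wedge a b 0 i)%:P + (w *m A) 0 i *: 'X + r 0 i *: 'X^2.
  have curve t : wedge (a - t *: d) (b + t *: c) = wedge a b + t *: (w *m A) + t ^+ 2 *: r.
    by rewrite wA /r; apply: row10P => k k10; case10 k k10; mx_simp; ring.
  have curveE t j : wedge a b 0 j + (w *m A) 0 j * t + r 0 j * t ^+ 2 =
      (wedge (a - t *: d) (b + t *: c)) 0 j.
    by rewrite curve !mxE !(mulrC t) !(mulrC (t ^+ 2)).
  apply: (@poly_eval_dense _ q) => [|t qt].
    apply: contraNneq abi => q0; have := congr1 (fun p : {poly K} => p.[0]) q0.
    by rewrite /q !hornerE => /eqP; rewrite ?expr0n /= ?mulr0 ?addr0.
  rewrite /F along_curve_eval (meval_eq _ (curveE t)); apply: gG.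
  apply: grassmannian_wedge; apply: contraNneq qt => e0.
  have -> : q.[t] = wedge a b 0 i + (w *m A) 0 i * t + r 0 i * t ^+ 2.
    by rewrite /q !hornerE; ring.
  by rewrite curveE e0 mxE.
have [_ <-] := along_curve_coef (y ord0) (w ord0) (fun=> 0) (g \mPo linear_forms A).
have -> : along_curve (y ord0) (w ord0) (fun=> 0) (g \mPo linear_forms A) =
    along_curve (wedge a b ord0) ((w *m A) ord0) (fun=> 0) g.
  apply/eqP; rewrite -subr_eq0; apply/eqP; apply: (@poly_eval_dense _ 1) => [|t _].
    exact: oner_neq0.
  rewrite hornerD hornerN !along_curve_eval; apply/eqP; rewrite subr_eq0; apply/eqP.
  have -> : (g \mPo linear_forms A).@[fun i => y ord0 i + w ord0 i * t + 0 * t ^+ 2] =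
      (g \mPo linear_forms A).@[(y + t *: w) ord0].
    by apply: meval_eq => i; rewrite !mxE mul0r addr0 mulrC.
  rewrite meval_linear_forms; apply: meval_eq => i.
  rewrite mulmxDl -scalemxAl yA; generalize (wedge a b) (w *m A) => p q.
  by rewrite !mxE mul0r addr0 [q _ _ * _]mulrC.
have [_ ->] := along_curve_coef (wedge a b ord0) ((w *m A) ord0) (fun=> 0) g.
have [_ <-] := along_curve_coef (wedge a b ord0) ((w *m A) ord0) (r ord0) g.
by rewrite -/F F0 coef0.
Qed.

Lemma wedge_self u : wedge u u = 0.
Proof. by apply: row10P => k k10; case10 k k10; mx_simp; ring. Qed.

(** Both a /\ V and b /\ V have dimension 4, and they meet in the line of a /\ b. *)
Lemma rank_tangent (a b : 'rV[K]_5) : wedge a b != 0 -> (7 <= \rank (wedge_mx a + wedge_mx b)%MS)%N.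
Proof.
move=> ab.
have a0 : a != 0.
  by apply: contraNneq ab => ->; apply/eqP; apply: row10P => k k10; case10 k k10; mx_simp; ring.
have b0 : b != 0 by apply: contraNneq ab => ->; rewrite linear0.
have [f0 [f1 [af0 bf0 _ _]]] : exists f0 f1, [/\ dot5 a f0 = 1, dot5 b f0 = 0, dot5 a f1 = 0 & dot5 b f1 = 1].
  apply: dual_vectors => s t e.
  have := wedge_row_free ab; rewrite -kermx_eq0 => /eqP k0.
  have : (row_mx s%:M t%:M <= kermx (col_mx a b))%MS.
    by apply/sub_kermxP; rewrite mul_row_col !mul_scalar_mx.
  rewrite k0 submx0 => /eqP st; split.
    by have := congr1 (fun M => lsubmx M 0 0) st; rewrite row_mxKl !mxE eqxx mulr1n.
  by have := congr1 (fun M => rsubmx M 0 0) st; rewrite row_mxKr !mxE eqxx mulr1n.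
have cap1 : (\rank (wedge_mx a :&: wedge_mx b)%MS <= 1)%N.
  rewrite (@leq_trans (\rank (wedge a b))) ?rank_leq_row // mxrankS //.
  apply/rV_subP => q; rewrite sub_capmx => /andP[/submxP[c ->] /submxP[d]].
  rewrite !mul_wedge_mx => e.
  have dC u v : dot5 u v = dot5 v u by rewrite /dot5; ring.
  have : ctr (wedge a c) f0 = ctr (wedge b d) f0 by rewrite e.
  rewrite !ctr_wedge !(dC f0) af0 bf0 scale1r scale0r sub0r => /eqP.
  rewrite subr_eq -scaleNr => /eqP->; rewrite linearD !linearZ /= wedge_self scaler0 addr0.
  exact: scalemx_sub.
have := mxrank_sum_cap (wedge_mx a) (wedge_mx b); rewrite !rank_wedge_mx //.
by move=> e; rewrite -(leq_add2r (\rank (wedge_mx a :&: wedge_mx b)%MS)) e (leq_add2l 7 _ 1).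
Qed.

Lemma independent_rows m n (Z : 'M[K]_(m, n)) : row_free Z -> (3 <= m)%N ->
  exists i0 i1 i2, forall a b c : K,
    a *: row i0 Z + b *: row i1 Z + c *: row i2 Z = 0 -> [/\ a = 0, b = 0 & c = 0].
Proof.
case: m Z => [|[|[|m]]] // Z Zfree _; exists (inord 0), (inord 1), (inord 2) => a b c e.
have : a *: delta_mx 0 (inord 0) + b *: delta_mx 0 (inord 1) + c *: delta_mx 0 (inord 2)
    = 0 :> 'rV[K]_m.+3.
  by apply: (row_free_inj Zfree); rewrite mul0mx !mulmxDl -!scalemxAl -!rowE.
move=> /rowP y; split.
- by have := y (inord 0); rewrite !mxE -!val_eqE /= !inordK //= !(mulr1, mulr0, addr0, add0r).
- by have := y (inord 1); rewrite !mxE -!val_eqE /= !inordK //= !(mulr1, mulr0, addr0, add0r).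
by have := y (inord 2); rewrite !mxE -!val_eqE /= !inordK //= !(mulr1, mulr0, addr0, add0r).
Qed.

Lemma wedge_comb3 (z0 z1 z2 : 'rV[K]_5) (c0 c1 c2 : K) : exists a0 a1 a2 b0 b1 b2 : K,
  c0 *: wedge z0 z1 + c1 *: wedge z0 z2 + c2 *: wedge z1 z2 =
  wedge (a0 *: z0 + a1 *: z1 + a2 *: z2) (b0 *: z0 + b1 *: z1 + b2 *: z2).
Proof.
have [c00|c00] := eqVneq c0 0.
  exists c1, c2, 0, 0, 0, 1; rewrite c00.
  by apply: row10P => k k10; case10 k k10; mx_simp; ring.
exists 1, 0, (- c2 / c0), 0, c0, c1.
by apply: row10P => k k10; case10 k k10; mx_simp; field.
Qed.

(* If x has rank 2, then the tangent space to the cone over the Grassmannian  *)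
(* at a /\ b lies in the hyperplane x = 0 for all a, b in the kernel of x, so *)
(* that the section is too large an intersection of tangent spaces at the     *)
(* points a /\ b that it contains.                                            *)
Lemma smooth_rank4_forms (k : nat) (A : 'M[K]_(k + 4, 10)) : (3 <= k)%N -> row_free A ->
  proj_dim (linear_section A) k -> smooth_scheme (linear_section_ideal A) ->
  rank4_forms A.
Proof.
move=> k3 /eqP A_rank X_dim X_smooth x Ax kx; apply/eqP/negPn/negP => x0.
have [u [v uv]] := form_neq0 x0.
have xE : x = wedge (ctr x u) (ctr x v).
  rewrite wedge_ctr uv scale1r kx; apply/rowP => j; rewrite [RHS]mxE [X in _ + X]mxE.
  have -> : hodge 0 (wedge u v) = 0 by apply: row10P => l l10; case10 l l10; mx_simp; ring.
  by rewrite mxE oppr0 addr0.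
pose S : 'M[K]_5 := lin1_mx (ctr x).
have SE c : c *m S = ctr x c by exact: mul_rV_lin1.
have S2 : (\rank S <= 2)%N.
  apply: (@leq_trans (\rank (col_mx (ctr x u) (ctr x v)))); last exact: rank_leq_row.
  apply: mxrankS; apply/row_subP => i; rewrite rowE SE [in ctr x _]xE ctr_wedge.
  by rewrite -scaleNr addmx_sub // scalemx_sub // -addsmxE ?addsmxSl ?addsmxSr.
pose Z := row_base (kermx S).
have Z3 : (3 <= \rank (kermx S))%N by rewrite mxrank_ker; move: S2; case: (\rank S) => [|[|[|]]].
have [i0 [i1 [i2 Zindep]]] := independent_rows (row_base_free (kermx S)) Z3.
have xZ i : ctr x (row i Z) = 0.
  rewrite -SE; apply/sub_kermxP; rewrite -(eq_row_base (kermx S)); exact: row_sub.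
move: (row i0 Z) (row i1 Z) (row i2 Z) (xZ i0) (xZ i1) (xZ i2) Zindep.
move=> z0 z1 z2 xz0 xz1 xz2 Zindep {i0 i1 i2 xZ Z Z3 S2 SE S}.
have ux s w : ctr x s = 0 -> frm x s w = 0 by move=> xs; rewrite /frm xs /dot5 !mxE; ring.
have gu : of_rows [:: u; v; z0; z1; z2] \in unitmx.
  apply: of_rows_unit => a0 a1 a2 a3 a4 /= e.
  have F t : a0 * frm x u t + a1 * frm x v t = 0.
    have := frm_lin x a0 a1 a2 a3 a4 u v z0 z1 z2 t.
    rewrite e !(ux z0) // !(ux z1) // !(ux z2) // !mulr0 !addr0 => <-.
    by rewrite -(scale0r 0) frmZl mul0r.
  have a00 : a0 = 0 by move: (F v); rewrite uv frmxx mulr0 addr0 mulr1.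
  have a10 : a1 = 0.
    move: (F u); rewrite a00 (frmC x v u) uv mul0r add0r mulrN1.
    by move/eqP; rewrite oppr_eq0 => /eqP.
  by move: e; rewrite a00 a10 !scale0r !add0r => /Zindep[-> -> ->].
pose E : 'M[K]_(3, 10) := \matrix_(i, j) (j == inord (7 + i))%:R.
pose D := E *m wedge2 (of_rows [:: u; v; z0; z1; z2]).
have rowD i : row i D = row (inord (7 + i)) (wedge2 (of_rows [:: u; v; z0; z1; z2])).
  by rewrite row_mul [RHS]rowE; congr (_ *m _); apply/rowP => j; rewrite !mxE.
have cD (c : 'rV[K]_3) : c *m D = c 0 (inord 0) *: wedge z0 z1 + c 0 (inord 1) *: wedge z0 z2
    + c 0 (inord 2) *: wedge z1 z2.
  rewrite mulmx_sum_row 3!big_ord_recl big_ord0 addr0 addrA !rowD !row_wedge2 //.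
  rewrite /pair1 /pair2 /= !row_of_rows //.
  by congr (_ + _ + _); congr (c 0 _ *: _); apply: val_inj; rewrite /= inordK.
have D3 : \rank D = 3%N.
  rewrite mxrankMfree ?row_free_unit ?wedge2_unit //; apply/eqP.
  rewrite -/(row_free E) -kermx_eq0; apply/rowV0P => y /sub_kermxP/rowP yE.
  apply/rowP => i; have := yE (inord (7 + i)); rewrite !mxE (bigD1 i) //= big1 => [|j ji].
    by rewrite mxE eqxx mulr1 addr0.
  rewrite mxE -val_eqE /= !inordK ?eqn_add2l; last 2 first.
  - by rewrite -ltn_subRL.
  - by rewrite -ltn_subRL.
  by rewrite eq_sym (negPf (ji : val j != val i)) mulr0.

have perp_rank : \rank (kermx x^T) = 9%N by rewrite mxrank_ker mxrank_tr rank_rV x0.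
have wperp s w : ctr x s = 0 -> wedge s w *m x^T = 0.
  move=> xs; rewrite [LHS]mx11_scalar.
  have -> : (wedge s w *m x^T) 0 0 = (x *m (wedge s w)^T) 0 0.
    by rewrite -[x in RHS]trmxK -trmx_mul [RHS]mxE.
  by rewrite frm_wedge ux // raddf0.
have rank_le9 m (M : 'M_(m, 10)) : (M <= kermx x^T)%MS -> (\rank M <= 9)%N.
  by move=> /mxrankS; rewrite perp_rank.
have Aperp : (A <= kermx x^T)%MS by apply/sub_kermxP.
have Dperp : (D <= kermx x^T)%MS.
  apply/sub_kermxP/row_matrixP => i; rewrite row_mul [row i D]rowE cD !mulmxDl -!scalemxAl.
  by rewrite !wperp // !scaler0 !addr0 row0.
(* A and D, of dimensions k + 4 >= 7 and 3, lie in the hyperplane x = 0 of dimension 9. *)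
have : (A :&: D)%MS != 0.
  rewrite -mxrank_eq0 -lt0n; have := mxrank_sum_cap A D; rewrite A_rank D3 => e.
  have : (\rank (A + D)%MS <= 9)%N by apply: rank_le9; rewrite addsmx_sub Aperp.
  rewrite -(leq_add2r (\rank (A :&: D)%MS)) e; case: (\rank (A :&: D)%MS) => // le9.
  by move: le9; rewrite addn0 -addnA leqNgt; case/negP; rewrite (@leq_add 3 7).
case/rowV0Pn => p; rewrite sub_capmx => /andP[/submxP[y pA] /submxP[c pD]] p0.
have [a [b [xa xb pE]]] : exists a b, [/\ ctr x a = 0, ctr x b = 0 & p = wedge a b].
  rewrite pD cD; have [a0 [a1 [a2 [b0 [b1 [b2 ->]]]]]] :=
    wedge_comb3 z0 z1 z2 (c 0 (inord 0)) (c 0 (inord 1)) (c 0 (inord 2)).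
  exists (a0 *: z0 + a1 *: z1 + a2 *: z2), (b0 *: z0 + b1 *: z1 + b2 *: z2).
  by split; rewrite // !linearD !linearZ /= xz0 xz1 xz2 !scaler0 !addr0.
have ab : wedge a b != 0 by rewrite -pE.
have yX : zeros (linear_section_ideal A) y.
  split; first by apply: contraNneq p0 => y0; rewrite pA y0 mul0mx.
  move=> _ [f fG ->]; rewrite meval_linear_forms -pA pE; apply: fG.
  exact: grassmannian_wedge.
have [d [[C [Cchain _]] _] [B Bfree BE]] := X_smooth y yX.
have dk : (d <= k)%N := proj2 X_dim d C Cchain.
pose T := (wedge_mx a + wedge_mx b)%MS.
have T7 : (7 <= \rank T)%N by exact: rank_tangent.
have Tperp : (T <= kermx x^T)%MS.
  by rewrite addsmx_sub; apply/andP; split; apply/sub_kermxP/row_matrixP => i;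
    rewrite row_mul rowE mul_wedge_mx wperp // row0.
pose Y := (T :&: A)%MS *m pinvmx A.
have YA : Y *m A = (T :&: A)%MS by rewrite mulmxKpV // capmxSr.
have YB : (Y <= B)%MS.
  apply/row_subP => i; apply/BE.
  have : (row i Y *m A <= T)%MS by rewrite -row_mul YA (submx_trans (row_sub _ _)) // capmxSl.
  case/sub_addsmxP => -[c1 c2] /=; rewrite !mul_wedge_mx => e.
  by apply: grassmannian_tangent ab _ e; rewrite -pA.
(* Again inside the hyperplane, T and A meet in dimension at least 7 + (k + 4) - 9, while the
   tangent space of the cone has dimension d + 1 <= k + 1. *)
have rY : (k + 2 <= \rank Y)%N.
  apply: (@leq_trans (\rank (T :&: A)%MS)); last by rewrite -YA mxrankM_maxl.
  have := mxrank_sum_cap T A; rewrite A_rank => e.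
  have : (\rank (T + A)%MS <= 9)%N by apply: rank_le9; rewrite addsmx_sub Tperp.
  rewrite -(leq_add2r (\rank (T :&: A)%MS)) e => le9.
  rewrite -(leq_add2l 9); apply: leq_trans le9.
  have -> : (9 + (k + 2) = 7 + (k + 4))%N by rewrite addnCA (addnCA 7).
  by rewrite leq_add2r.
have := leq_trans rY (leq_trans (mxrankS YB) (rank_leq_row B)).
by rewrite addn2 => /leq_trans/(_ (dk : d.+1 <= k.+1)%N); rewrite ltnn.
Qed.

End Smoothness.

(** * The symmetric matrix of a quadratic form *)

Section QuadricMatrix.

Variables (K : closedFieldType) (n : nat).

Lemma mnm_pair_eq (a b i j : 'I_n) :
  ((U_(a) + U_(b))%MM == (U_(i) + U_(j))%MM) =
  ((a == i) && (b == j)) || ((a == j) && (b == i)).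
Proof.
apply/eqP/idP => [e|/orP[/andP[/eqP-> /eqP->]|/andP[/eqP-> /eqP->]] //]; last first.
  by rewrite addmC.
have E l : ((a == l) + (b == l) = (i == l) + (j == l))%N.
  by move/mnmP/(_ l): e; rewrite !mnmDE !mnm1E.
have H1 : (a == i) && (b == i) ==> (a == b) by apply/implyP => /andP[/eqP-> /eqP->].
have H2 : (a == j) && (b == j) ==> (a == b) by apply/implyP => /andP[/eqP-> /eqP->].
move: (E a) (E b) H1 H2; rewrite !eqxx (eq_sym b a) !(eq_sym i) !(eq_sym j).
by case: (a == i); case: (a == j); case: (b == i); case: (b == j); case: (a == b).
Qed.

Lemma quad_mxE (q : {mpoly K[n]}) (M : 'M[K]_n) : (2 : K) != 0 -> M^T = M ->
  (forall y : 'rV_n, q.@[y ord0] = (y *m M *m y^T) 0 0) -> quad_mx q = M.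
Proof.
move=> n2 Msym qE.
have -> : q = \sum_a \sum_b M a b *: 'X_[U_(a) + U_(b)].
  apply/eqP; rewrite -subr_eq0; apply/eqP/mpoly_eval0 => y.
  have -> : (q - \sum_a \sum_b M a b *: 'X_[U_(a) + U_(b)]).@[y] =
      (q - \sum_a \sum_b M a b *: 'X_[U_(a) + U_(b)]).@[(\row_i y i) ord0].
    by apply: meval_eq => i; rewrite mxE.
  move: (\row_i y i) => {}y; rewrite mevalB qE; apply/eqP; rewrite subr_eq0; apply/eqP.
  rewrite mxE raddf_sum /=.
  under eq_bigr => b _ do rewrite !mxE mulr_suml.
  rewrite exchange_big /=; apply: eq_bigr => a _; rewrite raddf_sum /=; apply: eq_bigr => b _.
  by rewrite mevalZ mpolyXD mevalM !mevalXU; ring.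
apply/matrixP => i j; rewrite mxE.
have C (m : 'X_{1..n}) : (\sum_a \sum_b M a b *: 'X_[U_(a) + U_(b)])@_m =
    \sum_a \sum_b M a b * ((U_(a) + U_(b))%MM == m)%:R.
  rewrite raddf_sum /=; apply: eq_bigr => a _; rewrite raddf_sum /=; apply: eq_bigr => b _.
  by rewrite mcoeffZ mcoeffX.
have D c d : \sum_a \sum_b M a b * ((a == c) && (b == d))%:R = M c d.
  rewrite (bigD1 c) //= [X in _ + X]big1 ?addr0 => [|a /negPf->]; last first.
    by rewrite big1 // => b _; rewrite mulr0.
  rewrite (bigD1 d) //= big1 ?addr0 => [|b /negPf->]; last by rewrite andbF mulr0.
  by rewrite !eqxx mulr1.
rewrite !C; case: eqVneq => [<-|ij].
  by rewrite -[RHS]D; apply: eq_bigr => a _; apply: eq_bigr => b _; rewrite mnm_pair_eq orbb.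
have -> : \sum_a \sum_b M a b * ((U_(a) + U_(b))%MM == (U_(i) + U_(j))%MM)%:R = M i j + M j i.
  rewrite -(D i j) -(D j i) -big_split; apply: eq_bigr => a _; rewrite -big_split.
  apply: eq_bigr => b _; rewrite mnm_pair_eq /= -mulrDr; congr (_ * _).
  case: (eqVneq a i) => [->|_] /=; last by rewrite add0r.
  by rewrite (negPf ij) orbF addr0.
have -> : M j i = M i j by rewrite -[in LHS]Msym mxE.
by field.
Qed.

End QuadricMatrix.

(** * From the vectors v to generators of the ideal *)

Section Assembly.

Variable K : closedFieldType.
Hypothesis n2 : (2 : K) != 0.
Implicit Types (u v w : 'rV[K]_5) (x y z p : 'rV[K]_10).

Notation omega0 := (omega0 K).
Notation omega1 := (omega1 K).
Notation X k := ('X_(inord k) : {mpoly K[10]}).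
Notation pluckers := (plk (fun k => X k)).

Definition quadric v : {mpoly K[10]} :=
  \sum_(j < 5) ((-1) ^+ j * v 0 j) *: nth 0 pluckers j.

Lemma quadric_eval v p : (quadric v).@[p ord0] = dot5 v (kap p).
Proof.
rewrite /quadric sum_ord5 !mevalD !mevalZ !inordK //= !eval_simp.
by rewrite /dot5; mx_simp; ring.
Qed.

Lemma quadric_linear : linear quadric.
Proof.
move=> a u v; rewrite /quadric scaler_sumr -big_split /=; apply: eq_bigr => j _.
by rewrite !mxE scalerA -scalerDl; congr (_ *: _); ring.
Qed.

HB.instance Definition _ :=
  GRing.isLinear.Build K 'rV[K]_5 {mpoly K[10]} _ quadric quadric_linear.

Lemma quadric_homog v : quadric v \is 2.-homog.
Proof.
apply: rpred_sum => j _; apply: rpredZ; apply: plk_homog.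
exact: mem_nth.
Qed.

Lemma quadric_unit_row j : (j < 5)%N -> nth 0 pluckers j = quadric ((-1) ^+ j *: unit_row K j).
Proof.
move=> j5; apply/eqP; rewrite -subr_eq0; apply/eqP/mpoly_eval0 => y.
have E (f : {mpoly K[10]}) : f.@[y] = f.@[(\row_i y i) ord0] by apply: meval_eq => i; rewrite mxE.
rewrite E mevalB quadric_eval; move: (\row_i y i) => p.
by case5 j j5; rewrite /dot5 /unit_row; mx_simp; rewrite -!val_eqE /= !inordK //= !eval_simp; ring.
Qed.

Section LinearSection.

Variables (n : nat) (A : 'M[K]_(n, 10)).

Definition section_quadric v : {mpoly K[n]} := quadric v \mPo linear_forms A.

Lemma section_quadric_linear : linear section_quadric.
Proof. by move=> a u v; rewrite /section_quadric linearP /= comp_mpolyD comp_mpolyZ. Qed.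

HB.instance Definition _ :=
  GRing.isLinear.Build K 'rV[K]_5 {mpoly K[n]} _ section_quadric section_quadric_linear.

Lemma linear_forms_homog i : tnth (linear_forms A) i \is 1.-homog.
Proof. by rewrite tnth_mktuple; apply: rpred_sum => j _; apply/rpredZ/X_homog. Qed.

Lemma section_quadric_homog v : section_quadric v \is 2.-homog.
Proof. by have := homog_mPo (quadric_homog v) linear_forms_homog; rewrite mul1n. Qed.

Lemma section_quadric_eval v (y : 'rV[K]_n) : (section_quadric v).@[y ord0] = dot5 v (kap (y *m A)).
Proof. by rewrite meval_linear_forms quadric_eval. Qed.

Lemma quad_mx_section v : quad_mx (section_quadric v) = 2^-1 *: section_mx A v.
Proof.
apply: quad_mxE => // [|y].
  by rewrite linearZ /= /section_mx !trmx_mul trmxK tr_hodge_mx mulmxA.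
rewrite section_quadric_eval -scalemxAr -scalemxAl mxE /section_mx.
have -> : y *m (A *m hodge_mx v *m A^T) *m y^T = hodge v (y *m A) *m (y *m A)^T.
  by rewrite trmx_mul -mul_hodge_mx !mulmxA.
by rewrite hodge_quad mulrA mulVf // mul1r.
Qed.

Lemma quad_rank_section v : quad_rank (section_quadric v) = \rank (section_mx A v).
Proof. by rewrite /quad_rank quad_mx_section mxrank_scale_nz ?invr_neq0. Qed.

Definition section_ideal : seq {mpoly K[n]} := [seq q \mPo linear_forms A | q <- pluckers].

Lemma section_idealP q : q \in section_ideal -> exists v, q = section_quadric v.
Proof.
case/mapP => r /(nthP 0)[j j5 <-] ->.
by exists ((-1) ^+ j *: unit_row K j); rewrite quadric_unit_row.
Qed.

Lemma quadric_grassmannian v : vanishing_ideal (@grassmannian K) (quadric v).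
Proof.
move=> _ [M _ ->]; rewrite quadric_eval plucker_wedge kap_wedge /dot5 !mxE; ring.
Qed.

Hypothesis A_free : row_free A.

Lemma linear_sectionP (y : 'rV[K]_n) :
  linear_section A y <-> y != 0 /\ kap (y *m A) = 0.
Proof.
split=> -[y0 H]; split=> //.
  have Q v : dot5 v (kap (y *m A)) = 0.
    rewrite -section_quadric_eval; apply: H.
    by exists (quadric v) => //; apply: quadric_grassmannian.
  move: (kap _) Q => u Q; apply: row5P => k k5; rewrite [RHS]mxE.
  rewrite -[RHS](Q (unit_row K k)).
  by case5 k k5; rewrite /dot5 /unit_row !mxE -!val_eqE /= !inordK //=; ring.
move=> _ [f fG ->]; rewrite meval_linear_forms; apply: fG.
have yA0 : y *m A != 0.
  apply: contraNneq y0 => yA; apply/eqP/(row_free_inj A_free).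
  by rewrite yA mul0mx.
have [a [b ab]] := decomposable H yA0.
by rewrite ab in yA0 *; apply: grassmannian_wedge.
Qed.

Lemma vanishing_section_quadric v :
  vanishing_ideal (linear_section A) (section_quadric v).
Proof.
move=> y /linear_sectionP[_ k0]; rewrite section_quadric_eval k0 /dot5 !mxE; ring.
Qed.

(** f is extended to P^9 through the left inverse [pinvmx A] of the parametrisation of the linear
    space, where the ideal of the section is known by the last hypothesis, and then restricted
    again; the linear equations Ls restrict to 0. *)
Lemma section_ideal_vanishing (Ls : seq {mpoly K[10]}) f :
  (forall p, (forall q, q \in Ls -> q.@[p ord0] = 0) -> (p <= A)%MS) ->
  (forall q, q \in Ls -> q \mPo linear_forms A = 0) ->
  (forall g, vanishes_on_chart (Ls ++ pluckers) g -> idl (Ls ++ pluckers) g) ->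
  vanishing_ideal (linear_section A) f <-> idl section_ideal f.
Proof.
move=> LsA Ls0 H; split=> [f0|].
  pose L := [tuple \sum_i pinvmx A i a *: 'X_i | a < n] : n.-tuple {mpoly K[10]}.
  have LE p : (f \mPo L).@[p ord0] = f.@[(p *m pinvmx A) ord0].
    rewrite comp_mpoly_meval; apply: meval_eq => a; rewrite tnth_mktuple raddf_sum mxE.
    by apply: eq_bigr => i _; rewrite /= mevalZ mevalXU mulrC.
  have fL : vanishes_on_chart (Ls ++ pluckers) (f \mPo L).
    move=> p p0 Hp; pose r := \row_i p i.
    have E (g : {mpoly K[10]}) : g.@[p] = g.@[r ord0] by apply: meval_eq => i; rewrite mxE.
    have rA : (r <= A)%MS.
      by apply: LsA => q qLs; rewrite -E; apply: Hp; rewrite mem_cat qLs.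
    have r0 : r != 0 by apply: contraNneq p0 => /rowP/(_ (inord 0)); rewrite !mxE => ->.
    rewrite E LE; apply: f0; apply/linear_sectionP; rewrite mulmxKpV //; split.
      by apply: contraNneq r0 => r0; rewrite -(mulmxKpV rA) r0 mul0mx.
    have K0 j : (j < 5)%N -> (nth 0 pluckers j).@[r ord0] = 0.
      by move=> j5; rewrite -E; apply: Hp; rewrite mem_cat mem_nth ?orbT.
    apply: row5P => k k5; rewrite [RHS]mxE.
    have := K0 k k5; rewrite quadric_unit_row // quadric_eval => e.
    apply: (mulfI (_ : (-1) ^+ k != 0 :> K)); first by rewrite signr_eq0.
    rewrite mulr0 -[RHS]e; move=> {e}.
    by case5 k k5; rewrite /dot5 /unit_row; mx_simp; rewrite -!val_eqE /= !inordK //=; ring.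
  have := idl_mPo (linear_forms A) (H _ fL).
  have -> : (f \mPo L) \mPo linear_forms A = f.
    apply/eqP; rewrite -subr_eq0; apply/eqP/mpoly_eval0 => y.
    have E (g : {mpoly K[n]}) : g.@[y] = g.@[(\row_i y i) ord0].
      by apply: meval_eq => i; rewrite mxE.
    rewrite E; move: (\row_i y i) => r; rewrite mevalB meval_linear_forms LE.
    by rewrite -mulmxA mulmxVp // mulmx1 subrr.
  apply: idl_sub => q; rewrite map_cat mem_cat => /orP[|]; last exact: idl_gen.
  by case/mapP => r /Ls0-> ->; apply: idl0.
move: f; apply: (idl_ind (P := vanishing_ideal (linear_section A))) => [y _|f g f0 g0 y Xy|f q].
- exact: meval0.
- by rewrite mevalD f0 // g0 // addr0.
by case/section_idealP => v -> y Xy; rewrite mevalM vanishing_section_quadric // mulr0.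
Qed.

Hypothesis vanishingP :
  forall f, vanishing_ideal (linear_section A) f <-> idl section_ideal f.

Lemma pihomog0E (f : {mpoly K[n]}) : pihomog mdeg 0 f = (f@_0%MM)%:MP.
Proof.
elim/mpolyind: f => [|c m f _ _ IH]; first by rewrite pihomog0 mcoeff0 mpolyC0.
rewrite linearP /= IH mcoeffD mcoeffZ mpolyCD mcoeffX; congr (_ + _).
rewrite pihomogX mdeg_eq0; case: eqP => [->|_]; last by rewrite scaler0 mulr0 mpolyC0.
by rewrite mulr1 mpolyX0 alg_mpolyC.
Qed.

Lemma vanishing_quadric f : vanishing_ideal (linear_section A) f -> f \is 2.-homog ->
  exists v, f = section_quadric v.
Proof.
move=> /vanishingP fI fh; rewrite -(pihomog_dE fh); move: f fI {fh}.
apply: (idl_ind (P := fun f => exists v, pihomog mdeg 2 f = section_quadric v)).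
- by exists 0; rewrite pihomog0 linear0.
- by move=> f g [u fu] [v gv]; exists (u + v); rewrite pihomogD fu gv linearD.
move=> f q /section_idealP[v ->].
rewrite (pihomog_mulr _ _ (section_quadric_homog v)) /= pihomog0E.
by exists (f@_0%MM *: v); rewrite linearZ /= mul_mpolyC.
Qed.

Lemma section_generated m t (V : 'M[K]_(t, 5)) : row_full V ->
  (forall i, (\rank (section_mx A (row i V)) <= m)%N) ->
  generated_by_rank_le (vanishing_ideal (linear_section A)) m.
Proof.
move=> Vfull Vm.
pose S (q : {mpoly K[n]}) := exists2 i, q = section_quadric (row i V) & (quad_rank q <= m)%N.
exists S; split=> [q [i -> qm]|f].
  by split=> //; apply: section_quadric_homog.
have genD a b : ideal_generated S a -> ideal_generated S b -> ideal_generated S (a + b).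
  move=> [s sS ->] [r rS ->]; exists (s ++ r); last by rewrite big_cat.
  by move=> c; rewrite mem_cat => /orP[/sS|/rS].
have genM a b : ideal_generated S b -> ideal_generated S (a * b).
  move=> [s sS ->]; exists [seq (a * c.1, c.2) | c <- s].
    by move=> c /mapP[d /sS dS ->].
  by rewrite big_map mulr_sumr; apply: eq_bigr => c _; rewrite mulrA.
have gen0 : ideal_generated S 0 by exists [::] => //; rewrite big_nil.
have genQ v : ideal_generated S (section_quadric v).
  have /submxP[c ->] : (v <= V)%MS by apply: submx_full.
  rewrite mulmx_sum_row linear_sum; apply: (big_ind (ideal_generated S)) => // i _.
  rewrite linearZ /= -mul_mpolyC; apply: genM.
  exists [:: (1, section_quadric (row i V))]; last by rewrite big_seq1 mul1r.
  by move=> d; rewrite inE => /eqP->; exists i; rewrite //= quad_rank_section.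
split=> [/vanishingP|[s sS ->]].
  move: f; apply: (idl_ind (P := ideal_generated S)) => [//||f q /section_idealP[v ->]].
    by move=> a b; apply: genD.
  exact: genM.
move=> y Xy; rewrite raddf_sum /= big_seq big1 // => c /sS[i ci _].
by rewrite mevalM ci vanishing_section_quadric // mulr0.
Qed.

(** In degree 2, an ideal generated by quadrics is their linear span. Generators of rank below m
    come from vectors in V, so they only span quadrics coming from V. *)
Lemma section_not_generated m m' t (V : 'M[K]_(t, 5)) : (\rank V < 5)%N ->
  (forall v, (\rank (section_mx A v) < m)%N -> (v <= V)%MS) ->
  generated_by_rank_le (vanishing_ideal (linear_section A)) m' -> (m <= m')%N.
Proof.
move=> V5 Vm [S [Sm SI]]; rewrite leqNgt; apply/negP => mm'.
have [v vV] : exists v, ~~ (v <= V)%MS.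
  have : ~~ ((1%:M : 'M[K]_5) <= V)%MS.
    by apply/negP => /mxrankS; rewrite mxrank1 leqNgt V5.
  case/row_subPn => i iV; by exists (row i 1%:M).
case/negP: vV; have [s sS sv] := (SI (section_quadric v)).1 (vanishing_section_quadric v).
have [w wV wE] : exists2 w, (w <= V)%MS & pihomog mdeg 2 (section_quadric v) = section_quadric w.
  rewrite sv raddf_sum big_seq /=.
  apply: (big_ind (fun q => exists2 w, (w <= V)%MS & q = section_quadric w)).
  - by exists 0; rewrite ?sub0mx ?linear0.
  - by move=> _ _ [a aV ->] [b bV ->]; exists (a + b); rewrite ?addmx_sub ?linearD.
  move=> c /sS cS; have [c2 cm] := Sm _ cS.
  have [u cu] : exists u, c.2 = section_quadric u.
    apply: vanishing_quadric => //; apply/SI; exists [:: (1, c.2)]; last by rewrite big_seq1 mul1r.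
    by move=> d; rewrite inE => /eqP->.
  exists (c.1@_0%MM *: u).
    by apply/scalemx_sub/Vm; rewrite -quad_rank_section -cu (leq_ltn_trans cm).
  by rewrite (pihomog_mulr _ _ c2) /= pihomog0E cu linearZ /= mul_mpolyC.
(* The quadric of v - w is zero, of rank 0 < m, so v - w lies in V like w. *)
rewrite -(subrK w v) addmx_sub //; apply: Vm; rewrite -quad_rank_section linearB /=.
move: wE; rewrite pihomog_dE ?section_quadric_homog // => ->; rewrite subrr.
suff -> : quad_rank (0 : {mpoly K[n]}) = 0%N by apply: leq_trans mm'.
rewrite /quad_rank; suff -> : quad_mx (0 : {mpoly K[n]}) = 0 by rewrite mxrank0.
by apply/matrixP => i j; rewrite !mxE !mcoeff0 mul0r if_same.
Qed.

End LinearSection.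

End Assembly.

(** * Rank index of the sections in normal form *)

Section RankIndex.

Variable K : closedFieldType.
Hypothesis n2 : (2 : K) != 0.
Implicit Types (u v w : 'rV[K]_5) (x z p : 'rV[K]_10).

Notation omega0 := (omega0 K).
Notation omega1 := (omega1 K).
Notation X k := ('X_(inord k) : {mpoly K[10]}).
Notation pluckers := (plk (fun k => X k)).

Lemma rank_index_ext n (Y Y' : 'rV[K]_n -> Prop) m :
  (forall y, Y y <-> Y' y) -> rank_index Y m -> rank_index Y' m.
Proof.
move=> YY'; have E f : vanishing_ideal Y f <-> vanishing_ideal Y' f.
  by split=> H y /YY'; apply: H.
have G r : generated_by_rank_le (vanishing_ideal Y) r <-> generated_by_rank_le (vanishing_ideal Y') r.
  by split=> -[S [Sr SI]]; exists S; split=> // f; rewrite -SI; [apply: iff_sym|]; apply: E.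
by case=> /G Ym Ymin; split=> // m' /G; apply: Ymin.
Qed.

Lemma linear_section_wedge2 n (A : 'M[K]_(n, 10)) g : row_free A -> g \in unitmx ->
  row_free (A *m wedge2 g) /\
  forall y, linear_section (A *m wedge2 g) y <-> linear_section A y.
Proof.
move=> Afree gu; have A'free : row_free (A *m wedge2 g).
  by rewrite /row_free mxrankMfree // row_free_unit wedge2_unit.
split=> // y; rewrite (linear_sectionP A'free) (linear_sectionP Afree) mulmxA.
split=> -[y0 k0]; split=> //; last exact: kap_wedge2.
by have := kap_wedge2 (invmx g) k0; rewrite -mulmxA wedge2V // mulmx1.
Qed.

Lemma form_comp0 n (A : 'M[K]_(n, 10)) q x :
  (forall p, q.@[p ord0] = (p *m x^T) 0 0) -> annihilates A x -> q \mPo linear_forms A = 0.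
Proof.
move=> qE Ax; apply: mpoly_eval0 => y.
have -> : (q \mPo linear_forms A).@[y] = (q \mPo linear_forms A).@[(\row_i y i) ord0].
  by apply: meval_eq => i; rewrite mxE.
by rewrite meval_linear_forms qE -mulmxA Ax mulmx0 mxE.
Qed.

Lemma L0_eval p : (L0 K).@[p ord0] = (p *m omega0^T) 0 0.
Proof. by rewrite /L0 !eval_simp mxE sum_ord10; mx_simp; ring. Qed.

Lemma L1_eval p : (L1 K).@[p ord0] = (p *m omega1^T) 0 0.
Proof. by rewrite /L1 !eval_simp mxE sum_ord10; mx_simp; ring. Qed.

Lemma linform_eval p z : (linform (z ord0)).@[p ord0] = (p *m z^T) 0 0.
Proof.
rewrite raddf_sum mxE; apply: eq_bigr => i _.
by rewrite /= mevalM mevalC mevalXU mxE mulrC.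
Qed.

Section Annihilator.

Variables (n r : nat) (A : 'M[K]_(n, 10)) (W : 'M[K]_(r, 10)).
Hypotheses (nr : (n + r = 10)%N) (Afree : row_free A) (Wfree : row_free W).
Hypothesis WA : W *m A^T = 0.

Lemma annihilates_sub x : annihilates A x -> (x <= W)%MS.
Proof.
move=> /annihilates_tr xA; apply: (submx_trans (_ : (x <= kermx A^T)%MS)); first exact/sub_kermxP.
have : (W == kermx A^T)%MS; last by case/andP.
have WK : (W <= kermx A^T)%MS by apply/sub_kermxP.
by rewrite -(mxrank_leqif_eq WK) mxrank_ker mxrank_tr (eqP Afree) (eqP Wfree) -nr addKn.
Qed.

Lemma sub_section p : p *m W^T = 0 -> (p <= A)%MS.
Proof.
move=> pW; apply: (submx_trans (_ : (p <= kermx W^T)%MS)); first exact/sub_kermxP.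
have : (A == kermx W^T)%MS; last by case/andP.
have AK : (A <= kermx W^T)%MS.
  by apply/sub_kermxP; apply: trmx_inj; rewrite trmx_mul trmxK WA trmx0.
by rewrite -(mxrank_leqif_eq AK) mxrank_ker mxrank_tr (eqP Afree) (eqP Wfree) -nr addnK.
Qed.

Lemma section_rank_dichotomy v : v != 0 ->
  (6 <= \rank (section_mx A v))%N \/
  exists2 x, x != 0 & annihilates A x /\ ctr x v = 0.
Proof.
move=> v0; pose CW : 'M[K]_(r, 5) := \matrix_i ctr (row i W) v.
have ctr_sum (c : 'rV_r) : ctr (c *m W) v = c *m CW.
  rewrite !mulmx_sum_row; apply: (big_ind2 (fun x u => ctr x v = u)) => [|x a y b <- <-|i _].
  - by apply: row5P => k k5; case5 k k5; mx_simp; ring.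
  - exact: ctrDl.
  by rewrite ctrZl rowK.
have [c0|] := eqVneq (kermx CW) 0.
  left; apply: section_rank_ge6 => // x /annihilates_sub/submxP[c ->].
  by rewrite ctr_sum => /sub_kermxP; rewrite c0 submx0 => /eqP->; rewrite mul0mx.
case/rowV0Pn => c /sub_kermxP cW c0; right; exists (c *m W).
  by apply: contraNneq c0 => cW0; apply/eqP/(row_free_inj Wfree); rewrite cW0 mul0mx.
by rewrite ctr_sum; split=> //; apply/annihilates_tr; rewrite -mulmxA WA mulmx0.
Qed.

End Annihilator.

Lemma annihilator_exists n r (A : 'M[K]_(n, 10)) : (n + r = 10)%N -> row_free A ->
  exists2 W : 'M[K]_(r, 10), row_free W & W *m A^T = 0.
Proof.
move=> nr /eqP A_rank; have e : \rank (kermx A^T) = r.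
  by rewrite mxrank_ker mxrank_tr A_rank -nr addKn.
rewrite -e; exists (row_base (kermx A^T)); first exact: row_base_free.
by apply/sub_kermxP; rewrite eq_row_base.
Qed.

Lemma row_free_rows m (W : 'M[K]_(m, 10)) :
  (forall c : 'rV_m, c *m W = 0 -> c = 0) -> row_free W.
Proof. by move=> H; rewrite -kermx_eq0; apply/rowV0P => c /sub_kermxP/H. Qed.

Lemma rank_index5 (A : 'M[K]_(9, 10)) : row_free A -> rank4_forms A ->
  annihilates A omega0 -> rank_index (linear_section A) 6.
Proof.
move=> Afree nd A0.
have o0 : omega0 != 0.
  by apply/eqP => /rowP/(_ (inord 1))/eqP; rewrite row10E // mxE oner_eq0.
have W0free : row_free omega0 by rewrite /row_free rank_rV o0.
have W0A : omega0 *m A^T = 0 by exact/annihilates_tr.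
have vP f := @section_ideal_vanishing _ _ A Afree [:: L0 K] f.
have {}vP f : vanishing_ideal (linear_section A) f <-> idl (section_ideal A) f.
  apply: vP => [p Hp|q|g]; last exact: ideal5.
    apply: (sub_section _ Afree W0free W0A) => //.
    by rewrite [LHS]mx11_scalar -L0_eval Hp ?inE // raddf0.
  by rewrite inE => /eqP->; apply: form_comp0 L0_eval A0.
split.
  by apply: (section_generated n2 Afree vP (V := 1%:M)) => [|i]; [rewrite row_full_unit unitmx1 | exact: section_rank_le6].
move=> m'; apply: (section_not_generated n2 Afree vP (V := kap omega0)) => [|v rv].
  exact: leq_ltn_trans (rank_leq_row _) _.
have [->|v0] := eqVneq v 0; first exact: sub0mx.
have [|[x x0 [Ax xv]]] := section_rank_dichotomy (erefl : (9 + 1 = 10)%N) Afree W0free W0A v0.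
  by rewrite leqNgt rv.
have [a a0 kx] := kap_kernel nd Ax x0 v0 xv.
have /submxP[c xE] := annihilates_sub (erefl : (9 + 1 = 10)%N) Afree W0free W0A Ax.
have -> : v = a^-1 *: kap x by rewrite kx scalerA mulVf // scale1r.
by rewrite xE [c]mx11_scalar mul_scalar_mx kapZ !scalemx_sub.
Qed.

Lemma rank_index4 (A : 'M[K]_(8, 10)) : row_free A -> rank4_forms A ->
  annihilates A omega0 -> annihilates A omega1 -> rank_index (linear_section A) 6.
Proof.
move=> Afree nd A0 A1; pose W := col_mx omega0 omega1.
have Wfree : row_free W.
  apply: row_free_rows => c; rewrite -[c]hsubmxK mul_row_col.
  rewrite [lsubmx c]mx11_scalar [rsubmx c]mx11_scalar !mul_scalar_mx.
  move: (lsubmx c 0 0) (rsubmx c 0 0) => s t /rowP e.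
  have := e (inord 1); mx_simp; rewrite mulr1 mulr0 addr0 => ->.
  have := e (inord 2); mx_simp; rewrite mulr1 mulr0 add0r => ->.
  by apply/rowP => i; rewrite !mxE; case: splitP => j _; rewrite mxE mul0rn.
have WA : W *m A^T = 0.
  by rewrite mul_col_mx (annihilates_tr _ _).1 // (annihilates_tr _ _).1 // col_mx0.
have nr : (8 + (1 + 1) = 10)%N by [].
have vP f : vanishing_ideal (linear_section A) f <-> idl (section_ideal A) f.
  apply: (@section_ideal_vanishing _ _ A Afree [:: L1 K; L0 K] f) => [p Hp|q|g]; last exact: ideal4.
    apply: (sub_section nr Afree Wfree WA); rewrite tr_col_mx mul_mx_row.
    rewrite [p *m omega0^T]mx11_scalar [p *m omega1^T]mx11_scalar.
    by rewrite -L0_eval -L1_eval !Hp ?inE ?eqxx ?orbT // raddf0 row_mx0.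
  rewrite !inE => /orP[]/eqP->; first exact: form_comp0 L1_eval A1.
  exact: form_comp0 L0_eval A0.
split.
  by apply: (section_generated n2 Afree vP (V := 1%:M)) => [|i]; [rewrite row_full_unit unitmx1 | exact: section_rank_le6].
(* The span of all kernel vectors of the pencil, of dimension at most 3. *)
pose V := col_mx (kap omega0) (col_mx (kap2 omega0 omega1) (kap omega1)).
move=> m'; apply: (section_not_generated n2 Afree vP (V := V)) => [|v rv].
  exact: leq_ltn_trans (rank_leq_row _) _.
have [->|v0] := eqVneq v 0; first exact: sub0mx.
have [|[x x0 [Ax xv]]] := section_rank_dichotomy nr Afree Wfree WA v0.
  by rewrite leqNgt rv.
have [a a0 kx] := kap_kernel nd Ax x0 v0 xv.
have := annihilates_sub nr Afree Wfree WA Ax; rewrite -addsmxE => /sub_addsmxP[[c d] /= xE].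
have -> : v = a^-1 *: kap x by rewrite kx scalerA mulVf // scale1r.
rewrite xE [c]mx11_scalar [d]mx11_scalar !mul_scalar_mx kapD !kapZ kap2Z scalemx_sub //.
rewrite /V -!addsmxE; apply: addmx_sub; first apply: addmx_sub; apply: scalemx_sub.
- exact: addsmxSl.
- by apply: (submx_trans _ (addsmxSr _ _)); rewrite -addsmxE addsmxSr.
by apply: (submx_trans _ (addsmxSr _ _)); rewrite -addsmxE addsmxSl.
Qed.

Lemma rank_index3 (A : 'M[K]_(7, 10)) z : row_free A -> rank4_forms A ->
  annihilates A omega0 -> annihilates A omega1 -> annihilates A z -> z`_[7] = 1 ->
  rank_index (linear_section A) 5.
Proof.
move=> Afree nd A0 A1 Az z7; pose W := col_mx z (col_mx omega0 omega1).
have Wfree : row_free W.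
  apply: row_free_rows => c; rewrite -[c]hsubmxK mul_row_col -[rsubmx c]hsubmxK mul_row_col.
  rewrite [lsubmx c]mx11_scalar [lsubmx (rsubmx c)]mx11_scalar [rsubmx (rsubmx c)]mx11_scalar.
  rewrite !mul_scalar_mx; move: (lsubmx c 0 0) (lsubmx (rsubmx c) 0 0) (rsubmx (rsubmx c) 0 0).
  move=> r s t /rowP e.
  have r0 : r = 0 by have := e (inord 7); mx_simp; rewrite z7 !mulr0 !addr0 mulr1.
  have s0 : s = 0 by have := e (inord 1); mx_simp; rewrite r0 mul0r mulr1 mulr0 addr0 add0r.
  have t0 : t = 0 by have := e (inord 2); mx_simp; rewrite r0 s0 !mul0r mulr1 !add0r.
  rewrite r0 s0 t0; apply/rowP => i; rewrite !mxE; case: splitP => j _; rewrite !mxE ?mul0rn //.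
  by case: splitP => l _; rewrite mxE mul0rn.
have WA : W *m A^T = 0.
  by rewrite !mul_col_mx !(annihilates_tr _ _).1 // !col_mx0.
have nr : (7 + (1 + (1 + 1)) = 10)%N by [].
have vP f : vanishing_ideal (linear_section A) f <-> idl (section_ideal A) f.
  apply: (@section_ideal_vanishing _ _ A Afree [:: linform (z ord0); L1 K; L0 K] f) => [p Hp|q|g].
  - apply: (sub_section nr Afree Wfree WA); rewrite !tr_col_mx !mul_mx_row.
    rewrite [p *m omega0^T]mx11_scalar [p *m omega1^T]mx11_scalar [p *m z^T]mx11_scalar.
    by rewrite -L0_eval -L1_eval -linform_eval !Hp ?inE ?eqxx ?orbT // raddf0 !row_mx0.
  - rewrite !inE => /orP[/eqP->|/orP[]/eqP->].
    + exact: form_comp0 (linform_eval ^~ z) Az.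
    + exact: form_comp0 L1_eval A1.
    exact: form_comp0 L0_eval A0.
  exact: ideal3.
split; last first.
  move=> m'; apply: (section_not_generated n2 Afree vP (V := 0 : 'M_(1, 5))) => [|v rv].
    by rewrite mxrank0.
  have [->|v0] := eqVneq v 0; first exact: sub0mx.
  have [r6|[x x0 [Ax xv]]] := section_rank_dichotomy nr Afree Wfree WA v0.
    by have := leq_trans rv (ltnW r6); rewrite ltnn.
  have kx : kap x != 0 by apply: contra_neq x0; exact: nd.
  suff r5 : (5 <= \rank (section_mx A v))%N by rewrite leqNgt rv in r5.
  apply: (section_rank_ge5 v0 Ax xv kx n2) => y Ay yv.
  have [s [t [st0 e]]] := common_kernel nd v0 Ax Ay xv yv.
  have t0 : t != 0.
    apply: contraNneq st0 => t0; move/eqP: e; rewrite t0 scale0r addr0 scaler_eq0.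
    by rewrite (negPf x0) orbF => /eqP->.
  exists (- s / t); apply: (scalerI t0); rewrite scalerA mulrC divfK //.
  by apply/eqP; rewrite scaleNr -addr_eq0 addrC e.
(* Enough forms to recover [kap] and its polarisation on the net; their kernel vectors span V, and
   each gives a quadric of rank at most 5. *)
pose xs := [:: omega0; omega1; z; omega0 + omega1; omega0 + z; omega1 + z].
have xsA i : (i < 6)%N -> annihilates A (nth 0 xs i).
  by case: i => [|[|[|[|[|[|//]]]]]] _ //=; apply: annihilatesD.
have xs0 i : (i < 6)%N -> nth 0 xs i != 0.
  case: i => [|[|[|[|[|[|//]]]]]] _; apply/eqP => /rowP e.
  - by have := e (inord 1); mx_simp => /eqP; rewrite oner_eq0.
  - by have := e (inord 2); mx_simp => /eqP; rewrite oner_eq0.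
  - by have := e (inord 7); mx_simp => /eqP; rewrite z7 oner_eq0.
  - by have := e (inord 1); mx_simp => /eqP; rewrite addr0 oner_eq0.
  - by have := e (inord 7); mx_simp => /eqP; rewrite z7 add0r oner_eq0.
  by have := e (inord 7); mx_simp => /eqP; rewrite z7 add0r oner_eq0.
pose V : 'M[K]_(6, 5) := \matrix_i kap (nth 0 xs i).
apply: (section_generated n2 Afree vP (V := V)) => [|i].
  rewrite /row_full -mxrank_tr -/(row_free V^T) -kermx_eq0; apply/rowV0P => v /sub_kermxP/rowP e.
  have E i : (i < 6)%N -> dot5 v (kap (nth 0 xs i)) = 0.
    move=> i6; have VE j : V^T j (inord i) = kap (nth 0 xs i) 0 j.
      by rewrite [LHS]mxE [LHS]mxE inordK.
    by have := e (inord i); rewrite [RHS]mxE mxE sum_ord5 !VE.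
  apply: (net_kap_span nd A0 A1 Az z7).
  - exact: (E 0%N).
  - exact: (E 1%N).
  - exact: (E 2%N).
  - exact: (E 3%N).
  - exact: (E 4%N).
  exact: (E 5%N).
rewrite rowK; apply: (section_rank_le5 (xsA i (ltn_ord i)) (xs0 i (ltn_ord i)) (ctr_kap _)).
by apply: contra_neq (xs0 i (ltn_ord i)) => /(nd _ (xsA i (ltn_ord i))).
Qed.

End RankIndex.

Theorem theorem6p3 (K : closedFieldType) (char_neq2 : 2%N \notin [pchar K])
  (k : nat) (k_ge3 : (3 <= k)%N) (k_le5 : (k <= 5)%N)
  (A : 'M[K]_(k + 4, 10)) (A_free : row_free A)
  (X_dim : proj_dim (linear_section A) k)
  (X_smooth : smooth_scheme (linear_section_ideal A)) :
  rank_index (linear_section A) (if (k == 3)%N then 5 else 6)%N.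
Proof.
have n2 : (2 : K) != 0 by apply: contra char_neq2; rewrite inE /=.
have nd := smooth_rank4_forms k_ge3 A_free X_dim X_smooth.
case: k k_ge3 k_le5 A A_free {X_dim X_smooth} nd => [|[|[|[|[|[|//]]]]]] // _ _ A Afree nd.
- have [W Wfree WA] := annihilator_exists (erefl : (3 + 4 + 3 = 10)%N) Afree.
  have Wann i : annihilates A (row i W) by apply/annihilates_tr; rewrite -row_mul WA row0.
  have [i0 [i1 [i2 indep]]] := independent_rows Wfree isT.
  have [g [a [b [c [d [gu gx gy gz]]]]]] :=
    net_normal_form nd n2 (Wann i0) (Wann i1) (Wann i2) indep.
  have gu' : invmx g \in unitmx by rewrite unitmx_inv.
  have [A'free A'E] := linear_section_wedge2 Afree gu'.
  apply: rank_index_ext A'E _.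
  have pb := pullback_annihilates gu.
  (* The third equation is rescaled so that its coordinate 7 is 1. *)
  apply: (rank_index3 n2 (z := (pullback g (row i2 W) 0 (inord 7))^-1 *: pullback g (row i2 W))) => //.
  + exact: rank4_forms_mul.
  + by rewrite -gx; apply: pb; apply: annihilatesD; apply: annihilatesZ.
  + by rewrite -gy; apply: pb; apply: annihilatesD; apply: annihilatesZ.
  + by apply: annihilatesZ; apply: pb.
  by rewrite mxE mulVf.
- have [W Wfree WA] := annihilator_exists (erefl : (4 + 4 + 2 = 10)%N) Afree.
  have Wann i : annihilates A (row i W) by apply/annihilates_tr; rewrite -row_mul WA row0.
  have indep : free2 (row ord0 W) (row ord_max W).
    move=> s t; rewrite !rowE !scalemxAl -mulmxDl => e.
    have /rowP y : s *: delta_mx 0 ord0 + t *: delta_mx 0 ord_max = 0 :> 'rV[K]_2.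
      by apply: (row_free_inj Wfree); rewrite mul0mx.
    have := (y ord0, y ord_max); rewrite !mxE /= !(mulr0, mulr1, addr0, add0r).
    by case.
  have [g [gu gx gy _ _]] := pencil_normal_form nd (Wann ord0) (Wann ord_max) indep.
  have gu' : invmx g \in unitmx by rewrite unitmx_inv.
  have [A'free A'E] := linear_section_wedge2 Afree gu'.
  apply: rank_index_ext A'E _.
  apply: (rank_index4 n2) => //.
  + exact: rank4_forms_mul.
  + by rewrite -gx; apply: pullback_annihilates.
  by rewrite -gy; apply: pullback_annihilates.
have [W Wfree WA] := annihilator_exists (erefl : (5 + 4 + 1 = 10)%N) Afree.
have WA' : annihilates A W by apply/annihilates_tr.
have W0 : W != 0 by move: Wfree; rewrite /row_free rank_rV eqb1.
have [g gu gx] := rank4_normal_form (kap_neq0 nd WA' W0).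
have gu' : invmx g \in unitmx by rewrite unitmx_inv.
have [A'free A'E] := linear_section_wedge2 Afree gu'.
apply: rank_index_ext A'E _.
apply: (rank_index5 n2) => //; first exact: rank4_forms_mul.
by rewrite -gx; apply: pullback_annihilates.
Qed.
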